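(* Let $d\ge1$ and let $\hat{\mathcal G}(d)$ be the $\mathbb C$-vector space with basis the regular dot Brauer $d$-diagrams. The affine periplectic Brauer algebra $\widehat P_d^-$ can be realized as a diagram algebra with basis consisting of the regular dot Brauer $d$-diagrams: with multiplication given by concatenation (evaluated as described in the context), $\hat{\mathcal G}(d)$ is isomorphic to $\widehat P_d^-$ as an associative algebra via the identification under which (i) $s_i$ is the undotted diagram with edges $\{i,\overline{i+1}\},\{i+1,\bar i\}$ and $\{j,\bar j\}$ for $j\ne i,i+1$; (ii) $\varepsilon_i$ is the undotted diagram with edges $\{i,i+1\},\{\bar i,\overline{i+1}\}$ and $\{j,\bar j\}$ for $j\neq i,i+1$; (iii) $y_i$ is the identity diagram (edges $\{j,\bar j\}$ for all $j$) with one dot on its $i$-th vertical line. Under this identification the regular monomials correspond to the regular dot Brauer $d$-diagrams.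
   Context: The affine periplectic Brauer algebra $\widehat P_d^-$ is the associative unital $\mathbb C$-algebra generated by $s_a,\varepsilon_a$ ($1\le a\le d-1$), $y_j$ ($1\le j\le d$), subject to (for all indices for which the symbols make sense): (P.1) $s_a^2=1$; (P.2) $s_as_b=s_bs_a$ for $|a-b|>1$; $s_cs_{c+1}s_c=s_{c+1}s_cs_{c+1}$; $s_ay_i=y_is_a$ for $i\notin\{a,a+1\}$; (P.3) $\varepsilon_a^2=0$; (P.4) $\varepsilon_1y_1^k\varepsilon_1=0$ for all integers $k\ge1$; (P.5) $s_a\varepsilon_b=\varepsilon_bs_a$ and $\varepsilon_a\varepsilon_b=\varepsilon_b\varepsilon_a$ for $|a-b|>1$; $\varepsilon_ay_i=y_i\varepsilon_a$ for $i\notin\{a,a+1\}$; $y_iy_j=y_jy_i$; (P.6) $\varepsilon_as_a=-\varepsilon_a=-s_a\varepsilon_a$; $s_c\varepsilon_{c+1}\varepsilon_c=-s_{c+1}\varepsilon_c$, $\varepsilon_c\varepsilon_{c+1}s_c=\varepsilon_cs_{c+1}$; $\varepsilon_{c+1}\varepsilon_cs_{c+1}=-\varepsilon_{c+1}s_c$, $s_{c+1}\varepsilon_c\varepsilon_{c+1}=s_c\varepsilon_{c+1}$; $\varepsilon_{c+1}\varepsilon_c\varepsilon_{c+1}=-\varepsilon_{c+1}$, $\varepsilon_c\varepsilon_{c+1}\varepsilon_c=-\varepsilon_c$; (P.7) $s_ay_a-y_{a+1}s_a=\varepsilon_a-1$, $y_as_a-s_ay_{a+1}=-\varepsilon_a-1$;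 (P.8) $\varepsilon_a(y_a-y_{a+1})=\varepsilon_a$, $(y_a-y_{a+1})\varepsilon_a=-\varepsilon_a$. Diagrams. $\mathcal G(d)$ is the set of Brauer $(d,d)$-diagrams: partitions into pairs (edges) of the vertices $1,\dots,d$ (top row) and $\bar1,\dots,\bar d$ (bottom row). A horizontal edge joins two vertices of the same row; in the top row it is called a cup, in the bottom row a cap; its right end is the vertex with the larger index. A dot Brauer $d$-diagram is a Brauer $(d,d)$-diagram with finitely many dots (with multiplicity), each attached to an end of one of its edges (top or bottom end of a propagating edge, left or right end of a horizontal edge). Dots may move freely along a vertical line of the identity diagram. A dot Brauer $d$-diagram is regular if (1) every dot at the bottom is attached to the right end of a cap, and (2) no dot is attached to the right end of a cup. Correspondence with monomials. A product corresponds to vertical concatenation with the left factor on top. Each $\gamma\in\mathcal G(d)$ is regarded as an element of $\widehat P_d^-$ by choosing a word in the $s_a,\varepsilon_a$ whose concatenation produces $\gamma$ without closed loops (well defined up to sign; one choice is fixed for each $\gamma$, namely $s_a,\varepsilon_a$ themselves for the diagrams (i),(ii)). The dot diagram with underlying $\gamma$, with $i_k$ dots at the vertex $k$ and $j_k$ dots at the vertex $\bar k$, represents the monomial $y_1^{i_1}\cdots y_d^{i_d}\,\gamma\,y_1^{j_1}\cdots y_d^{j_d}$; this monomial is called regular if the dot diagram is regular, i.e. $i_k=0$ whenever $k$ is the right end of a top horizontal edge of $\gamma$, and $j_t\neq0$ only if $\bar t$ is the right end of a bottom horizontal edge of $\gamma$. Multiplication on $\hat{\mathcal G}(d)$. The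 product of two regular dot diagrams is obtained by stacking the first on top of the second, and then using the diagrammatic translations (under (i)–(iii)) of the relations (P.1)–(P.8) to move dots from the middle to the top or bottom, to straighten the underlying Brauer diagrams (with the signs given by the relations), and to rewrite the result as a linear combination of regular dot Brauer $d$-diagrams; if a closed circle appears (with or without dots) the result is $0$. *)

(* Defs.v *)
From HB Require Import structures.
From Stdlib Require Import Relation_Operators.
From mathcomp Require Import all_boot all_order all_algebra all_fingroup.
From mathcomp Require Import generic_quotient ring_quotient.
From mathcomp Require Import boolp reals complex.
From mathcomp Require Import finmap monalg.

Set Implicit Arguments.
Unset Strict Implicit.
Unset Printing Implicit Defensive.

Import GRing.Theory.
Local Open Scope ring_scope.
Local Open Scope quotient_scope.

(* Indices are shifted: strands are 'I_d and the generators s_a, eps_a are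
   indexed by 'I_d.-1; lo a and hi a are the strands a and a + 1. *)

Lemma hi_subproof d (a : 'I_d.-1) : (a.+1 < d)%N.
Proof. by case: d a => [|d] [a]. Qed.

Definition lo d (a : 'I_d.-1) : 'I_d := widen_ord (leq_pred d) a.
Definition hi d (a : 'I_d.-1) : 'I_d := Ordinal (hi_subproof a).

Lemma lo_neq_hi d (a : 'I_d.-1) : lo a != hi a.
Proof. by rewrite -val_eqE /= neq_ltn ltnSn. Qed.

Definition far n (a b : 'I_n) : bool := (a.+1 < b)%N || (b.+1 < a)%N.

Section Brauer.
Variable d : nat.

(* inl k is the k-th top vertex, inr k the k-th bottom vertex *)
Definition vertex : finType := ('I_d + 'I_d)%type.

Definition is_brauer (E : {set {set vertex}}) : bool :=
  partition E [set: vertex] && [forall B in E, #|B| == 2].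

Definition brauer := {E : {set {set vertex}} | is_brauer E}.

(* Stacking E on top of F: the bottom row of E is glued to the top row of F.
   The nodes are inl (inl k) (top), inl (inr k) (middle), inr k (bottom). *)
Definition node : finType := ('I_d + 'I_d + 'I_d)%type.

Definition upper (u : vertex) : node := inl u.
Definition lower (u : vertex) : node :=
  match u with inl k => inl (inr k) | inr k => inr k end.
Definition outer (u : vertex) : node :=
  match u with inl k => inl (inl k) | inr k => inr k end.
Definition middle (k : 'I_d) : node := inl (inr k).

Definition glued (E F : {set {set vertex}}) : rel node := fun x y =>
  [exists u : vertex, exists v : vertex,
     [&& [set u; v] \in E, x == upper u & y == upper v]
     || [&& [set u; v] \in F, x == lower u & y == lower v]].

Definition concat (E F : {set {set vertex}}) : {set {set vertex}} :=
  [set B : {set vertex} | [exists u : vertex, exists v : vertex,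
     [&& u != v, connect (glued E F) (outer u) (outer v) & B == [set u; v]]]].

Definition closed_loop (E F : {set {set vertex}}) : bool :=
  [exists k : 'I_d,
     [forall u : vertex, ~~ connect (glued E F) (middle k) (outer u)]].

Definition edges_of (f : vertex -> vertex) : {set {set vertex}} :=
  [set [set u; f u] | u : vertex].

Lemma edges_of_brauer (f : vertex -> vertex) :
  involutive f -> (forall u, f u != u) -> is_brauer (edges_of f).
Proof.
move=> fK f_neq; apply/andP; split; last first.
  apply/forall_inP => B /imsetP[u _ ->].
  by rewrite cards2 (eq_sym u) f_neq.
apply/and3P; split.
- apply/eqP/setP => u; rewrite inE; apply/bigcupP.
  by exists [set u; f u]; [apply: imset_f | rewrite set21].
- apply/trivIsetP => A B /imsetP[u _ ->] /imsetP[v _ ->] neq.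
  rewrite -setI_eq0; apply/eqP/setP => x; rewrite !inE.
  apply: contraNF neq; case/andP => /orP[]/eqP-> /orP[]/eqP E.
  + by rewrite E.
  + by rewrite E fK setUC.
  + by rewrite -E fK setUC.
  + by rewrite (can_inj fK E).
- apply/imsetP => -[u _ /setP/(_ u)]; by rewrite in_set0 set21.
Qed.

Definition flip (u : vertex) : vertex :=
  match u with inl k => inr k | inr k => inl k end.

Definition cross (a : 'I_d.-1) (u : vertex) : vertex :=
  match u with
  | inl k => inr (tperm (lo a) (hi a) k)
  | inr k => inl (tperm (lo a) (hi a) k)
  end.

Definition turn (a : 'I_d.-1) (u : vertex) : vertex :=
  match u with
  | inl k => if k \in pred2 (lo a) (hi a)
             then inl (tperm (lo a) (hi a) k) else inr k
  | inr k => if k \in pred2 (lo a) (hi a)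
             then inr (tperm (lo a) (hi a) k) else inl k
  end.

Lemma id_brauer : is_brauer (edges_of flip).
Proof. by apply: edges_of_brauer; case. Qed.

Lemma s_brauer a : is_brauer (edges_of (cross a)).
Proof. by apply: edges_of_brauer; case=> k //=; rewrite tpermK. Qed.

Lemma eps_brauer a : is_brauer (edges_of (turn a)).
Proof.
have nlh := lo_neq_hi a.
apply: edges_of_brauer => -[] k /=; case: ifP => /=.
- by move=> /orP[]/eqP-> /=; rewrite ?(tpermL, tpermR) !inE eqxx ?orbT /=
    ?(tpermL, tpermR).
- by move->.
- by move=> /orP[]/eqP-> /=; rewrite ?(tpermL, tpermR) !inE eqxx ?orbT /=
    ?(tpermL, tpermR).
- by move->.
- by case/orP => /eqP->; rewrite ?(tpermL, tpermR) (inj_eq inl_inj) // eq_sym.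
- by [].
- by case/orP => /eqP->; rewrite ?(tpermL, tpermR) (inj_eq inr_inj) // eq_sym.
- by [].
Qed.

Definition id_diag : brauer := exist is_brauer _ id_brauer.
Definition s_diag a : brauer := exist is_brauer _ (s_brauer a).
Definition eps_diag a : brauer := exist is_brauer _ (eps_brauer a).

Inductive letter := LS of 'I_d.-1 | LE of 'I_d.-1.

Definition letter_code (g : letter) : 'I_d.-1 + 'I_d.-1 :=
  match g with LS a => inl a | LE a => inr a end.
Definition letter_decode (g : 'I_d.-1 + 'I_d.-1) : letter :=
  match g with inl a => LS a | inr a => LE a end.
Lemma letter_codeK : cancel letter_code letter_decode.
Proof. by case. Qed.
HB.instance Definition _ := Choice.copy letter (can_type letter_codeK).

Definition letter_diag (g : letter) : brauer :=
  match g with LS a => s_diag a | LE a => eps_diag a end.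

Fixpoint word_edges (l : seq letter) : {set {set vertex}} :=
  if l is g :: l' then concat (val (letter_diag g)) (word_edges l')
  else val id_diag.

Fixpoint loop_free (l : seq letter) : bool :=
  if l is g :: l' then
    ~~ closed_loop (val (letter_diag g)) (word_edges l') && loop_free l'
  else true.

(* a choice, for each Brauer diagram, of a loop-free word producing it *)
Definition word_choice (w : brauer -> seq letter) : Prop :=
  [/\ forall g, word_edges (w g) = val g,
      forall g, loop_free (w g),
      forall a, w (s_diag a) = [:: LS a]
    & forall a, w (eps_diag a) = [:: LE a]].

Definition dot_diagram : Type :=
  (brauer * {ffun 'I_d -> nat} * {ffun 'I_d -> nat})%type.
HB.instance Definition _ := Choice.on dot_diagram.

Definition shape (D : dot_diagram) : brauer := D.1.1.
Definition top_dots (D : dot_diagram) : {ffun 'I_d -> nat} := D.1.2.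
Definition bot_dots (D : dot_diagram) : {ffun 'I_d -> nat} := D.2.

Definition cup_right_end (g : brauer) (k : 'I_d) : bool :=
  [exists l : 'I_d, (l < k)%N && ([set inl l; inl k] \in val g)].
Definition cap_right_end (g : brauer) (k : 'I_d) : bool :=
  [exists l : 'I_d, (l < k)%N && ([set inr l; inr k] \in val g)].

Definition regular (D : dot_diagram) : bool :=
  [forall k, (bot_dots D k != 0)%N ==> cap_right_end (shape D) k]
  && [forall k, cup_right_end (shape D) k ==> (top_dots D k == 0)%N].

Definition reg_diagram := {D : dot_diagram | regular D}.

Lemma undotted_regular (g : brauer) : regular (g, [ffun=> 0%N], [ffun=> 0%N]).
Proof.
by apply/andP; split; apply/forallP => k; apply/implyP; rewrite !ffunE.
Qed.

Lemma dotted_line_regular (i : 'I_d) :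
  regular (id_diag, [ffun k => (k == i) : nat], [ffun=> 0%N]).
Proof.
apply/andP; split; apply/forallP => k; apply/implyP; rewrite ?ffunE //.
case/existsP=> l /andP[_ /imsetP[[] u _] /setP E].
  by have := E (inr u); rewrite !inE eqxx orbT.
by have := E (inr u); rewrite !inE eqxx.
Qed.

Definition undotted (g : brauer) : reg_diagram :=
  exist regular _ (undotted_regular g).
Definition dotted_line (i : 'I_d) : reg_diagram :=
  exist regular _ (dotted_line_regular i).

End Brauer.

Section Relations.
Variables (d : nat) (A : nzRingType) (s e : 'I_d.-1 -> A) (y : 'I_d -> A).

Inductive relation : A -> A -> Prop :=
| P1 a : relation (s a * s a) 1
| P2_far a b : far a b -> relation (s a * s b) (s b * s a)
| P2_braid (c c' : 'I_d.-1) : c' = c.+1 :> nat ->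
    relation (s c * s c' * s c) (s c' * s c * s c')
| P2_y a i : i != lo a -> i != hi a -> relation (s a * y i) (y i * s a)
| P3 a : relation (e a * e a) 0
| P4 (a : 'I_d.-1) k : a = 0%N :> nat -> (1 <= k)%N ->
    relation (e a * y (lo a) ^+ k * e a) 0
| P5_se a b : far a b -> relation (s a * e b) (e b * s a)
| P5_ee a b : far a b -> relation (e a * e b) (e b * e a)
| P5_ey a i : i != lo a -> i != hi a -> relation (e a * y i) (y i * e a)
| P5_yy i j : relation (y i * y j) (y j * y i)
| P6_es a : relation (e a * s a) (- e a)
| P6_se a : relation (- e a) (- (s a * e a))
| P6_see (c c' : 'I_d.-1) : c' = c.+1 :> nat ->
    relation (s c * e c' * e c) (- (s c' * e c))
| P6_ees (c c' : 'I_d.-1) : c' = c.+1 :> nat ->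
    relation (e c * e c' * s c) (e c * s c')
| P6_ees' (c c' : 'I_d.-1) : c' = c.+1 :> nat ->
    relation (e c' * e c * s c') (- (e c' * s c))
| P6_see' (c c' : 'I_d.-1) : c' = c.+1 :> nat ->
    relation (s c' * e c * e c') (s c * e c')
| P6_eee' (c c' : 'I_d.-1) : c' = c.+1 :> nat ->
    relation (e c' * e c * e c') (- e c')
| P6_eee (c c' : 'I_d.-1) : c' = c.+1 :> nat ->
    relation (e c * e c' * e c) (- e c)
| P7_sy a : relation (s a * y (lo a) - y (hi a) * s a) (e a - 1)
| P7_ys a : relation (y (lo a) * s a - s a * y (hi a)) (- e a - 1)
| P8_l a : relation (e a * (y (lo a) - y (hi a))) (e a)
| P8_r a : relation ((y (lo a) - y (hi a)) * e a) (- e a).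

End Relations.

Lemma relation_morph d (A B : nzRingType) (f : {rmorphism A -> B})
    (s e : 'I_d.-1 -> A) (y : 'I_d -> A) l r :
  relation s e y l r -> relation (f \o s) (f \o e) (f \o y) (f l) (f r).
Proof.
pose fE := (rmorphM f, rmorphB f, rmorphN f, rmorph0 f, rmorph1 f,
  rmorphXn f).
case=> *; rewrite ?fE.
all: by [exact: P1 | exact: P2_far | exact: P2_braid | exact: P2_y | exact: P3
  | exact: P4 | exact: P5_se | exact: P5_ee | exact: P5_ey | exact: P5_yy
  | exact: P6_es | exact: P6_se | exact: P6_see | exact: P6_ees
  | exact: P6_ees' | exact: P6_see' | exact: P6_eee' | exact: P6_eee
  | exact: P7_sy | exact: P7_ys | exact: P8_l | exact: P8_r].
Qed.

Section Algebra.
Variables (C : fieldType) (d : nat).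

Definition generator : choiceType := (letter d + 'I_d)%type.

(* The free associative algebra: a word in the generators is a vertical stack
   of elementary diagrams, the leftmost letter being on top. *)
Definition stacks := {malg C[{fmonom generator}]}.
HB.instance Definition _ := GRing.Lalgebra.on stacks.

Definition fgen (g : generator) : stacks := << fmu g >>.
Definition fs a : stacks := fgen (inl (LS a)).
Definition fe a : stacks := fgen (inl (LE a)).
Definition fy i : stacks := fgen (inr i).

Inductive in_ideal : stacks -> Prop :=
| ideal0 : in_ideal 0
| ideal_rel l r : relation fs fe fy l r -> in_ideal (l - r)
| idealD x y : in_ideal x -> in_ideal y -> in_ideal (x + y)
| idealMl x y : in_ideal y -> in_ideal (x * y)
| idealMr x y : in_ideal x -> in_ideal (x * y).

Definition ideal : {pred stacks} := fun x => `[< in_ideal x >].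

Lemma ideal_zmod_closed : zmod_closed ideal.
Proof.
split=> [|x y /asboolP Ix /asboolP Iy]; apply/asboolP; first exact: ideal0.
by apply: idealD => //; rewrite -mulN1r; apply: idealMl.
Qed.
HB.instance Definition _ := GRing.isZmodClosed.Build stacks ideal
  ideal_zmod_closed.

Definition periplectic : Type := Quotient.quot ideal.
HB.instance Definition _ := GRing.Zmodule.on periplectic.

Definition proj (x : stacks) : periplectic := \pi_(Quotient.quot ideal) x.

Lemma proj_eqP x y : proj x = proj y <-> in_ideal (x - y).
Proof.
split=> [/eqP|I]; first by rewrite /proj piE => /asboolP.
by apply/eqP; rewrite /proj piE; apply/asboolP.
Qed.

Lemma projK (x : periplectic) : proj (repr x) = x.
Proof. exact: reprK. Qed.

Lemma proj_zmod_morphism : zmod_morphism proj.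
Proof. by move=> x y; rewrite /proj !piE. Qed.
HB.instance Definition _ :=
  GRing.isZmodMorphism.Build stacks periplectic proj proj_zmod_morphism.

Definition pmul (x y : periplectic) : periplectic := proj (repr x * repr y).
Definition pscale (c : C) (x : periplectic) : periplectic := proj (c *: repr x).

Lemma repr_projB x : in_ideal (repr (proj x) - x).
Proof. by apply/proj_eqP; rewrite projK. Qed.

Lemma proj_pmul x y : pmul (proj x) (proj y) = proj (x * y).
Proof.
apply/proj_eqP; set x' := repr _; set y' := repr _.
have -> : x' * y' - x * y = x' * (y' - y) + (x' - x) * y.
  by rewrite mulrBr mulrBl addrA subrK.
by apply: idealD; [apply: idealMl | apply: idealMr]; apply: repr_projB.
Qed.

Lemma proj_pscale c x : pscale c (proj x) = proj (c *: x).
Proof.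
apply/proj_eqP; rewrite -scalerBr -[_ - _]mul1r scalerAl.
by apply: idealMl; apply: repr_projB.
Qed.

Lemma stacks_scaleAr (c : C) (x y : stacks) : c *: (x * y) = x * (c *: y).
Proof.
have mulC (z : stacks) : c *: z = z * c%:MP.
  rewrite malgM_def fgmulgU; apply/eq_bigr => k _.
  by rewrite mulm1 mulrC.
by rewrite !mulC mulrA.
Qed.

(* The one-dimensional representation s_a = 1, eps_a = 0, y_j = j, used only
   to show that the quotient is not the zero ring. *)
Definition triv_gen (g : generator) : C :=
  match g with inl (LS _) => 1 | inl (LE _) => 0 | inr j => (j : nat)%:R end.
Definition triv_monom (u : {fmonom generator}) : C :=
  \prod_(g <- (u : seq generator)) triv_gen g.
Lemma triv_monomP : {morph triv_monom : x y / mmul x y >-> x * y}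
  /\ triv_monom mone = 1.
Proof.
split=> [x y|]; rewrite /triv_monom; first by rewrite fmM big_cat.
by rewrite fm1 big_nil.
Qed.
HB.instance Definition _ := isMultiplicative.Build {fmonom generator} C
  triv_monom triv_monomP.
Definition triv : stacks -> C := mmap idfun triv_monom.
HB.instance Definition _ := GRing.RMorphism.on triv.

Lemma triv_fgen g : triv (fgen g) = triv_gen g.
Proof. by rewrite /triv mmapU /= mul1r /triv_monom fmU big_seq1. Qed.

Lemma triv_relation_eq (s e : 'I_d.-1 -> C) (y : 'I_d -> C) l r :
  (forall a, s a = 1) -> (forall a, e a = 0) ->
  (forall i, y i = (i : nat)%:R) -> relation s e y l r -> l = r.
Proof.
move=> sE eE yE.
have hiS (a : 'I_d.-1) : (hi a : nat)%:R = (lo a : nat)%:R + 1 :> C.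
  by rewrite /= -addn1 natrD.
case=> *; rewrite ?(sE, eE, yE) ?hiS
  ?(mulr0, mul0r, mulr1, mul1r, oppr0, sub0r) //.
all: by [rewrite opprD addrA subrr sub0r | rewrite mulrC].
Qed.

Lemma triv_relation l r : relation fs fe fy l r -> triv l = triv r.
Proof.
move=> lr; apply: (@triv_relation_eq (triv \o fs) (triv \o fe) (triv \o fy)).
- by move=> a; apply: triv_fgen.
- by move=> a; apply: triv_fgen.
- by move=> i; apply: triv_fgen.
- exact: (relation_morph triv lr).
Qed.

Lemma triv_ideal x : in_ideal x -> triv x = 0.
Proof.
have tD y z : triv (y + z) = triv y + triv z by exact: (rmorphD triv).
have tB y z : triv (y - z) = triv y - triv z by exact: (rmorphB triv).
have tM y z : triv (y * z) = triv y * triv z by exact: (rmorphM triv).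
elim=> [|l r lr|y z _ Iy _ Iz|y z _ Iz|y z _ Iy].
- exact: (rmorph0 triv).
- by rewrite tB (triv_relation lr) subrr.
- by rewrite tD Iy Iz addr0.
- by rewrite tM Iz mulr0.
- by rewrite tM Iy mul0r.
Qed.

Lemma pmulA : associative pmul.
Proof. by move=> x y z; rewrite -[x]projK -[y]projK -[z]projK !proj_pmul mulrA. Qed.
Lemma pmul1l : left_id (proj 1) pmul.
Proof. by move=> x; rewrite -[x]projK proj_pmul mul1r. Qed.
Lemma pmul1r : right_id (proj 1) pmul.
Proof. by move=> x; rewrite -[x]projK proj_pmul mulr1. Qed.
Lemma pmulDl : left_distributive pmul +%R.
Proof.
move=> x y z; rewrite -[x]projK -[y]projK -[z]projK.
by rewrite !(proj_pmul, =^~ raddfD) /= mulrDl.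
Qed.
Lemma pmulDr : right_distributive pmul +%R.
Proof.
move=> x y z; rewrite -[x]projK -[y]projK -[z]projK.
by rewrite !(proj_pmul, =^~ raddfD) /= mulrDr.
Qed.
Lemma proj1_neq0 : proj 1 != 0.
Proof.
apply/negP => /eqP; rewrite -[0](raddf0 proj) => /proj_eqP /triv_ideal /eqP.
by rewrite subr0 (rmorph1 triv) oner_eq0.
Qed.
HB.instance Definition _ := GRing.Zmodule_isNzRing.Build periplectic
  pmulA pmul1l pmul1r pmulDl pmulDr proj1_neq0.

Lemma pscaleA a b x : pscale a (pscale b x) = pscale (a * b) x.
Proof. by rewrite -[x]projK !proj_pscale scalerA. Qed.
Lemma pscale1 : left_id 1 pscale.
Proof. by move=> x; rewrite -[x]projK proj_pscale scale1r. Qed.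
Lemma pscaleDr : right_distributive pscale +%R.
Proof.
move=> a x y; rewrite -[x]projK -[y]projK.
by rewrite !(proj_pscale, =^~ raddfD) /= scalerDr.
Qed.
Lemma pscaleDl x : {morph pscale^~ x : a b / a + b}.
Proof.
by move=> a b; rewrite -[x]projK !proj_pscale scalerDl raddfD.
Qed.
HB.instance Definition _ := GRing.Zmodule_isLmodule.Build C periplectic
  pscaleA pscale1 pscaleDr pscaleDl.

Lemma periplectic_scaleAl (a : C) (x y : periplectic) :
  a *: (x * y) = (a *: x) * y.
Proof.
rewrite -[x]projK -[y]projK.
by rewrite /GRing.mul /GRing.scale /= !(proj_pmul, proj_pscale) scalerAl.
Qed.
HB.instance Definition _ := GRing.Lmodule_isLalgebra.Build C periplectic
  periplectic_scaleAl.

Lemma periplectic_scaleAr (a : C) (x y : periplectic) :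
  a *: (x * y) = x * (a *: y).
Proof.
rewrite -[x]projK -[y]projK.
by rewrite /GRing.mul /GRing.scale /= !(proj_pmul, proj_pscale) stacks_scaleAr.
Qed.
HB.instance Definition _ := GRing.Lalgebra_isAlgebra.Build C periplectic
  periplectic_scaleAr.

Lemma proj_monoid_morphism : monoid_morphism proj.
Proof. by split=> [|x y]; [exact: erefl | exact: esym (proj_pmul x y)]. Qed.
HB.instance Definition _ := GRing.isMonoidMorphism.Build stacks periplectic proj
  proj_monoid_morphism.
Lemma proj_scalable : scalable proj.
Proof. by move=> c x; exact: esym (proj_pscale c x). Qed.
HB.instance Definition _ := GRing.isScalable.Build C stacks periplectic *:%R proj
  proj_scalable.

Definition dot_space : Type := {malg C[reg_diagram d]}.
HB.instance Definition _ := GRing.Lmodule.on dot_space.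

Definition basis (D : reg_diagram d) : dot_space := << D >>.

Variable w : brauer d -> seq (letter d).

Definition dot_stack (D : dot_diagram d) : stacks :=
  (\prod_(k < d) fy k ^+ top_dots D k)
  * (\prod_(g <- w (shape D)) fgen (inl g))
  * (\prod_(k < d) fy k ^+ bot_dots D k).

Definition dot_monomial (D : dot_diagram d) : periplectic := proj (dot_stack D).

Definition as_stacks (v : dot_space) : stacks :=
  \sum_(D <- msupp v) v@_D *: dot_stack (val D).

(* Elementary diagrammatic moves on linear combinations of stacks: inside one
   stack, replace one side of a relation by the other, or discard the stack
   because it contains a closed circle, possibly with dots. *)
Inductive move_step : stacks -> stacks -> Prop :=
| move_lr z (c : C) (u v : {fmonom generator}) l r :
    relation fs fe fy l r ->
    move_step (z + c *: (<< u >> * l * << v >>))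
              (z + c *: (<< u >> * r * << v >>))
| move_rl z (c : C) (u v : {fmonom generator}) l r :
    relation fs fe fy l r ->
    move_step (z + c *: (<< u >> * r * << v >>))
              (z + c *: (<< u >> * l * << v >>))
| move_circle z (c : C) (u v : {fmonom generator}) a m n :
    move_step
      (z + c *: (<< u >> * (fe a * fy (lo a) ^+ m * fy (hi a) ^+ n * fe a)
                 * << v >>))
      z.

Definition evaluates (x : stacks) (v : dot_space) : Prop :=
  clos_refl_trans stacks move_step x (as_stacks v).

End Algebra.

(* Main.v *)
(* The regular monomials span. Modulo stacks with fewer dots, dots slide freely
   along the edges of a diagram, so every word reduces to an undotted stack with
   dots at its ends; an undotted stack without circles is determined up to sign
   by its Brauer diagram, because the stabilizer of a set of cups acts on their
   product by signs. A circle with dots vanishes: sliding a dot once around it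
   replaces y^k by (y + 2)^k, which in characteristic 0 forces y^k to contribute 0
   by induction on k.

   They are independent. The finite algebra acts on oriented perfect matchings
   of the ends of n + d vertical strands, and y_j acts as the Jucys-Murphy
   element of the strand n + j, so that n auxiliary strands lie below all others.
   When a diagram with at most n dots is applied to the matching by vertical
   edges, a matching that involves all n auxiliary strands appears only if there
   are exactly n dots, each of which has threaded one auxiliary strand into the
   edge carrying it. Such a matching determines the underlying Brauer diagram and
   the number of dots on each edge, that is, the regular diagram.

   Two stacks are related by moves exactly when they are equal in the algebra,
   so evaluating a product of diagrams is the multiplication carried over along
   the resulting linear isomorphism. *)
From HB Require Import structures.
Require Import Defs.
From Stdlib Require Import Relation_Operators.
From mathcomp Require Import all_boot all_order all_algebra all_fingroup.
From mathcomp Require Import zify.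
From mathcomp Require Import boolp reals complex.
From mathcomp Require Import finmap monalg.

Set Implicit Arguments.
Unset Strict Implicit.
Unset Printing Implicit Defensive.

Import GRing.Theory.
Local Open Scope ring_scope.

(** * The Coxeter presentation of the symmetric group *)

(** The presentation has generators on adjacent strands only, whereas sliding, the sign rule for
    cups and Jucys-Murphy sums involve arbitrary pairs of strands. The record [periplectic_rep]
    therefore collects relations that are equivariant under all permutations. It is instantiated
    twice, by the abstract algebra and by matrices acting on matchings, and the arguments about
    permutations and cups use the record alone. The abstract instance needs every permutation as an
    element of the algebra, whence the word problem for the Coxeter presentation. Up to sign an
    undotted stack is a permutation times a product of disjoint cups, because a Brauer diagram has
    as many cups as caps. The sign of a stack is never computed: spanning allows any scalars and
    independence only needs nonzero coefficients. The exception is the unit, whose chosen word must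
    have the value 1 exactly. The constant 2 of a circle is 1 for passing its cap plus 1 for passing
    its cup, both by (P.8). The number n of auxiliary strands is the largest number of dots in the
    linear combination under test, so each combination is tested in a representation of its own. *)

Section CoxeterWords.

(* [chain n k] is the word s_{n-1} s_{n-2} ... s_k of the coset representative sending k to n. *)
Definition chain (n k : nat) : seq nat := rev (iota k (n - k)).

(** Right multiplication by the letter j, where (k, l) stands for the word l followed by
    [chain n k]: j = k - 1 lengthens the chain, j = k shortens it, a smaller j commutes past it, and
    a larger j passes it and comes out as j - 1. *)
Definition coset_step (kl : nat * seq nat) (j : nat) : nat * seq nat :=
  let: (k, l) := kl in
  if j.+1 == k then (j, l) else if j == k then (k.+1, l)
  else if (j.+1 < k)%N then (k, rcons l j) else (k, rcons l j.-1).

Definition coset_form n (l : seq nat) := foldl coset_step (n, [::]) l.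

Lemma coset_form_bound n l : all (ltn^~ n) l ->
  ((coset_form n l).1 <= n)%N /\ all (ltn^~ n.-1) (coset_form n l).2.
Proof.
rewrite /coset_form; elim/last_ind: l => //= l j IH.
rewrite all_rcons foldl_rcons => /andP[jn /IH]; case: foldl => k l' /= [kn l'n].
rewrite /coset_step; case: eqP => [|?] /=; first by split => //; lia.
case: eqP => [|?] /=; first by split => //; lia.
by case: ltnP => ? /=; rewrite all_rcons; split=> //; apply/andP; split => //; lia.
Qed.

Section Value.
Variables (T : Type) (mul : T -> T -> T) (one : T) (g : nat -> T) (N : nat).
Hypothesis mulA : associative mul.
Hypothesis mul1x : left_id one mul.
Hypothesis mulx1 : right_id one mul.
Hypothesis gg : forall i, (i < N)%N -> mul (g i) (g i) = one.
Hypothesis g_far : forall i j, (i.+1 < j)%N -> (j < N)%N ->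
  mul (g i) (g j) = mul (g j) (g i).
Hypothesis g_braid : forall i, (i.+1 < N)%N ->
  mul (mul (g i) (g i.+1)) (g i) = mul (mul (g i.+1) (g i)) (g i.+1).

Definition val_word (l : seq nat) : T := foldr (fun i x => mul (g i) x) one l.

Lemma val_word_cat l1 l2 :
  val_word (l1 ++ l2) = mul (val_word l1) (val_word l2).
Proof. by elim: l1 => [|i l IH] /=; rewrite ?mul1x // IH mulA. Qed.

Lemma val_word_rcons l i : val_word (rcons l i) = mul (val_word l) (g i).
Proof. by rewrite -cats1 val_word_cat /= mulx1. Qed.

Lemma val_word_revr l : all (ltn^~ N) l ->
  mul (val_word l) (val_word (rev l)) = one.
Proof.
elim: l => [|i l IH] /=; first by rewrite mul1x.
move=> /andP[iN lN]; rewrite rev_cons val_word_rcons -mulA (mulA (val_word l)).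
by rewrite IH // mul1x gg.
Qed.

Lemma val_word_revl l : all (ltn^~ N) l ->
  mul (val_word (rev l)) (val_word l) = one.
Proof. by move=> lN; rewrite -{2}(revK l) val_word_revr // all_rev. Qed.

Lemma chain_succ n k : (k < n)%N -> chain n k = rcons (chain n k.+1) k.
Proof. by move=> kn; rewrite /chain -rev_cons subnS -[(n - k)%N]prednK ?subn_gt0. Qed.

Lemma chain_far n k j : (n <= N)%N -> (j.+1 < k)%N ->
  mul (val_word (chain n k)) (g j) = mul (g j) (val_word (chain n k)).
Proof.
move=> nN jk; rewrite /chain.
have [m] : exists m, (n - k)%N = m by eexists.
elim: m k nN jk => [|m IH] k nN jk E; rewrite E /=; first by rewrite mul1x mulx1.
rewrite rev_cons val_word_rcons -mulA -(@g_far j k) //; last by lia.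
rewrite mulA; have := IH k.+1 nN (ltnW jk); rewrite subnS E /= => -> //.
Qed.

(** In the chain only the letters j and j - 1 interact with the new letter j; one braid move turns
    it into j - 1, which commutes with the larger letters in front. *)
Lemma chain_shift n k j : (n <= N)%N -> (k < j)%N -> (j < n)%N ->
  mul (val_word (chain n k)) (g j) = mul (g j.-1) (val_word (chain n k)).
Proof.
move=> nN; have [m] : exists m, (j - k)%N = m by eexists.
elim: m k => [|m IH] k E kj jn; first by lia.
have kn : (k < n)%N by apply: leq_trans jn; apply: ltnW.
rewrite (chain_succ kn) val_word_rcons.
case: (eqVneq j k.+1) => [jE|jnk]; last first.
  have kj' : (k.+1 < j)%N by lia.
  rewrite -mulA (@g_far k j) //; last by lia.
  by rewrite !mulA IH //; lia.
rewrite {}jE /= in jn *; rewrite (chain_succ jn) val_word_rcons.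
rewrite -!mulA [mul (g k.+1) _]mulA -g_braid; last by lia.
by rewrite -!mulA mulA chain_far // !mulA.
Qed.

(** One letter at a time, each case of [coset_step] being an identity of the monoid. As [coset_form]
    depends on the word only, the ring and the symmetric group receive the same decomposition. *)
Lemma coset_formP n l : (n <= N)%N -> all (ltn^~ n) l ->
  val_word l = mul (val_word (coset_form n l).2)
                   (val_word (chain n (coset_form n l).1)).
Proof.
move=> nN; elim/last_ind: l => [|l j IH] /=.
  by rewrite /chain subnn /= mul1x.
rewrite all_rcons => /andP[jn ln].
have [] := coset_form_bound ln; rewrite val_word_rcons IH //.
rewrite /coset_form foldl_rcons; case: foldl => k l' /= kn l'n.
rewrite -mulA; case: eqP => [<-|jk1] /=.
  by rewrite -val_word_rcons -chain_succ.
case: eqP => [<-|jk] /=.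
  by rewrite chain_succ // val_word_rcons -(mulA _ (g j)) gg ?mulx1 //; lia.
case: ltnP => ljk /=; rewrite val_word_rcons -!mulA.
  by rewrite chain_far.
by rewrite chain_shift //; lia.
Qed.
End Value.
End CoxeterWords.

(** * Permutations as words in adjacent transpositions *)

Section AdjacentTranspositions.
Variable d : nat.
Local Notation perms := {perm 'I_d}.

Definition adj (a : 'I_d.-1) : perms := tperm (lo a) (hi a).

Definition swapn (a x : nat) : nat :=
  if x == a then a.+1 else if x == a.+1 then a else x.

Lemma val_adj a x : val (adj a x) = swapn a (val x).
Proof.
rewrite /adj /swapn; case: tpermP => [->|->|/eqP xl /eqP xh] /=; rewrite ?eqxx //.
  by case: eqP => //; lia.
by move: xl xh; rewrite -!val_eqE /= => /negPf-> /negPf->.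
Qed.

(** Composition of functions, opposite to the product of permutations, so that words of permutations
    read like words of operators. *)
Definition pcomp (s t : perms) : perms := (t * s)%g.
(** Letters are natural numbers; out of range they stand for the identity, a case that the bounds on
    words exclude. *)
Definition adjn (i : nat) : perms := oapp adj 1%g (insub i).

Lemma val_adjn i x : (i < d.-1)%N -> val (adjn i x) = swapn i (val x).
Proof. by move=> id; rewrite /adjn insubT /= val_adj. Qed.

Lemma pcompA : associative pcomp. Proof. by move=> x y z; rewrite /pcomp mulgA. Qed.
Lemma pcomp1p : left_id 1%g pcomp. Proof. by move=> x; rewrite /pcomp mulg1. Qed.
Lemma pcompp1 : right_id 1%g pcomp. Proof. by move=> x; rewrite /pcomp mul1g. Qed.

Lemma adjnn i : (i < d.-1)%N -> pcomp (adjn i) (adjn i) = 1%g.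
Proof. by move=> id; rewrite /adjn insubT /pcomp /= tperm2. Qed.

Lemma adjn_far i j : (i.+1 < j)%N -> (j < d.-1)%N ->
  pcomp (adjn i) (adjn j) = pcomp (adjn j) (adjn i).
Proof.
move=> ij jd; have id : (i < d.-1)%N by lia.
apply/permP => x; apply: val_inj; rewrite !permM !val_adjn // /swapn.
by move: (val x) => n; do ![case: eqP => //=]; lia.
Qed.

Lemma adjn_braid i : (i.+1 < d.-1)%N ->
  pcomp (pcomp (adjn i) (adjn i.+1)) (adjn i)
  = pcomp (pcomp (adjn i.+1) (adjn i)) (adjn i.+1).
Proof.
move=> jd; have id : (i < d.-1)%N by lia.
apply/permP => x; apply: val_inj; rewrite !permM !val_adjn // /swapn.
by move: (val x) => n; do ![case: eqP => //=]; lia.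
Qed.

Definition perm_word := val_word pcomp 1%g adjn.

Let pcat := @val_word_cat _ _ _ adjn pcompA pcomp1p.
Let prcons := @val_word_rcons _ _ _ adjn pcompA pcomp1p pcompp1.

Lemma perm_word_fix l n (x : 'I_d) : all (ltn^~ n) l -> (n <= d.-1)%N ->
  (n < x)%N -> perm_word l x = x.
Proof.
move=> + nd nx; elim: l => [|i l IH] /=; first by rewrite perm1.
move=> /andP[il ll]; apply: val_inj; rewrite permM IH // val_adjn /swapn; last by lia.
by rewrite !ifN //; apply/eqP => /= xi; move: nx; rewrite xi; lia.
Qed.

Lemma perm_chain n k (x : 'I_d) : (k <= n)%N -> (n <= d.-1)%N -> x = k :> nat ->
  val (perm_word (chain n k) x) = n.
Proof.
move=> + nd; have [m] : exists m, (n - k)%N = m by eexists.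
elim: m k x => [|m IH] k x E kn xk.
  by rewrite /chain E /= perm1 xk; lia.
rewrite chain_succ; last by lia.
rewrite /perm_word prcons permM (IH k.+1) //; try lia.
by rewrite val_adjn /swapn; [case: eqP => //; lia | lia].
Qed.

Lemma all_chain n k : all (ltn^~ n) (chain n k).
Proof. by apply/allP => i; rewrite mem_rev mem_iota /=; lia. Qed.

(** Splitting off the coset representative of the preimage [k] of the top strand leaves a
    permutation that fixes this strand. *)
Lemma perm_wordE n (s : perms) : (n <= d.-1)%N ->
  (forall x : 'I_d, (n < x)%N -> s x = x) ->
  exists2 l, all (ltn^~ n) l & perm_word l = s.
Proof.
elim: n s => [|n IH] s nd sfix.
  exists [::] => //; apply/esym/permP => x; rewrite perm1.
  have [x0|] := posnP x; last exact: sfix.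
  have [sx0|/sfix] := posnP (s x); last exact: perm_inj.
  by apply: val_inj; rewrite /= sx0 x0.
have nd' : (n.+1 < d)%N by lia.
pose top := Ordinal nd'; pose k := (s^-1%g top).
have kn : (k <= n.+1)%N.
  rewrite leqNgt; apply/negP => /[dup] nk /sfix; rewrite permKV => /(congr1 val) /=.
  by lia.
pose c := chain n.+1 k.
have cN : all (ltn^~ d.-1) c by apply: sub_all (all_chain _ _) => x /=; lia.
have ck : perm_word c k = top by apply: val_inj; rewrite perm_chain.
pose c' := perm_word (rev c).
have cc' : (c' * perm_word c)%g = 1%g.
  by have := val_word_revr pcompA pcomp1p pcompp1 adjnn cN.
have c'c : (perm_word c * c')%g = 1%g.
  by have := val_word_revl pcompA pcomp1p pcompp1 adjnn cN.
have [x nx|l ln lE] := IH (c' * s)%g (ltnW nd).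
  rewrite permM; have [xn|nx'] := eqVneq (nat_of_ord x) n.+1.
    have -> : x = top by apply: val_inj.
    by rewrite -ck -(permM (perm_word c)) c'c perm1 permKV.
  have cx : perm_word c x = x.
    apply: (@perm_word_fix _ n.+1) => //; first exact: all_chain.
    by have := ltn_ord x; lia.
  have c'x : c' x = x by rewrite -{1}cx -permM c'c perm1.
  by rewrite c'x; apply: sfix; lia.
exists (l ++ c); last first.
  rewrite /perm_word pcat /pcomp -/(perm_word l) lE.
  by rewrite mulgA -/(perm_word c) c'c mul1g.
rewrite all_cat all_chain andbT.
by apply: sub_all ln => x /=; lia.
Qed.

Lemma perm_wordT (s : perms) : exists2 l, all (ltn^~ d.-1) l & perm_word l = s.
Proof. by apply: perm_wordE => // x; have := ltn_ord x; lia. Qed.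
End AdjacentTranspositions.

(** * The word problem for the Coxeter relations *)

Section CoxeterPresentation.
Variables (d : nat) (A : pzRingType) (s : 'I_d.-1 -> A).
Hypothesis ss : forall a, s a * s a = 1.
Hypothesis s_far : forall a b, far a b -> s a * s b = s b * s a.
Hypothesis s_braid : forall c c' : 'I_d.-1, c' = c.+1 :> nat ->
  s c * s c' * s c = s c' * s c * s c'.

Let g (i : nat) : A := oapp s 1 (insub i).
Let value := val_word *%R 1 g.
Let vcat : forall l1 l2, value (l1 ++ l2) = value l1 * value l2 :=
  @val_word_cat _ _ _ g (@mulrA A) (@mul1r A).

Let gg i : (i < d.-1)%N -> g i * g i = 1.
Proof. by move=> id; rewrite /g insubT /= ss. Qed.

Let g_far i j : (i.+1 < j)%N -> (j < d.-1)%N -> g i * g j = g j * g i.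
Proof.
move=> ij jd; have id : (i < d.-1)%N by lia.
by rewrite /g !insubT /= s_far // /far /= ij.
Qed.

Let g_braid i : (i.+1 < d.-1)%N -> g i * g i.+1 * g i = g i.+1 * g i * g i.+1.
Proof.
move=> jd; have id : (i < d.-1)%N by lia.
by rewrite /g !insubT /= s_braid.
Qed.

Let cform n l := @coset_formP _ _ _ _ _ (@mulrA A) (@mul1r A) (@mulr1 A) gg g_far g_braid n l.
Let pform n l := @coset_formP _ _ _ _ _ (@pcompA d) (@pcomp1p d) (@pcompp1 d)
  (@adjnn d) (@adjn_far d) (@adjn_braid d) n l.

(* The coset representative of the word of a permutation fixing n is trivial. *)
Lemma value_parabolic n l (x : 'I_d) : (n <= d.-1)%N -> all (ltn^~ n) l ->
    x = n :> nat -> perm_word d l x = x ->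
  exists l', [/\ all (ltn^~ n.-1) l', value l = value l'
               & perm_word d l = perm_word d l'].
Proof.
move=> nd ln xn lx; exists (coset_form n l).2.
have [kn l'n] := coset_form_bound ln.
have [y yE] : {y : 'I_d | y = (coset_form n l).1 :> nat}.
  have h : ((coset_form n l).1 < d)%N by have := ltn_ord x; lia.
  by exists (Ordinal h).
have kE : (coset_form n l).1 = n.
  have : perm_word d l y = x.
    have cy : perm_word d (chain n (coset_form n l).1) y = x.
      by apply: val_inj; rewrite perm_chain.
    rewrite /perm_word (pform nd ln) permM -!/(perm_word d _) cy.
    have [n0|n_gt0] := posnP n.
      case: (coset_form n l).2 l'n => [|i ll]; first by rewrite /= perm1.
      by rewrite /= n0.
    by apply: (perm_word_fix l'n); lia.
  by rewrite -lx => /perm_inj yx; rewrite -yE yx.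
have ch : chain n n = [::] by rewrite /chain subnn.
split=> //.
  by rewrite /value (cform nd ln) kE ch /= mulr1.
by rewrite /perm_word (pform nd ln) kE ch /= pcompp1.
Qed.

(** The identity fixes the top strand, so [value_parabolic] lowers the bound on the letters by one,
    again and again, until no letter is left. *)
Lemma value_perm1 l : all (ltn^~ d.-1) l -> perm_word d l = 1%g -> value l = 1.
Proof.
suff H n : (n <= d.-1)%N -> all (ltn^~ n) l -> perm_word d l = 1%g -> value l = 1.
  exact: H.
elim: n l => [|n IH] l nd ln l1.
  by case: l ln l1.
have nd' : (n.+1 < d)%N by lia.
have [|l' [l'n -> El]] := @value_parabolic _ _ (Ordinal nd') nd ln erefl.
  by rewrite l1 perm1.
by apply: IH; rewrite // -?El //; lia.
Qed.

Lemma value_perm l1 l2 : all (ltn^~ d.-1) l1 -> all (ltn^~ d.-1) l2 ->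
  perm_word d l1 = perm_word d l2 -> value l1 = value l2.
Proof.
move=> l1d l2d E.
have r := val_word_revr (@mulrA A) (@mul1r A) (@mulr1 A) gg l2d.
have rp := val_word_revr (@pcompA d) (@pcomp1p d) (@pcompp1 d) (@adjnn d) l2d.
have : value (l1 ++ rev l2) = 1.
  apply: value_perm1; first by rewrite all_cat l1d all_rev.
  rewrite /perm_word (val_word_cat _ (@pcompA d) (@pcomp1p d)).
  by rewrite -/(perm_word d l1) E.
rewrite vcat => E1; rewrite -[LHS]mulr1.
rewrite -(val_word_revl (@mulrA A) (@mul1r A) (@mulr1 A) gg l2d).
by rewrite mulrA E1 mul1r.
Qed.

Lemma perm_word_exists (p : {perm 'I_d}) :
  exists l, all (ltn^~ d.-1) l && (perm_word d l == p).
Proof. by have [l ld lp] := perm_wordT p; exists l; rewrite ld; apply/eqP. Qed.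

Definition coxrep (p : {perm 'I_d}) : A := value (xchoose (perm_word_exists p)).

Lemma coxrep_word l : all (ltn^~ d.-1) l -> coxrep (perm_word d l) = value l.
Proof.
move=> ld; rewrite /coxrep; set l' := xchoose _.
by have /andP[l'd /eqP E] : _ && _ := xchooseP (perm_word_exists (perm_word d l)); apply: value_perm.
Qed.

Lemma coxrep1 : coxrep 1%g = 1.
Proof. by rewrite -[1%g]/(perm_word d [::]) coxrep_word. Qed.

Lemma coxrepM p q : coxrep (p * q)%g = coxrep q * coxrep p.
Proof.
have [l ld <-] := perm_wordT p; have [l' l'd <-] := perm_wordT q.
rewrite !coxrep_word // -vcat -coxrep_word ?all_cat ?l'd //.
by rewrite /perm_word (val_word_cat _ (@pcompA d) (@pcomp1p d)).
Qed.

Lemma coxrep_adj a : coxrep (adj a) = s a.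
Proof.
have -> : adj a = perm_word d [:: val a].
  by rewrite /perm_word /= pcompp1 /adjn valK.
by rewrite coxrep_word /= ?ltn_ord // mulr1 /g valK.
Qed.

(* A permutation fixing n and everything above is a word in the s_b with b < n - 1. *)
Lemma coxrep_parabolic n (p : {perm 'I_d}) (x : A) : (n.+1 = d.-1)%N ->
    (forall y : 'I_d, (n <= y)%N -> p y = y) ->
    (forall b : 'I_d.-1, (b.+1 < n)%N -> s b * x = x * s b) ->
  coxrep p * x = x * coxrep p.
Proof.
move=> nd pfix sx; have [l ld lp] := perm_wordT p; rewrite -lp coxrep_word //.
have [[u un] [v vn]] : {u : 'I_d | u = n.+1 :> nat} * {v : 'I_d | v = n :> nat}.
  have h : (n.+1 < d)%N by lia.
  by split; [exists (Ordinal h) | exists (Ordinal (ltnW h))].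
rewrite -nd in ld.
(* The strands n + 1 and n are stripped in turn; this leaves letters below n - 1, to which the
   hypothesis on [x] applies. *)
have [||l1 [l1n -> E1]] := @value_parabolic n.+1 l u _ ld un; first by lia.
  by rewrite lp pfix // un.
have [||l2 [l2n -> _]] := @value_parabolic n l1 v _ l1n vn; first by lia.
  by rewrite -E1 lp pfix // vn.
have {l2n} : all (fun i => i.+1 < n)%N l2 by apply: sub_all l2n => i /=; lia.
elim: l2 => [|i l2 IH] /=; first by rewrite mul1r mulr1.
move=> /andP[il /IH E]; have id : (i < d.-1)%N by lia.
by rewrite /value /= -mulrA [val_word _ _ _ _ * x]E !mulrA /g insubT /= sx.
Qed.
End CoxeterPresentation.

(** * Transpositions, cups and Jucys-Murphy elements *)

(* The relations of the finite periplectic Brauer algebra for all pairs of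
   strands at once. As R (p * q) = R q * R p and (p * q) x = q (p x), products
   in the ring compose permutations from right to left. *)
Record periplectic_rep (X : finType) (B : pzRingType) (R : {perm X} -> B)
    (e : X -> X -> B) : Prop := PeriplecticRep {
  prep1 : R 1%g = 1;
  prepM : forall p q, R (p * q)%g = R q * R p;
  prepE : forall p i j, R p * e i j = e (p i) (p j) * R p;
  prep_se : forall i j, i != j -> R (tperm i j) * e i j = e i j;
  prepC : forall i j, i != j -> e j i = - e i j;
  prep_ee : forall i j, i != j -> e i j * e i j = 0;
  prep_far : forall i j k l, uniq [:: i; j; k; l] -> e i j * e k l = e k l * e i j;
  prep_near : forall i j k, uniq [:: i; j; k] ->
    e i j * e j k = R (tperm j k) * R (tperm i j) * e j k
}.

Section PeriplecticRep.
Variables (X : finType) (B : pzRingType) (R : {perm X} -> B) (e : X -> X -> B).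
Hypothesis H : periplectic_rep R e.
Local Notation s i j := (R (tperm i j)).

Lemma rep_tt i j : s i j * s i j = 1.
Proof. by rewrite -(prepM H) tperm2 (prep1 H). Qed.

Lemma rep_es i j : i != j -> e i j * s i j = - e i j.
Proof.
move=> ij; rewrite -[in RHS](prep_se H ij) (prepE H) tpermL tpermR.
by rewrite (prepC H ij) mulNr opprK.
Qed.

Lemma tperm_rot (x a b : X) : uniq [:: x; a; b] ->
  (tperm x a * tperm a b = tperm a b * tperm x b)%g.
Proof.
rewrite /= !inE negb_or andbT => /andP[/andP[xa xb] ab].
rewrite (conjgC (tperm x a)) tpermJ tpermL tpermD //; last by rewrite eq_sym.
by rewrite eq_sym.
Qed.

(** [prep_near] with one of its two transpositions absorbed by the cup. *)
Lemma rep_near_l x a b : uniq [:: x; a; b] -> e x a * e a b = s x b * e a b.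
Proof.
move=> u; rewrite (prep_near H u) -(prepM H) tperm_rot // (prepM H) -mulrA.
by rewrite (prep_se H) //; move: u; rewrite /= !inE => /and3P[].
Qed.

Lemma rep_near_r x a b : uniq [:: x; a; b] -> e a b * e x a = e a b * s x b.
Proof.
move=> u; have: uniq [:: b; a; x] by rewrite -[[:: b; a; x]]/(rev [:: x; a; b]) rev_uniq.
move=> u'; move: (u); rewrite /= !inE negb_or andbT => /andP[/andP[xa xb] ab].
have -> : e a b * e x a = e b a * e a x.
  by rewrite (prepC H xa) (prepC H ab) mulrNN.
rewrite (prep_near H u') -(prepM H) (prepE H) !permM.
have tx : tperm b a x = x by rewrite tpermD // eq_sym.
have tb : tperm a x b = b by rewrite tpermD.
rewrite tpermR tb tx tpermR.
have -> : (tperm b a * tperm a x = tperm x b * tperm a b)%g.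
  have u2 : uniq [:: x; b; a].
    by rewrite /= !inE negb_or xa xb eq_sym ab.
  by rewrite (tpermC a x) (tpermC a b) (tperm_rot u2).
by rewrite (prepM H) mulrA (prepC H ab) mulNr rep_es // opprK.
Qed.

(** The element [e j k] slides along either of the two cups; the results carry [s i k] and [s j l]
    with opposite signs and must agree. *)
Lemma rep_cups i j k l : uniq [:: i; j; k; l] ->
  s i k * s j l * (e i j * e k l) = - (e i j * e k l).
Proof.
move=> u; move: (u); rewrite /= !inE !negb_or andbT.
move=> /andP[/and3P[ij ik il] /andP[/andP[jk jl] kl]].
have u1 : uniq [:: k; j; i] by rewrite /= !inE !negb_or ![k == _]eq_sym jk ik eq_sym ij.
have u2 : uniq [:: j; k; l] by rewrite /= !inE !negb_or jk jl kl.
have E1 : e j k * (e i j * e k l) = - (s i k * (e i j * e k l)).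
  rewrite (mulrA (e j k)) -[e j k * e i j]mulrNN -!(prepC H) //.
  by rewrite rep_near_l // (prepC H ij) mulrN mulNr tpermC mulrA.
have E2 : e j k * (e i j * e k l) = s j l * (e i j * e k l).
  by rewrite (prep_far H u) mulrA rep_near_l // -mulrA.
by rewrite -mulrA -E2 E1 mulrN mulrA rep_tt mul1r.
Qed.

(* The Jucys-Murphy element of the strand j over the strands in S. *)
Definition jm (S : {set X}) (j : X) : B := \sum_(x in S) (s x j + e x j).

Lemma jm_perm (S : {set X}) j (p : {perm X}) : (forall x, (p x \in S) = (x \in S)) ->
  R p * jm S j = jm S (p j) * R p.
Proof.
move=> pS; rewrite /jm mulr_sumr mulr_suml.
rewrite [RHS](reindex_inj (@perm_inj _ p)) /=.
apply: eq_big => x; rewrite ?pS // => _.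
rewrite mulrDr mulrDl (prepE H) -!(prepM H); congr (_ + _).
by rewrite -tpermJ -conjgC.
Qed.

Lemma jm_far (S : {set X}) j a b : a != b -> a \notin S -> b \notin S -> a != j ->
  b != j -> j \notin S -> e a b * jm S j = jm S j * e a b.
Proof.
move=> ab aS bS aj bj jS; rewrite /jm mulr_sumr mulr_suml.
apply: eq_bigr => x xS.
have [xa xb xj] : [/\ x != a, x != b & x != j].
  by split; apply: contraTneq xS => ->.
rewrite mulrDr mulrDl (prepE H) !tpermD // ?(eq_sym j) //; congr (_ + _).
by rewrite (prep_far H) //= !inE !negb_or ab aj bj xj !andbT ![_ == x]eq_sym xa xb.
Qed.

(** The terms at a and b do not commute with the cup one by one, but the cup annihilates their sum
    from either side; the remaining terms are far from it. *)
Lemma jm_mem (S : {set X}) j a b : a != b -> a \in S -> b \in S -> j \notin S ->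
  e a b * jm S j = jm S j * e a b.
Proof.
move=> ab aS bS jS.
have [aj bj] : a != j /\ b != j by split; apply: contraNneq jS => <-.
have bSa : b \in S :\ a by rewrite !inE eq_sym ab.
rewrite /jm (big_setD1 a) //= (big_setD1 b) //= addrA.
rewrite mulrDr mulrDl; congr (_ + _); last first.
  have := @jm_far (S :\ a :\ b) j a b; rewrite !inE !eqxx /= !andbF.
  by rewrite (negPf jS) !andbF; apply.
have ua : uniq [:: j; a; b] by rewrite /= !inE !negb_or ![j == _]eq_sym aj bj ab.
have ub : uniq [:: j; b; a] by rewrite /= !inE !negb_or ![j == _]eq_sym aj bj eq_sym ab.
have ba : b != a by rewrite eq_sym.
transitivity (0 : B).
  rewrite !mulrDr; have -> : e a b * e a j = - (e a b * s j b).
    by rewrite -rep_near_r // -mulrN -(prepC H) // eq_sym.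
  have -> : e a b * e b j = - (e a b * s j a).
    rewrite (prepC H ba) mulNr (prepC H (_ : j != b)); last by rewrite eq_sym.
    by rewrite mulrN rep_near_r // mulNr.
  rewrite (tpermC j a) (tpermC j b).
  by rewrite -[X in X + _]opprB addNr.
rewrite !mulrDl; have -> : e a j * e a b = - (s j b * e a b).
  by rewrite -rep_near_l // -mulNr -(prepC H) // eq_sym.
have -> : e b j * e a b = - (s j a * e a b).
  rewrite (prepC H ba) mulrN (prepC H (_ : j != b)); last by rewrite eq_sym.
  by rewrite mulNr rep_near_l // mulrN.
rewrite (tpermC j a) (tpermC j b).
by rewrite -[X in X + _]opprB addNr.
Qed.

(** Each term of the element with the smaller set moves strands inside S' only, so it commutes with
    the symmetric expression [jm S' j]. *)
Lemma jm_comm (S S' : {set X}) i j : i \notin S -> j \notin S' -> i |: S \subset S' ->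
  jm S i * jm S' j = jm S' j * jm S i.
Proof.
move=> iS jS' sS; have iS' : i \in S' by apply: (subsetP sS); rewrite setU11.
apply/commr_sym/commr_sum => x xS; apply: commr_sym; rewrite /GRing.comm.
have xS' : x \in S' by apply: (subsetP sS); rewrite inE xS orbT.
have xi : x != i by apply: contraNneq iS => <-.
rewrite mulrDr mulrDl jm_mem // jm_perm.
  by rewrite tpermD //; apply: contraNneq jS' => <-.
by move=> z; case: tpermP => [->|->|_ _]; rewrite ?iS' ?xS'.
Qed.

(** The recursion of Jucys-Murphy elements; multiplied by [s a b] it becomes (P.7). *)
Lemma jm_next (S : {set X}) a b : a \notin S -> b \notin S -> a != b ->
  jm (a |: S) b = s a b * jm S a * s a b + s a b + e a b.
Proof.
move=> aS bS ab; rewrite /jm big_setU1 //= -/(jm S b) addrC -addrA; congr (_ + _).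
rewrite jm_perm ?tpermL; first by rewrite -mulrA rep_tt mulr1.
by move=> x; case: tpermP => [->|->|//]; rewrite (negPf aS) (negPf bS).
Qed.

(** Under the cap [e x a] acts as [s x b] and [e x b] as [s x a], so the terms of the two sums agree
    for every x. With [jm_pair_l] this is the source of (P.8). *)
Lemma jm_pair_r (S : {set X}) a b : a != b -> a \notin S -> b \notin S ->
  e a b * (jm S a - jm S b) = 0.
Proof.
move=> ab aS bS; rewrite /jm -sumrB mulr_sumr big1 // => x xS.
have [xa xb] : x != a /\ x != b by split; apply: contraTneq xS => ->.
have ba : b != a by rewrite eq_sym.
rewrite mulrBr !mulrDr rep_near_r; last by rewrite /= !inE negb_or xa xb ab.
have -> : e a b * e x b = e a b * s x a.
  by rewrite (prepC H ba) !mulNr rep_near_r //= !inE negb_or xa xb ba.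
by rewrite [X in X - _]addrC subrr.
Qed.

Lemma jm_pair_l (S : {set X}) a b : a != b -> a \notin S -> b \notin S ->
  (jm S a - jm S b) * e a b = 0.
Proof.
move=> ab aS bS; rewrite /jm -sumrB mulr_suml big1 // => x xS.
have [xa xb] : x != a /\ x != b by split; apply: contraTneq xS => ->.
have ba : b != a by rewrite eq_sym.
rewrite mulrBl !mulrDl rep_near_l; last by rewrite /= !inE negb_or xa xb ab.
have -> : e x b * e a b = s x a * e a b.
  by rewrite (prepC H ba) !mulrN rep_near_l //= !inE negb_or xa xb ba.
by rewrite [X in X - _]addrC subrr.
Qed.
End PeriplecticRep.

(** * Generators between arbitrary strands *)

(** Multiple transitivity of the symmetric group: identities checked on particular strands can be
    carried to arbitrary distinct ones. *)
Lemma perm_of_seqs (X : finType) (l1 l2 : seq X) : uniq l1 -> uniq l2 ->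
  size l1 = size l2 -> exists p : {perm X}, map p l1 = l2.
Proof.
elim: l1 l2 => [|x l1 IH] [|y l2] //=; first by exists 1%g.
move=> /andP[xl1 u1] /andP[yl2 u2] [/(IH _ u1 u2)[p pE]].
exists (p * tperm (p x) y)%g; rewrite permM tpermL; congr (_ :: _).
rewrite -[RHS]pE; apply/eq_in_map => z zl; rewrite permM tpermD //.
  by apply: contraNneq xl1 => /perm_inj->.
by apply: contraNneq yl2 => ->; rewrite -pE map_f.
Qed.

(** * Closed circles with dots *)

Section Circle.
Variables (A : pzRingType) (e y z : A).
Hypothesis torsion_free : forall (x : A) k, x *+ k.+1 = 0 -> x = 0.
Hypothesis yz : y * z = z * y.
Hypotheses (ey : e * (y - z) = e) (ye : (y - z) * e = - e).

Lemma cap_slide : e * y = e * (z + 1).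
Proof.
move: ey; rewrite mulrBr mulrDr mulr1 => E.
by rewrite -[X in _ + X]E addrC subrK.
Qed.

Lemma cup_slide : z * e = (y + 1) * e.
Proof.
move: ye; rewrite mulrBl mulrDl mul1r => E.
by rewrite -[X in _ + X]opprK -E opprB addrC subrK.
Qed.

(* Sliding a dot once around the circle shifts it by 2. *)
Lemma circle_shift k : e * y ^+ k * e = e * (y + 2) ^+ k * e.
Proof.
have -> : e * y ^+ k = e * (z + 1) ^+ k.
  elim: k => [//|k IH]; rewrite exprSr mulrA IH -mulrA.
  have -> : (z + 1) ^+ k * y = y * (z + 1) ^+ k.
    by apply/commr_sym/commrX/commrD; [apply: yz | apply: commr1].
  by rewrite mulrA cap_slide -mulrA -exprS.
rewrite -!mulrA; congr (_ * _).
elim: k => [//|k IH]; rewrite exprS -mulrA IH exprSr -[RHS]mulrA.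
have -> : (y + 2) * e = (z + 1) * e.
  by rewrite [RHS]mulrDl cup_slide -mulrDl -addrA.
rewrite !mulrA; congr (_ * _); apply/commrX/commrD; last exact: commr_nat.
by apply/commr_sym/commrD; [apply: yz | apply: commr1].
Qed.

Lemma circle_eq0 k : e * y ^+ k * e = 0.
Proof.
elim/ltn_ind: k => k IH.
(* The shift is applied in degree k + 1: the leading terms cancel, the terms of degree below k
   vanish by induction, and 2 (k + 1) times the wanted element remains. *)
have := circle_shift k.+1; rewrite exprDn_comm; last exact: commr_nat.
rewrite big_ord_recl big_ord_recl /= subn0 expr0 mulr1 bin0 mulr1n.
rewrite /bump /= add1n subn1 expr1 bin1 !mulrDr !mulrDl.
rewrite [in X in _ = _ + (_ + X)]mulr_sumr mulr_suml big1 ?addr0 => [E|i _].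
  move: E => /eqP; rewrite -subr_eq0 opprD addrA subrr add0r oppr_eq0 => /eqP.
  by rewrite mulr1 -mulr2n -mulrnA mulSn addSn mulrnAr mulrnAl => /torsion_free.
rewrite -natrX mulr_natr -mulrnA mulrnAr mulrnAl IH ?mul0rn //.
by rewrite /bump /= !add1n subSS ltn_subrL /=; have := ltn_ord i; lia.
Qed.

Lemma circle2_eq0 m n : e * y ^+ m * z ^+ n * e = 0.
Proof.
elim: n m => [|n IH] m; first by rewrite expr0 mulr1 circle_eq0.
have E : e * z = e * y - e by rewrite cap_slide mulrDr mulr1 addrK.
rewrite exprS mulrA -(mulrA e).
have -> : y ^+ m * z = z * y ^+ m by apply/commr_sym/commrX/commr_sym/yz.
by rewrite mulrA E !mulrBl -(mulrA e y) -exprS !IH subrr.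
Qed.
End Circle.

(** * Cups between arbitrary strands in the presented algebra *)

Section PresentedRing.
Variables (d : nat) (A : nzRingType) (s e : 'I_d.-1 -> A) (y : 'I_d -> A).
Hypothesis hrel : forall l r, relation s e y l r -> l = r.

Lemma pres_ss a : s a * s a = 1. Proof. by apply: hrel; apply: P1. Qed.
Lemma pres_far a b : far a b -> s a * s b = s b * s a.
Proof. by move=> ab; apply: hrel; apply: P2_far. Qed.
Lemma pres_braid (c c' : 'I_d.-1) : c' = c.+1 :> nat ->
  s c * s c' * s c = s c' * s c * s c'.
Proof. by move=> cc; apply: hrel; apply: P2_braid. Qed.

Definition sperm : {perm 'I_d} -> A := coxrep s.

Lemma sperm1 : sperm 1%g = 1.
Proof. exact: (coxrep1 pres_ss pres_far pres_braid). Qed.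
Lemma spermM p q : sperm (p * q)%g = sperm q * sperm p.
Proof. exact: (coxrepM pres_ss pres_far pres_braid). Qed.
Lemma sperm_adj a : sperm (adj a) = s a.
Proof. exact: (coxrep_adj pres_ss pres_far pres_braid). Qed.
Lemma spermV p : sperm p * sperm p^-1%g = 1.
Proof. by rewrite -spermM mulVg sperm1. Qed.
Lemma spermVl p : sperm p^-1%g * sperm p = 1.
Proof. by rewrite -spermM mulgV sperm1. Qed.

(* Conjugating the last generator, because a permutation fixing its two strands
   is a word in generators far from it. *)
Definition ecup (i j : 'I_d) : A :=
  if i == j then 0 else
  if [pick z : 'I_d.-1 | z.+1 == d.-1] is Some z then
    let p := (tperm (lo z) i * tperm (tperm (lo z) i (hi z)) j)%g in
    sperm p * e z * sperm p^-1%g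
  else 0.

(** Without generators there are no two distinct strands, so the default 0 in [ecup] does no
    harm. *)
Lemma last_generator : (exists z : 'I_d.-1, z.+1 == d.-1) \/ (forall i j : 'I_d, i = j).
Proof.
case: (ltnP 1 d) => h; [left | right].
  have zd : (d.-2 < d.-1)%N by lia.
  by exists (Ordinal zd); apply/eqP => /=; lia.
by move=> i j; apply: val_inj => /=; have := ltn_ord i; have := ltn_ord j; lia.
Qed.

(** Two permutations that agree on the strands of the last generator differ by one fixing both
    strands, and [coxrep_parabolic] moves this one past [e z]. *)
Lemma ecup_lastE (z : 'I_d.-1) (p : {perm 'I_d}) i j : z.+1 == d.-1 -> p (lo z) = i -> p (hi z) = j ->
  ecup i j = sperm p * e z * sperm p^-1%g.
Proof.
move=> zd pi pj; have lh := lo_neq_hi z.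
have ij : i != j by rewrite -pi -pj (inj_eq perm_inj).
rewrite /ecup (negPf ij); case: pickP => [z' z'd|/(_ z)]; last by rewrite zd.
have -> : z' = z by apply: val_inj => /=; move/eqP: z'd; move/eqP: zd; lia.
set q := (_ * _)%g; cbv zeta.
have qi : q (lo z) = i.
  rewrite permM tpermL tpermD //; last by rewrite eq_sym.
  by rewrite -{2}(tpermL (lo z) i) (inj_eq perm_inj) eq_sym.
have qj : q (hi z) = j by rewrite permM tpermL.
have [r [rE rlo rhi]] : exists r, [/\ p = (r * q)%g, r (lo z) = lo z & r (hi z) = hi z].
  exists (p * q^-1)%g; rewrite mulgKV !permM pi pj -{1}qi -{1}qj !permK.
  by split.
have rz : sperm r * e z = e z * sperm r.
  apply: (coxrep_parabolic pres_ss pres_far pres_braid (n := z)); first exact/eqP.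
    move=> x zx; have [xz|xz] := eqVneq (x : nat) z.
      by have -> : x = lo z by apply: val_inj.
    have -> : x = hi z by apply: val_inj => /=; move/eqP: zd; have := ltn_ord x; lia.
    by [].
  by move=> b bz; apply: hrel; apply: P5_se; rewrite /far bz.
clearbody q; rewrite rE invMg !spermM -(mulrA _ (sperm r)) rz -!mulrA.
by rewrite (mulrA (sperm r)) spermV mul1r.
Qed.

Lemma ecup_perm (p : {perm 'I_d}) i j : sperm p * ecup i j = ecup (p i) (p j) * sperm p.
Proof.
have [<-|ij] := eqVneq i j; first by rewrite /ecup !eqxx mulr0 mul0r.
case: last_generator => [[z zd]|/(_ i j)E]; last by rewrite E eqxx in ij.
have [||//|q [qi qj]] := @perm_of_seqs _ [:: lo z; hi z] [:: i; j].
- by rewrite /= !inE lo_neq_hi.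
- by rewrite /= !inE ij.
rewrite (ecup_lastE zd qi qj) (@ecup_lastE z (q * p)%g) //; first last.
- by rewrite permM qj.
- by rewrite permM qi.
by rewrite invMg !spermM -!mulrA spermVl mulr1.
Qed.

Lemma adj_next (c c' : 'I_d.-1) : c' = c.+1 :> nat ->
  let p := (adj c' * adj c)%g in p (lo c) = lo c' /\ p (hi c) = hi c'.
Proof.
move=> cc p; rewrite /p /adj; have hE : hi c = lo c' by apply: val_inj.
have E1 : tperm (lo c') (hi c') (lo c) = lo c.
  by rewrite tpermD // -val_eqE /=; lia.
have E2 : tperm (lo c) (hi c) (hi c') = hi c'.
  by rewrite tpermD // -val_eqE /=; lia.
by rewrite !permM E1 tpermL hE tpermL -hE E2.
Qed.

(** Downward induction from the last generator. The step is that [s a * s a'] conjugates [e a] into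
    [e a'], since by (P.6) both [s a * s a' * e a] and [e a' * s a * s a'] are the negative of
    [e a' * e a]. *)
Lemma ecupE a : ecup (lo a) (hi a) = e a.
Proof.
have [m] : exists m, (d.-1 - a.+1)%N = m by eexists.
elim: m a => [|m IH] a E.
  rewrite (@ecup_lastE a 1%g); rewrite ?perm1 ?invg1 ?sperm1 ?mulr1 ?mul1r //.
  by apply/eqP; have := ltn_ord a; lia.
have a'd : (a.+1 < d.-1)%N by lia.
pose a' := Ordinal a'd; have [//|pl ph] := @adj_next a a'.
set p := (_ * _)%g in pl ph.
have pE : sperm p = s a * s a' by rewrite spermM !sperm_adj.
have pe : sperm p * e a = e a' * sperm p.
  rewrite pE; apply: oppr_inj; transitivity (e a' * e a).
    have /(congr1 (fun x => s a * x)) := hrel (@P6_see _ _ s e y a a' erefl).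
    by rewrite !mulrA pres_ss mul1r mulrN mulrA => ->.
  have /(congr1 (fun x => x * s a')) := hrel (@P6_ees' _ _ s e y a a' erefl).
  by rewrite -mulrA pres_ss mulr1 mulNr mulrA.
have := ecup_perm p (lo a) (hi a); rewrite pl ph (IH a'); last by rewrite /a' /=; lia.
rewrite -pe => /(congr1 (fun x => sperm p^-1 * x)).
by rewrite !mulrA spermVl !mul1r.
Qed.

(* To prove an identity for arbitrary distinct strands, carry it over from generators. *)
Lemma sperm_transport p (x x' z z' : A) : sperm p * x = x' * sperm p ->
  sperm p * z = z' * sperm p -> x = z -> x' = z'.
Proof.
move=> hx hz xz; rewrite -[x']mulr1 -[z']mulr1 -(spermV p) !mulrA -hx -hz.
by rewrite xz.
Qed.

Lemma sperm_tperm (p : {perm 'I_d}) i j : sperm p * sperm (tperm i j) = sperm (tperm (p i) (p j)) * sperm p.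
Proof. by rewrite -!spermM -tpermJ -conjgC. Qed.

Lemma sperm_mul p (x x' z z' : A) : sperm p * x = x' * sperm p ->
  sperm p * z = z' * sperm p -> sperm p * (x * z) = (x' * z') * sperm p.
Proof. by move=> hx hz; rewrite mulrA hx -mulrA hz mulrA. Qed.

Lemma sperm_opp p (x x' : A) : sperm p * x = x' * sperm p ->
  sperm p * (- x) = (- x') * sperm p.
Proof. by move=> hx; rewrite mulrN hx mulNr. Qed.

Lemma uniq_bound (l : seq 'I_d) : uniq l -> (size l <= d)%N.
Proof. by move=> /card_uniqP <-; rewrite -[leqRHS]card_ord max_card. Qed.

Lemma pres_e_se a : s a * e a = e a.
Proof. by apply: oppr_inj; symmetry; apply: hrel; apply: P6_se. Qed.

Lemma perm_of_pair (i j : 'I_d) : i != j ->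
  exists (a : 'I_d.-1) (p : {perm 'I_d}), p (lo a) = i /\ p (hi a) = j.
Proof.
move=> ij; have := @uniq_bound [:: i; j]; rewrite /= inE ij => /(_ isT) d2.
have hd : (0 < d.-1)%N by lia.
exists (Ordinal hd).
have [||//|q [qi qj]] := @perm_of_seqs _ [:: lo (Ordinal hd); hi (Ordinal hd)] [:: i; j].
- by [].
- by rewrite /= !inE ij.
by exists q.
Qed.

(** Each identity is checked on the first few strands, where it is one of the defining relations,
    and transported. *)
Lemma ecup_rep : periplectic_rep sperm ecup.
Proof.
split; [exact: sperm1 | exact: spermM | exact: ecup_perm | | | | | ].
- move=> i j /perm_of_pair[a [p [<- <-]]].
  apply: (@sperm_transport p _ _ _ _ _ (ecup_perm p (lo a) (hi a))).
    by apply: sperm_mul (ecup_perm p _ _); apply: sperm_tperm.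
  by rewrite ecupE sperm_adj pres_e_se.
- move=> i j /perm_of_pair[a [p [<- <-]]].
  apply: (@sperm_transport p (ecup (hi a) (lo a)) _ (- e a)); first exact: ecup_perm.
    by apply: sperm_opp; rewrite -ecupE ecup_perm.
  have := ecup_perm (adj a) (lo a) (hi a); rewrite tpermL tpermR ecupE sperm_adj.
  move=> E; rewrite -[LHS]mulr1 -(pres_ss a) mulrA -E pres_e_se.
  by apply: hrel; apply: P6_es.
- move=> i j /perm_of_pair[a [p [<- <-]]].
  apply: (@sperm_transport p (e a * e a) _ 0); first last.
  + by apply: hrel; apply: P3.
  + by rewrite mulr0 mul0r.
  by apply: sperm_mul; rewrite -ecupE ecup_perm.
- move=> i j k l u; have /= d4 := uniq_bound u.
  have [h0 h2] : (0 < d.-1)%N /\ (2 < d.-1)%N by lia.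
  pose a := Ordinal h0; pose b := Ordinal h2.
  have [||//|p [<- <- <- <-]] := @perm_of_seqs _ [:: lo a; hi a; lo b; hi b] [:: i; j; k; l].
  + by [].
  + by [].
  apply: (@sperm_transport p (e a * e b) _ (e b * e a)).
  + by apply: sperm_mul; rewrite -ecupE ecup_perm.
  + by apply: sperm_mul; rewrite -ecupE ecup_perm.
  by apply: hrel; apply: P5_ee.
- move=> i j k u; have /= d3 := uniq_bound u.
  have [h0 h1] : (0 < d.-1)%N /\ (1 < d.-1)%N by lia.
  pose a := Ordinal h0; pose b := Ordinal h1.
  have [||//|p [<- <- <-]] := @perm_of_seqs _ [:: lo a; hi a; hi b] [:: i; j; k].
  + by [].
  + by [].
  have hE : hi a = lo b by apply: val_inj.
  apply: (@sperm_transport p (e a * e b) _ (s b * s a * e b)).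
  + by apply: sperm_mul; rewrite -ecupE ecup_perm ?hE.
  + apply: sperm_mul; last by rewrite -ecupE ecup_perm hE.
    by apply: sperm_mul; rewrite -sperm_adj sperm_tperm ?hE.
  have /(congr1 (fun x => s b * x)) := hrel (@P6_see' _ _ s e y a b erefl).
  by rewrite !mulrA pres_ss mul1r.
Qed.

Hypothesis torsion_free : forall (x : A) k, x *+ k.+1 = 0 -> x = 0.

Lemma pres_yy i j : y i * y j = y j * y i.
Proof. by apply: hrel; apply: P5_yy. Qed.

Let eyE a : e a * (y (lo a) - y (hi a)) = e a. Proof. by apply: hrel; apply: P8_l. Qed.
Let yeE a : (y (lo a) - y (hi a)) * e a = - e a. Proof. by apply: hrel; apply: P8_r. Qed.

Lemma circle_lo a k : e a * y (lo a) ^+ k * e a = 0.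
Proof. exact: (circle_eq0 torsion_free (pres_yy _ _) (eyE a) (yeE a)). Qed.

Lemma circle a m n : e a * y (lo a) ^+ m * y (hi a) ^+ n * e a = 0.
Proof. exact: (circle2_eq0 torsion_free (pres_yy _ _) (eyE a) (yeE a)). Qed.
End PresentedRing.

(** * Undotted stacks up to sign *)

Section UpToSign.
Variable B : pzRingType.
Definition pm (x y : B) : Prop := exists b : bool, x = (-1) ^+ b * y.

Lemma pm_refl x : pm x x. Proof. by exists false; rewrite mul1r. Qed.
Lemma pm_opp x : pm x (- x). Proof. by exists true; rewrite expr1 mulN1r opprK. Qed.
Lemma pm_oppl x : pm (- x) x. Proof. by exists true; rewrite expr1 mulN1r. Qed.
Lemma pm_sym x y : pm x y -> pm y x.
Proof. by move=> [b ->]; exists b; rewrite mulrA -expr2 sqrr_sign mul1r. Qed.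
Lemma pm_trans y x z : pm x y -> pm y z -> pm x z.
Proof.
move=> [b ->] [c ->]; rewrite mulrA -signr_addb.
by exists (b (+) c).
Qed.
Lemma pm_mulr z x y : pm x y -> pm (x * z) (y * z).
Proof. by move=> [b ->]; exists b; rewrite mulrA. Qed.
Lemma pm_mull z x y : pm x y -> pm (z * x) (z * y).
Proof. by move=> [b ->]; exists b; rewrite mulrA (commr_sign z b) -mulrA. Qed.
Lemma pm_eq0 x y : pm x y -> y = 0 -> x = 0.
Proof. by move=> [b ->] ->; rewrite mulr0. Qed.
End UpToSign.

Section PartnerMaps.
Variable V : finType.

(** Partner functions of perfect matchings; Brauer diagrams are handled through them rather than
    through their sets of edges. *)
Definition fpf_inv (f : V -> V) := involutive f /\ forall u, f u != u.

(* The effect on partners of contracting the ends a, b and joining them by a cup. *)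
Definition surg (f : V -> V) (a b : V) (u : V) : V :=
  tperm b (f a) (f (tperm b (f a) u)).

Lemma surg_fpf f a b : fpf_inv f -> fpf_inv (surg f a b).
Proof.
move=> [fK ff]; split=> u; first by rewrite /surg tpermK fK tpermK.
by rewrite /surg -{2}[u](tpermK b (f a)) (inj_eq perm_inj).
Qed.

(** The involution f conjugates the transposition defining [surg f a b] into the one defining
    [surg f b a], and the two transpositions are disjoint. *)
Lemma surgC f a b : fpf_inv f -> a != b -> f a != b -> surg f a b =1 surg f b a.
Proof.
move=> [fK ff] ab fab u; have fba : f b != a by rewrite (can2_eq fK fK) eq_sym.
have fi := inv_inj fK; rewrite /surg !(inj_tperm _ _ _ fi) !fK.
have E : (tperm (f b) a * tperm b (f a) = tperm b (f a) * tperm (f b) a)%g.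
  rewrite (conjgC (tperm (f b) a)) tpermJ !tpermD //.
  - by rewrite eq_sym.
  - by rewrite eq_sym.
  by rewrite (inj_eq fi).
have /permP/(_ (f u)) := E; rewrite !permM => ->.
by rewrite (tpermC (f a)) (tpermC a).
Qed.
End PartnerMaps.

(** * Products of disjoint cups *)

Section Cups.
Variables (X : finType) (B : pzRingType) (R : {perm X} -> B) (e : X -> X -> B).
Hypothesis H : periplectic_rep R e.
Local Notation s i j := (R (tperm i j)).

Definition pts (L : seq (X * X)) : seq X := flatten [seq [:: p.1; p.2] | p <- L].
(** For disjoint pairs this is the involution exchanging the two feet of each cup; it is all that
    the product of the cups remembers of the list, up to sign. *)
Definition mu (L : seq (X * X)) : {perm X} := foldr (fun p q => tperm p.1 p.2 * q)%g 1%g L.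
Definition cups (L : seq (X * X)) : B := foldr (fun p x => e p.1 p.2 * x) 1 L.

Lemma uniq_pts i j L : uniq (pts ((i, j) :: L)) ->
  [/\ i != j, i \notin pts L, j \notin pts L & uniq (pts L)].
Proof. by rewrite /= !inE negb_or => /and3P[/andP[]]. Qed.

Lemma in_pts i j L k : (k \in pts ((i, j) :: L)) = [|| k == i, k == j | k \in pts L].
Proof. by rewrite !inE. Qed.

Lemma mu_out L k : k \notin pts L -> mu L k = k.
Proof.
elim: L => [|[i j] L IH] /=; first by rewrite perm1.
rewrite !inE !negb_or => /and3P[ki kj kL].
by rewrite permM tpermD 1?eq_sym // IH.
Qed.

Lemma mu_cons i j L : uniq (pts ((i, j) :: L)) ->
  (mu ((i, j) :: L) i = j) * (mu ((i, j) :: L) j = i).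
Proof.
rewrite /= !inE negb_or => /and3P[/andP[ij iL] jL _].
by rewrite !permM tpermL tpermR !mu_out.
Qed.

Lemma mu_cons_out i j L k : k != i -> k != j -> mu ((i, j) :: L) k = mu L k.
Proof. by move=> ki kj; rewrite permM tpermD // eq_sym. Qed.

Lemma mu_in L k : uniq (pts L) -> k \in pts L -> (mu L k \in pts L) && (mu L k != k).
Proof.
elim: L => [|[i j] L IH] // u; have [mi mj] := mu_cons u.
have [ij iL jL uL] := uniq_pts u; rewrite !in_pts.
have [->|ki] := eqVneq k i; first by rewrite mi (eq_sym j) (negPf ij) !eqxx orbT.
have [->|kj] := eqVneq k j; first by rewrite mj eqxx (negPf ij).
by move=> /= /(IH uL) /andP[h1 h2]; rewrite mu_cons_out // h1 h2 !orbT.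
Qed.

Lemma mu_pts L k : uniq (pts L) -> (k \in pts L) = (mu L k != k).
Proof.
move=> u; apply/idP/idP => [/(mu_in u)/andP[]//|].
by apply: contraNT => /mu_out->.
Qed.

Lemma muK L : uniq (pts L) -> involutive (mu L).
Proof.
elim: L => [|[i j] L IH] u k; first by rewrite !perm1.
have [mi mj] := mu_cons u.
have [ij iL jL uL] := uniq_pts u.
have [->|ki] := eqVneq k i; first by rewrite mi mj.
have [->|kj] := eqVneq k j; first by rewrite mj mi.
have [kL|kL] := boolP (k \in pts L); last first.
  have E : mu ((i, j) :: L) k = k by rewrite mu_cons_out // mu_out.
  by rewrite !E.
have /andP[mkL _] := mu_in uL kL.
rewrite (mu_cons_out _ ki kj) mu_cons_out ?IH //.
  by apply: contraNneq iL => <-.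
by apply: contraNneq jL => <-.
Qed.

(** Disjoint cups commute and reversing a cup changes the sign, so the cup at k can be brought to
    the front with k as its first foot. *)
Lemma cups_extract L k : uniq (pts L) -> k \in pts L ->
  exists L', [/\ uniq (pts ((k, mu L k) :: L')), mu L = mu ((k, mu L k) :: L')
               & pm (cups L) (e k (mu L k) * cups L')].
Proof.
elim: L => [|[i j] L IH] // u; have [mi mj] := mu_cons u.
have [ij iL jL uL] := uniq_pts u; rewrite in_pts.
have [->|ki] := eqVneq k i.
  by exists L; rewrite -/(mu ((i, j) :: L)) mi; split; [ | | apply: pm_refl].
have [->|kj] := eqVneq k j.
  move=> _; exists L; rewrite -/(mu ((i, j) :: L)) mj; split.
  - by rewrite /= !inE negb_or eq_sym ij iL jL.
  - by rewrite /= tpermC.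
  by rewrite (prepC H ij) mulNr; apply: pm_opp.
rewrite !orFb => kL; have [L' [u' muE cE]] := IH uL kL.
rewrite mu_cons_out //.
have /andP[mkL mk] := mu_in uL kL.
have [il jl] : mu L k != i /\ mu L k != j.
  by split; [apply: contraNneq iL | apply: contraNneq jL] => <-.
have pE : pts L =i pts ((k, mu L k) :: L') by move=> x; rewrite (mu_pts x uL) (mu_pts x u') -muE.
have u2 : uniq (pts ((k, mu L k) :: (i, j) :: L')).
  move: iL jL u'; rewrite !pE /= !inE !negb_or.
  move=> /and3P[_ _ ->] /and3P[_ _ ->] /and3P[/andP[-> ->] -> ->].
  by rewrite ki kj il jl ij.
have u4 : uniq [:: i; j; k; mu L k].
  by rewrite /= !inE !negb_or ij ![_ == k]eq_sym ki kj eq_sym il eq_sym jl eq_sym mk.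
exists ((i, j) :: L'); split=> //.
  rewrite /= {1}muE /= !mulgA; congr (_ * _)%g.
  by rewrite (conjgC (tperm i j)) tpermJ !tpermD // eq_sym.
rewrite /= mulrA -(prep_far H) // -mulrA; exact: pm_mull.
Qed.

Lemma cups_mu L L' : uniq (pts L) -> uniq (pts L') -> mu L = mu L' -> pm (cups L) (cups L').
Proof.
elim: L L' => [|[i j] L IH] L' u u' E.
  case: L' u' E => [|[i j] L'] u' E; first exact: pm_refl.
  have := mu_pts i u'; rewrite -E perm1 eqxx.
  by rewrite /= inE eqxx.
have [mi mj] := mu_cons u.
have iL' : i \in pts L' by rewrite mu_pts // -E -mu_pts // /= inE eqxx.
have [L'' []] := cups_extract u' iL'; rewrite -E mi => u'' mE /pm_sym cE.
apply: pm_trans cE; apply: pm_mull; apply: IH; last exact: mulgI mE.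
  by move: u => /= /and3P[].
by move: u'' => /= /and3P[].
Qed.

Lemma cups_swap L k : uniq (pts L) -> k \in pts L ->
  pm (s k (mu L k) * cups L) (cups L).
Proof.
move=> u kL; have [L' [u' _ cE]] := cups_extract u kL.
apply: pm_trans (pm_mull _ cE) _; rewrite mulrA (prep_se H); first exact: pm_sym.
by have /andP[_] := mu_in u kL; rewrite eq_sym.
Qed.

Lemma cups_swap2 L k k' : uniq (pts L) -> k \in pts L -> k' \in pts L -> k' != k ->
  k' != mu L k -> pm (s k k' * s (mu L k) (mu L k') * cups L) (cups L).
Proof.
move=> u kL k'L kk' mkk'; have [L' [u' mE cE]] := cups_extract u kL.
have k'L' : k' \in pts L'.
  have := mu_pts k' u'; rewrite -mE -mu_pts // k'L => /idP.
  by rewrite /= !inE (negPf kk') (negPf mkk').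
have uL' : uniq (pts L') by move: u' => /= /and3P[].
have mk' : mu L' k' = mu L k' by rewrite mE mu_cons_out.
have [L'' [u'' mE'' cE'']] := cups_extract uL' k'L'.
have /andP[mkL' mk'k'] := mu_in uL' k'L'.
have {cE cE''} cE : pm (cups L) (e k (mu L k) * e k' (mu L k') * cups L'').
  by rewrite -mulrA; apply: pm_trans cE (pm_mull _ _); rewrite -mk'.
apply: pm_trans (pm_mull _ cE) _; apply: pm_sym; apply: pm_trans cE _.
rewrite mulrA (rep_cups H) ?mulNr; first exact: pm_opp.
have [h1 h2 h3 _] := uniq_pts u'; rewrite -mk' /= !inE !negb_or h1 (eq_sym k) kk'.
rewrite (eq_sym (mu L k)) mkk' (eq_sym k') mk'k' !andbT /=.
by apply/andP; split; [apply: contraNneq h2 | apply: contraNneq h3] => ->.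
Qed.

Definition moved (p : {perm X}) := [set x | p x != x].

(** Such permutations form the hyperoctahedral group of the pairs, generated by flips of one pair
    and exchanges of two pairs, for which [cups_swap] and [cups_swap2] give the sign. The induction
    is on the number of moved points. *)
Lemma cups_stab L (p : {perm X}) : uniq (pts L) -> (forall k, k \notin pts L -> p k = k) ->
  (forall k, p (mu L k) = mu L (p k)) -> pm (R p * cups L) (cups L).
Proof.
move=> u; have [n] : exists n, (#|moved p| <= n)%N by exists #|moved p|.
elim: n p => [|n IH] p pn pfix pmu.
  have -> : p = 1%g.
    apply/permP => x; rewrite perm1; apply/eqP; move: pn; rewrite leqn0 cards_eq0.
    by move=> /eqP/setP/(_ x); rewrite !inE => /negbFE.
  by rewrite (prep1 H) mul1r; apply: pm_refl.
have [/eqP|[k]] := set_0Vmem (moved p).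
  by rewrite -cards_eq0 => /eqP p0; apply: IH => //; rewrite p0.
rewrite inE => pk.
have kL : k \in pts L by apply: contraNT pk => /pfix ->.
have pkL : p k \in pts L.
  by rewrite mu_pts // -pmu (inj_eq perm_inj) -mu_pts.
set m := mu L k.
have mk : m != k by have /andP[] := mu_in u kL.
have mmk : mu L m = k by rewrite muK.
(* h undoes the motion of the pair of k. *)
suff [h [hh hc hmu hkm hfix]] : exists h : {perm X}, [/\ (h * h = 1)%g,
    pm (R h * cups L) (cups L), forall x, h (mu L x) = mu L (h x),
    h (p k) = k & forall x, p x = x -> x != k -> h x = x].
  have -> : p = (p * h * h)%g by rewrite -mulgA hh mulg1.
  rewrite (prepM H) -mulrA; apply: pm_trans hc; apply: pm_mull.
  apply: IH.
  - rewrite -ltnS; apply: leq_trans pn; apply: proper_card.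
    apply/properP; split; last by exists k; rewrite !inE ?permM ?hkm ?eqxx.
    apply/subsetP => x; rewrite !inE permM; apply: contra => /eqP px.
    have xk : x != k by apply: contraNneq pk => <-; rewrite px.
    by rewrite px hfix.
  - move=> x xL; rewrite permM pfix // hfix ?pfix //.
    by apply: contraNneq xL => ->.
  by move=> x; rewrite !permM pmu hmu.
have [pkm|pkm] := eqVneq (p k) m.
  exists (tperm k m); split; rewrite ?tperm2 ?pkm ?tpermR //.
  - exact: cups_swap.
  - move=> x; have E : (tperm k m ^ mu L = tperm k m)%g by rewrite tpermJ -/m mmk tpermC.
    by have /permP/(_ x) := conjgC (tperm k m) (mu L); rewrite E !permM => ->.
  move=> x px xk; rewrite tpermD //; first by rewrite eq_sym.
  apply: contraNneq mk => mx; rewrite -mx in px.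
  by apply/eqP; apply: (@perm_inj _ p); rewrite px pkm.
set k' := p k in pkm pk pkL *; set m' := mu L k'.
have pm' : p m = m' by rewrite /m pmu.
have m'k' : m' != k' by have /andP[] := mu_in u pkL.
have m'k : m' != k.
  by rewrite /m' (can2_eq (muK u) (muK u)) -/m.
have m'm : m' != m by rewrite /m' /m (inj_eq perm_inj).
have dis : (tperm k k' * tperm m m' = tperm m m' * tperm k k')%g.
  by rewrite (conjgC (tperm k k')) tpermJ !tpermD // eq_sym.
exists (tperm k k' * tperm m m')%g; split.
- rewrite {1}dis -mulgA (mulgA (tperm k k')) tperm2 mul1g.
  exact: tperm2.
- rewrite dis (prepM H); exact: cups_swap2.
- move=> x; have E : ((tperm k k' * tperm m m') ^ mu L = tperm k k' * tperm m m')%g.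
    by rewrite conjMg !tpermJ -/m -/m' mmk muK // -dis.
  by have /permP/(_ x) := conjgC (tperm k k' * tperm m m')%g (mu L); rewrite E !(permM, permM (mu L)) => ->.
- by rewrite permM tpermR tpermD // eq_sym.
move=> x px xk.
have xk' : x != k' by apply: contraNneq pk => xk'; rewrite -(inj_eq (@perm_inj _ p)) -/k' -xk' px.
have [xm xm'] : x != m /\ x != m'.
  split; apply: contraNneq m'm => xE; rewrite -xE.
    by rewrite -{1}pm' -xE px.
  by rewrite -(inj_eq (@perm_inj _ p)) px pm' xE.
by rewrite permM !tpermD // eq_sym.
Qed.
End Cups.

(** * Diagrams of permutations times cups *)

Section DiagramOfForm.
Variable X : finType.

(* Partners in the diagram of R p * cups L, where q = mu L pairs the bottom ends. *)
Definition dpart (p q : {perm X}) (u : X + X) : X + X :=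
  match u with
  | inl x => let k := (p^-1)%g x in if q k == k then inr k else inl (p (q k))
  | inr k => if q k == k then inl (p k) else inr (q k)
  end.

Definition lperm (p : {perm X}) (u : X + X) : X + X :=
  match u with inl x => inl (p x) | inr k => inr k end.

Lemma lpermK p : cancel (lperm p) (lperm p^-1%g).
Proof. by case=> //= x; rewrite permK. Qed.

Lemma lperm_tperm a b u : lperm (tperm a b) u = tperm (inl a) (inl b) u.
Proof.
case: u => [x|k] /=; last by rewrite tpermD.
by rewrite -(inj_tperm _ _ _ (@inl_inj X X)).
Qed.

Lemma dpart_fpf (p q : {perm X}) : involutive q -> fpf_inv (dpart p q).
Proof.
move=> qK; split=> -[x|k] /=.
- case: eqP => [E|/eqP E] /=; first by rewrite E eqxx permKV.
  by rewrite permK qK eq_sym (negPf E) permKV.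
- case: eqP => [E|/eqP E] /=; first by rewrite permK E eqxx.
  by rewrite qK eq_sym (negPf E).
- have [E|E] := eqVneq (q (p^-1%g x)) (p^-1%g x); first by [].
  by apply: contraNneq E => -[E]; rewrite -{2}E permK.
- have [E|E] := eqVneq (q k) k; first by [].
  by apply: contraNneq E => -[->].
Qed.

Lemma dpart_lperm p q r u : dpart (p * r)%g q u = lperm r (dpart p q (lperm r^-1%g u)).
Proof.
case: u => [x|k] /=; last by case: eqP => //= _; rewrite permM.
by rewrite invMg !permM; case: eqP.
Qed.

Lemma dpart_tperm p q a b u :
  dpart (p * tperm a b)%g q u = tperm (inl a) (inl b) (dpart p q (tperm (inl a) (inl b) u)).
Proof. by rewrite dpart_lperm tpermV !lperm_tperm. Qed.
End DiagramOfForm.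

Section Coherence.
Variables (X : finType) (B : pzRingType) (R : {perm X} -> B) (e : X -> X -> B).
Hypothesis H : periplectic_rep R e.

(** The bottom ends determine the pairing [mu L] and the values of p on the free strands; the top
    ends then determine p up to a permutation commuting with the pairing, which [cups_stab] turns
    into a sign. *)
Lemma dpart_inj (p p' : {perm X}) (L L' : seq (X * X)) : uniq (pts L) -> uniq (pts L') ->
  dpart p (mu L) =1 dpart p' (mu L') -> pm (R p * cups e L) (R p' * cups e L').
Proof.
move=> u u' E.
have muE : mu L = mu L'.
  apply/permP => k; have := E (inr k) => /=.
  by case: eqP => [->|_]; case: eqP => [->|_] // [].
apply: pm_trans (pm_mull _ (cups_mu H u u' muE)) _.
pose r := (p' * p^-1)%g.
have -> : p' = (r * p)%g by rewrite mulgKV.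
rewrite (prepM H) -mulrA; apply: pm_mull; apply: pm_sym; apply: cups_stab => //.
  move=> k kL; have := E (inr k); rewrite /= muE.
  have -> : mu L' k == k by rewrite -[_ == _]negbK -mu_pts.
  by move=> -[pk]; rewrite permM -pk permK.
move=> k; have := E (inl (p' k)); rewrite /= muE permK !permM.
have [mk|mk] := eqVneq (mu L' k) k.
  by case: eqP => // -> _; rewrite mk.
by case: eqP => // _ [<-]; rewrite permK.
Qed.

Lemma mu_cons2 (k l : X) L x : k \notin pts L -> l \notin pts L ->
  mu ((k, l) :: L) x = if x == k then l else if x == l then k else mu L x.
Proof.
move=> kL lL; rewrite permM; have [->|xk] := eqVneq x k; first by rewrite tpermL mu_out.
have [->|xl] := eqVneq x l; first by rewrite tpermR mu_out.
by rewrite tpermD // eq_sym.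
Qed.

(** Moved through [R p], the new cup has feet k and l. Either they are joined by a cup of L and
    close a circle, or one of them lies on a cup and slides along it, or both are free and a cup is
    added to L. *)
Lemma cup_form (p : {perm X}) L x y : uniq (pts L) -> x != y ->
    let f := dpart p (mu L) in
  if f (inl x) == inl y then e x y * (R p * cups e L) = 0 else
  exists p' L', [/\ uniq (pts L'), pm (e x y * (R p * cups e L)) (R p' * cups e L')
    & dpart p' (mu L') =1 surg f (inl x) (inl y)].
Proof.
move=> u xy f; have ff : fpf_inv f by apply: dpart_fpf; apply: muK.
pose k := (p^-1)%g x; pose l := (p^-1)%g y.
have [xE yE] : x = p k /\ y = p l by rewrite !permKV.
have kl : k != l by rewrite (inj_eq perm_inj).
have eE : e x y * (R p * cups e L) = R p * (e k l * cups e L).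
  by rewrite xE yE mulrA -(prepE H) mulrA.
have [E|nE] := eqVneq (f (inl x)) (inl y).
  rewrite eE; have kL : k \in pts L.
    by rewrite mu_pts //; move: E; rewrite /f /= -/k; case: eqP.
  have mk : mu L k = l.
    by move: E; rewrite /f /= -/k; case: eqP => // _ [E]; rewrite /l -E permK.
  have [L' [_ _]] := cups_extract H u kL; rewrite mk => cE.
  rewrite (pm_eq0 (pm_mull _ cE)) ?mulr0 //.
  by rewrite mulrA (prep_ee H) // mul0r.
have nE' : inl x != inl y :> X + X by rewrite (inj_eq inl_inj).
(* An end which is already on a cup slides along it. *)
have slide (a b : X) : a != b -> a \in pts L -> mu L a != b ->
    pm (R p * (e a b * cups e L)) (R (tperm b (mu L a) * p)%g * cups e L).
  move=> ab aL mab; have [L' [_ _ cE]] := cups_extract H u aL.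
  rewrite (prepM H) -mulrA; apply: pm_mull; apply: pm_trans (pm_mull _ cE) _.
  apply: pm_sym; apply: pm_trans (pm_mull _ cE) _; rewrite !mulrA.
  have /andP[_ ma] := mu_in u aL; have ba : b != a by rewrite eq_sym.
  apply: pm_mulr; rewrite (prepC H ba) mulNr.
  rewrite (rep_near_l H); first exact: pm_opp.
  by rewrite /= !inE negb_or ba eq_sym mab eq_sym ma.
have slide_dpart (a b : X) : a \in pts L ->
    dpart (tperm b (mu L a) * p)%g (mu L) =1 surg f (inl (p a)) (inl (p b)).
  move=> aL z; rewrite (conjgC (tperm _ _)) tpermJ dpart_tperm -/f /surg.
  suff -> : f (inl (p a)) = inl (p (mu L a)) by [].
  by rewrite /f /= permK -[_ == _]negbK -mu_pts // aL.
have [kL|kL] := boolP (k \in pts L).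
  have mkl : mu L k != l.
    apply: contraNneq nE; rewrite /f /= -/k => mk; rewrite mk yE.
    by have /andP[_] := mu_in u kL; rewrite mk => /negPf->.
  exists (tperm l (mu L k) * p)%g, L; split=> //; first by rewrite eE; apply: slide.
  by rewrite xE yE; apply: slide_dpart.
have [lL|lL] := boolP (l \in pts L).
  have mlk : mu L l != k by apply: contraNneq kL => <-; have /andP[] := mu_in u lL.
  exists (tperm k (mu L l) * p)%g, L; split=> //.
    have lk : l != k by rewrite eq_sym.
    rewrite eE (prepC H lk) mulNr mulrN; apply: pm_trans (pm_oppl _) _.
    by apply: slide; rewrite // eq_sym.
  by move=> z; rewrite surgC // {1}xE {1}yE; apply: slide_dpart.
exists p, ((k, l) :: L); split.
- by rewrite /= inE negb_or kl kL lL.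
- by rewrite eE; apply: pm_refl.
have fx : f (inl x) = inr k by rewrite /f /= -/k mu_out // eqxx.
have fy : f (inl y) = inr l by rewrite /f /= -/l mu_out // eqxx.
have fk : f (inr k) = inl x by rewrite /f /= mu_out // eqxx -xE.
have fl : f (inr l) = inl y by rewrite /f /= mu_out // eqxx -yE.
have mE := mu_cons2 _ kL lL.
have [fK _] := ff.
(* With both feet free the surgery only concerns the vertices x, y above and k, l below. *)
move=> [z|z]; rewrite /surg fx /= !mE.
  have [zk|zk] := eqVneq (p^-1%g z) k.
    have -> : z = x by rewrite xE -zk permKV.
    have -> : tperm (inl y) (inr k) (inl x) = inl x by rewrite tpermD // eq_sym.
    by rewrite eq_sym (negPf kl) fx tpermR yE.
  have zx : z != x by apply: contraNneq zk => ->.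
  have [zl|zl] := eqVneq (p^-1%g z) l.
    have -> : z = y by rewrite yE -zl permKV.
    rewrite (negPf kl) tpermL fk -xE tpermD //.
    by rewrite eq_sym.
  have zy : z != y by apply: contraNneq zl => ->.
  have -> : tperm (inl y) (inr k) (inl z) = inl z by rewrite tpermD // (inj_eq inl_inj) eq_sym.
  rewrite tpermD.
  - by [].
  - by rewrite -fl (inj_eq (inv_inj fK)).
  by rewrite -fx (inj_eq (inv_inj fK)) (inj_eq inl_inj) eq_sym.
have [->|zk] := eqVneq z k.
  by rewrite eq_sym (negPf kl) tpermR fy tpermD.
have [->|zl] := eqVneq z l.
  have -> : tperm (inl y) (inr k) (inr l) = inr l by rewrite tpermD.
  by rewrite (negPf kl) fl tpermL.
have -> : tperm (inl y) (inr k) (inr z) = inr z by rewrite tpermD // (inj_eq inr_inj) eq_sym.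
rewrite tpermD.
- by [].
- by rewrite -fl (inj_eq (inv_inj fK)) (inj_eq inr_inj) eq_sym.
by rewrite -fx (inj_eq (inv_inj fK)).
Qed.
End Coherence.

(** * Concatenation of Brauer diagrams *)

Lemma connect_hom (T T' : finType) (r : rel T) (r' : rel T') (h : T -> T') :
  (forall x y, r x y -> connect r' (h x) (h y)) ->
  forall x y, connect r x y -> connect r' (h x) (h y).
Proof.
move=> hr x y /connectP[p + ->]; elim: p x => [|z p IH] x //=.
by move=> /andP[/hr xz /IH]; apply: connect_trans.
Qed.

(** Labels that are constant along edges separate components; the absence of connections in stacks
    is shown in this way. *)
Lemma connect_invariant (T : finType) (r : rel T) (W : eqType) (c : T -> W) :
  (forall x y, r x y -> c x = c y) -> forall x y, connect r x y -> c x = c y.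
Proof.
move=> hr x y /connectP[p + ->]; elim: p x => [|z p IH] x //=.
by move=> /andP[/hr -> /IH].
Qed.

Lemma set2_eq (T : finType) (a b c e : T) : [set a; b] = [set c; e] ->
  (a = c /\ b = e) \/ (a = e /\ b = c).
Proof.
move=> E.
have: a \in [set c; e] by rewrite -E set21.
have: b \in [set c; e] by rewrite -E set22.
have: c \in [set a; b] by rewrite E set21.
have: e \in [set a; b] by rewrite E set22.
rewrite !inE => /orP[]/eqP-> /orP[]/eqP->; rewrite ?eqxx ?orbT //=; try by auto.
- by move=> /orP[]/eqP-> _; auto.
- by move=> _ /orP[]/eqP->; auto.
Qed.

Section Partners.
Variable d : nat.
Local Notation vertex := (vertex d).
Implicit Types (f g h : vertex -> vertex) (E F : {set {set vertex}}).

Lemma eq_edges_of f g : f =1 g -> edges_of f = edges_of g.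
Proof. by move=> fg; apply: eq_imset => u; rewrite fg. Qed.

Lemma mem_edges_of f u v : fpf_inv f -> ([set u; v] \in edges_of f) = (v == f u).
Proof.
move=> [fK ff]; apply/imsetP/eqP => [[x _ /set2_eq[[-> ->]//|[-> ->]]]|->].
  by rewrite fK.
by exists u.
Qed.

Lemma edges_of_inj f g : fpf_inv f -> fpf_inv g -> edges_of f = edges_of g -> f =1 g.
Proof.
move=> ff gg E u; apply/eqP; rewrite -(mem_edges_of _ _ gg) -E.
by rewrite mem_edges_of.
Qed.

Lemma brauer_edges E : is_brauer E -> exists2 f, fpf_inv f & E = edges_of f.
Proof.
move=> /andP[/and3P[/eqP cE tE _] /forall_inP E2].
have block u : exists v, (v != u) && ([set u; v] \in E).
  have : u \in cover E by rewrite cE inE.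
  move=> /bigcupP[B BE uB]; have /cards2P[a [b [ab BE2]]] := E2 _ BE.
  move: uB; rewrite BE2 in BE *; rewrite !inE => /orP[]/eqP->.
    by exists b; rewrite eq_sym ab.
  by exists a; rewrite ab setUC.
have uniq_block u v v' : [set u; v] \in E -> [set u; v'] \in E -> [set u; v] = [set u; v'].
  move=> h h'; apply/eqP; apply: contraT => /(trivIsetP tE _ _ h h').
  by move=> /disjoint_setI0/setP/(_ u); rewrite !inE eqxx.
pose f u := xchoose (block u).
have fP u : f u != u /\ [set u; f u] \in E by apply/andP; exact: (xchooseP (block u)).
have fK : involutive f.
  move=> u; have [n1 h1] := fP u; have [n2 h2] := fP (f u).
  rewrite setUC in h1; have /set2_eq[[_ ->]//|[_ E3]] := uniq_block _ _ _ h2 h1.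
  by rewrite E3 eqxx in n2.
have ff : fpf_inv f by split=> // u; have [] := fP u.
exists f => //; apply/setP => B; apply/idP/imsetP => [BE|[u _ ->]]; last by have [] := fP u.
have /cards2P[a [b [ab BE2]]] := E2 _ BE; exists a => //.
by rewrite BE2; apply: uniq_block; rewrite -?BE2 //; have [] := fP a.
Qed.

Lemma glued_sym E F : symmetric (glued E F).
Proof.
move=> x y; apply/existsP/existsP => -[u /existsP[v /orP[]]] /and3P[? ? ?];
  exists v; apply/existsP; exists u; apply/orP; [left|right|left|right];
  by apply/and3P; split => //; rewrite setUC.
Qed.

Lemma gluedP f g x y : fpf_inv f -> fpf_inv g ->
  reflect ((exists2 u, x = upper u & y = upper (f u)) \/
           (exists2 u, x = lower u & y = lower (g u)))
          (glued (edges_of f) (edges_of g) x y).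
Proof.
move=> ff gg; apply: (iffP existsP).
  move=> [u /existsP[v /orP[]]] /and3P[]; rewrite mem_edges_of // => /eqP-> /eqP-> /eqP->.
    by left; exists u.
  by right; exists u.
by case=> -[u -> ->]; exists u; apply/existsP; [exists (f u) | exists (g u)];
  rewrite !mem_edges_of // !eqxx ?orbT.
Qed.

Lemma concat_edges_of E F h : fpf_inv h ->
  (forall u, connect (glued E F) (outer u) (outer (h u))) ->
  (forall u v, u != v -> connect (glued E F) (outer u) (outer v) -> v = h u) ->
  concat E F = edges_of h.
Proof.
move=> [hK hh] h1 h2; apply/setP => B; rewrite inE; apply/existsP/imsetP.
  by move=> [u /existsP[v /and3P[uv /(h2 _ _ uv)-> /eqP->]]]; exists u.
move=> [u _ ->]; exists u; apply/existsP; exists (h u).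
by rewrite h1 eqxx eq_sym hh.
Qed.

Definition pcross (p : {perm 'I_d}) (u : vertex) : vertex :=
  match u with inl k => inr (p k) | inr k => inl (p^-1%g k) end.

Lemma pcross_fpf p : fpf_inv (pcross p).
Proof. by split=> -[k|k] //=; rewrite ?permK ?permKV. Qed.

Definition perm_act (p : {perm 'I_d}) f (u : vertex) : vertex :=
  lperm p^-1%g (f (lperm p u)).

Lemma perm_act_fpf p f : fpf_inv f -> fpf_inv (perm_act p f).
Proof.
move=> [fK ff]; rewrite /perm_act; split=> u.
  by have := lpermK p^-1%g; rewrite invgK => -> ; rewrite fK lpermK.
have lVK := lpermK p^-1%g; rewrite invgK in lVK.
by rewrite -{2}(lpermK p u) (inj_eq (can_inj lVK)).
Qed.

Lemma concat_pcross p f : fpf_inv f ->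
  concat (edges_of (pcross p)) (edges_of f) = edges_of (perm_act p f).
Proof.
move=> ff; have pf := pcross_fpf p; have [fK fn] := ff.
have lVK := lpermK p^-1%g; rewrite invgK in lVK.
have sym : connect_sym (glued (edges_of (pcross p)) (edges_of f)).
  by apply: sym_connect_sym; apply: glued_sym.
have o_l u : connect (glued (edges_of (pcross p)) (edges_of f)) (outer u) (lower (lperm p u)).
  case: u => k; last exact: connect0.
  by apply: connect1; apply/gluedP => //; left; exists (inl k).
apply: concat_edges_of; first exact: perm_act_fpf.
  move=> u; apply: connect_trans (o_l u) _.
  apply: connect_trans (_ : connect _ _ (lower (f (lperm p u)))) _.
    by apply: connect1; apply/gluedP => //; right; exists (lperm p u).
  by rewrite sym; have := o_l (perm_act p f u); rewrite /perm_act lVK.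
move=> u v uv.
pose E u := [set u; f u].
(* Each node is labelled by the edge of f through which its component runs. *)
pose c (n : node d) := match n with
  | inl (inl k) => E (inl (p k)) | inl (inr k) => E (inl k) | inr k => E (inr k) end.
have cO w : c (outer w) = E (lperm p w) by case: w.
have cE w : E (f w) = E w by rewrite /E fK setUC.
have cL w : c (lower w) = E w by case: w.
move=> /(@connect_invariant _ _ _ c); rewrite !cO => /(_ _)/set2_eq[].
- move=> x y /gluedP[]// [w -> ->]; last by rewrite !cL cE.
  by case: w => k /=; rewrite ?permKV.
- by move=> [/(can_inj (lpermK p)) E1 _]; rewrite E1 eqxx in uv.
by move=> [_ E1]; rewrite /perm_act E1 lpermK.
Qed.

Lemma closed_loop_pcross p f : fpf_inv f ->
  closed_loop (edges_of (pcross p)) (edges_of f) = false.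
Proof.
move=> ff; apply/negbTE/existsPn => k; apply/forallPn; exists (inl (p^-1%g k)).
rewrite negbK; apply: connect1; apply/gluedP => //; first exact: pcross_fpf.
by left; exists (inr k).
Qed.

Lemma turn_fpf (a : 'I_d.-1) : fpf_inv (turn a).
Proof.
have nlh := lo_neq_hi a; split=> -[k|k] /=.
- case: ifP => /=; last by move->.
  by move=> /orP[]/eqP-> /=; rewrite ?(tpermL, tpermR) !inE eqxx ?orbT /= ?(tpermL, tpermR).
- case: ifP => /=; last by move->.
  by move=> /orP[]/eqP-> /=; rewrite ?(tpermL, tpermR) !inE eqxx ?orbT /= ?(tpermL, tpermR).
- case: ifP => // /orP[]/eqP->; rewrite ?(tpermL, tpermR) (inj_eq inl_inj) //.
  by rewrite eq_sym.
case: ifP => // /orP[]/eqP->; rewrite ?(tpermL, tpermR) (inj_eq inr_inj) //.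
by rewrite eq_sym.
Qed.

Section Cup.
Variables (a : 'I_d.-1) (f : vertex -> vertex).
Hypothesis ff : fpf_inv f.
Let G := glued (edges_of (turn a)) (edges_of f).
Let tf := turn_fpf a.

Let Gsym : connect_sym G. Proof. by apply: sym_connect_sym; apply: glued_sym. Qed.
Let GU u : connect G (upper u) (upper (turn a u)).
Proof. by apply: connect1; apply/gluedP => //; left; exists u. Qed.
Let GL u : connect G (lower u) (lower (f u)).
Proof. by apply: connect1; apply/gluedP => //; right; exists u. Qed.

Let turn_out k : k != lo a -> k != hi a -> turn a (inl k) = inr k.
Proof. by rewrite /= !inE => /negPf-> /negPf->. Qed.
Let turn_lo : turn a (inl (lo a)) = inl (hi a).
Proof. by rewrite /= !inE eqxx tpermL. Qed.
Let turn_lo' : turn a (inr (lo a)) = inr (hi a).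
Proof. by rewrite /= !inE eqxx tpermL. Qed.

Lemma closed_loop_turn : f (inl (lo a)) = inl (hi a) ->
  closed_loop (edges_of (turn a)) (edges_of f).
Proof.
have [fK fn] := ff => flo; have fhi : f (inl (hi a)) = inl (lo a) by rewrite -flo fK.
apply/existsP; exists (lo a); apply/forallP => u; apply/negP.
(* The middle nodes [lo a] and [hi a] form a component by themselves, and c is its indicator. *)
pose c (n : node d) := if n is inl (inr k) then k \in pred2 (lo a) (hi a) else false.
move=> /(@connect_invariant _ _ _ c); rewrite /c /= !inE eqxx.
have -> : (if outer u is inl (inr k) then k \in pred2 (lo a) (hi a) else false) = false.
  by case: u.
move=> /(_ _)/esym => h; suff: false by []; apply: h.
move=> x y /gluedP[]// [[k|k] -> ->] /=.
- by case: ifP => //= ->.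
- by case: ifP => //= /orP[]/eqP->; rewrite ?(tpermL, tpermR) !inE eqxx ?orbT.
- have [->|kl] := eqVneq k (lo a); first by rewrite flo /= !inE !eqxx orbT.
  have [->|kh] := eqVneq k (hi a); first by rewrite fhi /= !inE !eqxx orbT.
  rewrite !inE (negPf kl) (negPf kh).
  case fk: (f (inl k)) => [m|m] //=; rewrite !inE.
  have [ml|ml] := eqVneq m (lo a).
    by move: fk => /(congr1 f); rewrite fK ml flo => -[E]; rewrite E eqxx in kh.
  have [mh|//] := eqVneq m (hi a).
  by move: fk => /(congr1 f); rewrite fK mh fhi => -[E]; rewrite E eqxx in kl.
case fk: (f (inr k)) => [m|m] //=; rewrite !inE.
have [ml|ml] := eqVneq m (lo a); first by move: fk => /(congr1 f); rewrite fK ml flo.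
have [mh|//] := eqVneq m (hi a); by move: fk => /(congr1 f); rewrite fK mh fhi.
Qed.

Hypothesis flo : f (inl (lo a)) != inl (hi a).
Let h := surg f (inl (lo a)) (inl (hi a)).
Let p := f (inl (lo a)).
Let q := f (inl (hi a)).

Let hf : fpf_inv h. Proof. exact: surg_fpf. Qed.
Let lh : inl (lo a) != inl (hi a) :> vertex.
Proof. by rewrite (inj_eq inl_inj) lo_neq_hi. Qed.
Let plo : p != inl (lo a). Proof. by have [_ fn] := ff; apply: fn. Qed.
Let qhi : q != inl (hi a). Proof. by have [_ fn] := ff; apply: fn. Qed.
Let qlo : q != inl (lo a).
Proof. by have [fK _] := ff; rewrite /q (can2_eq fK fK) eq_sym. Qed.
Let pq : p != q. Proof. by have [fK _] := ff; rewrite (inj_eq (inv_inj fK)). Qed.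

Let h_lo : h (inl (lo a)) = inl (hi a).
Proof. by rewrite /h /surg (tpermD _ plo) 1?eq_sym // tpermR. Qed.
Let h_p : h p = q.
Proof. by rewrite /h /surg tpermR tpermD // eq_sym. Qed.
Let h_out u : u != inl (lo a) -> u != inl (hi a) -> u != p -> u != q -> h u = f u.
Proof.
have [fK _] := ff => ul uh up uq.
rewrite /h /surg (_ : tperm _ _ u = u); last by rewrite tpermD // eq_sym.
rewrite tpermD //; first by rewrite eq_sym (can2_eq fK fK).
by rewrite (inj_eq (inv_inj fK)) eq_sym.
Qed.

Let o_l u : u != inl (lo a) -> u != inl (hi a) -> connect G (outer u) (lower u).
Proof.
by case: u => [k|k] // kl kh; have := GU (inl k); rewrite turn_out.
Qed.

Let p_q : connect G (lower p) (lower q).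
Proof.
have [fK _] := ff.
apply: connect_trans (_ : connect _ _ (lower (inl (lo a)))) _.
  by rewrite Gsym; apply: GL.
apply: connect_trans (GL (inl (hi a))).
by have := GU (inr (lo a)); rewrite turn_lo'.
Qed.

Let op_oq : connect G (outer p) (outer q).
Proof.
apply: connect_trans (o_l plo flo) _; apply: connect_trans p_q _.
by rewrite Gsym; apply: o_l.
Qed.

Lemma concat_turn : concat (edges_of (turn a)) (edges_of f) = edges_of h.
Proof.
have [fK fn] := ff; have [hK hn] := hf.
apply: concat_edges_of => // [u|u v uv].
  have [->|ul] := eqVneq u (inl (lo a)).
    by rewrite h_lo; have := GU (inl (lo a)); rewrite turn_lo.
  have [->|uh] := eqVneq u (inl (hi a)).
    by rewrite -h_lo hK Gsym h_lo; have := GU (inl (lo a)); rewrite turn_lo.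
  have [->|up] := eqVneq u p; first by rewrite h_p.
  have [->|uq] := eqVneq u q; first by rewrite -h_p hK h_p Gsym.
  rewrite h_out //; apply: connect_trans (o_l ul uh) _.
  apply: connect_trans (GL u) _; rewrite Gsym; apply: o_l.
    by rewrite (can2_eq fK fK).
  by rewrite (can2_eq fK fK).
pose E u := [set u; h u].
(* Nodes are labelled by edges of the result; the two middle nodes at the cap lie on the edge from
   [p] to [q]. *)
pose c (n : node d) := match n with
  | inl (inl k) => E (inl k)
  | inl (inr k) => if k \in pred2 (lo a) (hi a) then E p else E (inl k)
  | inr k => E (inr k) end.
have cO w : c (outer w) = E w by case: w.
have Eh w : E (h w) = E w by rewrite /E hK setUC.
have cL w : w != inl (lo a) -> w != inl (hi a) -> c (lower w) = E w.
  by case: w => //= k; rewrite !(inj_eq inl_inj) !inE => /negPf-> /negPf->.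
have cLo : c (lower (inl (lo a))) = E p by rewrite /c /= !inE eqxx.
have cHi : c (lower (inl (hi a))) = E p by rewrite /c /= !inE eqxx orbT.
move=> /(@connect_invariant _ _ _ c); rewrite !cO => /(_ _)/set2_eq[].
- move=> x y /gluedP[]// [w -> ->].
    case: w => k /=; case: ifP => [/orP[]/eqP->|kn] /=; rewrite ?(tpermL, tpermR) ?kn //.
      by rewrite -h_lo Eh.
    by rewrite -h_lo Eh.
  have [->|wl] := eqVneq w (inl (lo a)); first by rewrite cLo cL.
  have [->|wh] := eqVneq w (inl (hi a)); first by rewrite cHi cL // -/q -h_p Eh.
  have [->|wp] := eqVneq w p; first by rewrite fK cLo cL.
  have [->|wq] := eqVneq w q; first by rewrite fK cHi cL // -h_p Eh.
  by rewrite !cL ?(can2_eq fK fK) // -h_out // Eh.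
- by move=> [E1 _]; rewrite E1 eqxx in uv.
by move=> [_ ->].
Qed.

Lemma closed_loop_turnN : closed_loop (edges_of (turn a)) (edges_of f) = false.
Proof.
apply/negbTE/existsPn => k; apply/forallPn.
have lop : connect G (lower (inl (lo a))) (outer p).
  by apply: connect_trans (GL _) _; rewrite Gsym; apply: o_l.
have [->|kl] := eqVneq k (lo a); first by exists p; rewrite negbK.
have [->|kh] := eqVneq k (hi a).
  exists p; rewrite negbK; apply: connect_trans lop.
  by rewrite Gsym; have := GU (inr (lo a)); rewrite turn_lo'.
exists (inl k); rewrite negbK Gsym.
by apply: (@o_l (inl k)); rewrite (inj_eq inl_inj).
Qed.
End Cup.
End Partners.

(** * Associativity of concatenation *)

Section TripleStack.
Variable d : nat.
Local Notation vertex := (vertex d).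
Local Notation node := (node d).
Implicit Types (E F : {set {set vertex}}).

(* The four rows of vertices of a stack of three diagrams. layerIJ embeds the
   vertices of the diagram between rows I and J, layerIJK the nodes of a stack
   of two diagrams with rows I, J and K. *)
Definition node4 : finType := ('I_d + 'I_d + ('I_d + 'I_d))%type.
Definition layer01 (u : vertex) : node4 := inl u.
Definition layer12 (u : vertex) : node4 :=
  match u with inl k => inl (inr k) | inr k => inr (inl k) end.
Definition layer23 (u : vertex) : node4 := inr u.
Definition layer012 (n : node) : node4 :=
  match n with inl u => inl u | inr k => inr (inl k) end.
Definition layer123 (n : node) : node4 :=
  match n with inl (inl k) => inl (inr k) | inl (inr k) => inr (inl k)
  | inr k => inr (inr k) end.
Definition layer023 (n : node) : node4 :=
  match n with inl (inl k) => inl (inl k) | inl (inr k) => inr (inl k)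
  | inr k => inr (inr k) end.
Definition layer013 (n : node) : node4 :=
  match n with inl u => inl u | inr k => inr (inr k) end.

Section Stack.
Variables E1 E2 E3 : {set {set vertex}}.

Definition glued3 : rel node4 := fun x y =>
  [exists u : vertex, exists v : vertex,
     [|| [&& [set u; v] \in E1, x == layer01 u & y == layer01 v],
         [&& [set u; v] \in E2, x == layer12 u & y == layer12 v]
       | [&& [set u; v] \in E3, x == layer23 u & y == layer23 v]]].

Lemma glued_connect_sym E F : connect_sym (glued E F).
Proof. by apply: sym_connect_sym; apply: glued_sym. Qed.

Lemma glued3_1 u v : [set u; v] \in E1 -> connect glued3 (layer01 u) (layer01 v).
Proof.
by move=> uv; apply/connect1/existsP; exists u; apply/existsP; exists v; rewrite uv !eqxx.
Qed.
Lemma glued3_2 u v : [set u; v] \in E2 -> connect glued3 (layer12 u) (layer12 v).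
Proof.
move=> uv; apply/connect1/existsP; exists u; apply/existsP; exists v.
by rewrite uv !eqxx orbT.
Qed.
Lemma glued3_3 u v : [set u; v] \in E3 -> connect glued3 (layer23 u) (layer23 v).
Proof.
move=> uv; apply/connect1/existsP; exists u; apply/existsP; exists v.
by rewrite uv !eqxx !orbT.
Qed.

Lemma glued_upper E F u v : [set u; v] \in E -> connect (glued E F) (upper u) (upper v).
Proof.
by move=> uv; apply/connect1/existsP; exists u; apply/existsP; exists v; rewrite uv !eqxx.
Qed.
Lemma glued_lower E F u v : [set u; v] \in F -> connect (glued E F) (lower u) (lower v).
Proof.
move=> uv; apply/connect1/existsP; exists u; apply/existsP; exists v.
by rewrite uv !eqxx orbT.
Qed.

Lemma glued_ind E F (P : node -> node -> Prop) :
  (forall u v, [set u; v] \in E -> P (upper u) (upper v)) ->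
  (forall u v, [set u; v] \in F -> P (lower u) (lower v)) ->
  forall x y, glued E F x y -> P x y.
Proof.
move=> hE hF x y /existsP[u /existsP[v /orP[]/and3P[uv /eqP-> /eqP->]]].
  exact: hE.
exact: hF.
Qed.

Lemma concatP E F u v : [set u; v] \in concat E F ->
  connect (glued E F) (outer u) (outer v).
Proof.
rewrite inE => /existsP[u' /existsP[v' /and3P[_ h /eqP/set2_eq[[-> ->]//|[-> ->]]]]].
by rewrite glued_connect_sym.
Qed.

Lemma layer123_inj : injective layer123.
Proof. by case=> [[?|?]|?] [[?|?]|?] //= [->]. Qed.

Lemma glued12 x y : connect (glued E1 E2) x y -> connect glued3 (layer012 x) (layer012 y).
Proof.
apply: connect_hom; apply: glued_ind => u v uv; first exact: glued3_1.
by move: (glued3_2 uv); case: u v {uv} => [?|?] [?|?].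
Qed.

Lemma glued23 x y : connect (glued E2 E3) x y -> connect glued3 (layer123 x) (layer123 y).
Proof.
apply: connect_hom; apply: glued_ind => u v uv; [move: (glued3_2 uv)|move: (glued3_3 uv)];
  by case: u v {uv} => [?|?] [?|?].
Qed.

Lemma loop_outer E F : ~~ closed_loop E F ->
  forall k, exists u, connect (glued E F) (middle k) (outer u).
Proof.
by move=> /existsPn h k; have /forallPn[u] := h k; rewrite negbK; exists u.
Qed.

(** Without a closed loop every node between the upper two diagrams is connected to an outer vertex
    of them, so contracting these diagrams loses no connection. *)
Lemma connect_stackl : ~~ closed_loop E1 E2 -> forall a b,
  connect (glued (concat E1 E2) E3) a b = connect glued3 (layer023 a) (layer023 b).
Proof.
move=> /loop_outer noloop a b; apply/idP/idP.
  apply: (connect_hom (h := layer023)); apply: glued_ind => u v.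
    by move=> /concatP /glued12; case: u v => [?|?] [?|?].
  by move=> /glued3_3; case: u v => [?|?] [?|?].
(* An outer vertex in the component of n; on the middle row its existence is the absence of
   loops. *)
pose rep (n : node) : vertex :=
  match n with inl (inl k) => inl k | inl (inr k) => xchoose (noloop k)
  | inr k => inr k end.
have repP n : connect (glued E1 E2) n (outer (rep n)).
  by case: n => [[k|k]|k] //=; apply: (xchooseP (noloop k)).
pose r (n : node4) : node :=
  match n with inl u => upper (rep (inl u)) | inr (inl k) => inl (inr k)
  | inr (inr k) => inr k end.
have rK n : r (layer023 n) = n by case: n => [[k|k]|k].
rewrite -{2}(rK a) -{2}(rK b).
have edge x y : glued E1 E2 x y ->
    connect (glued (concat E1 E2) E3) (upper (rep x)) (upper (rep y)).
  move=> xy; have [->//|nxy] := eqVneq (rep x) (rep y).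
  apply: glued_upper; rewrite inE; apply/existsP; exists (rep x).
  apply/existsP; exists (rep y); rewrite nxy eqxx andbT /=.
  apply: connect_trans (repP y); rewrite glued_connect_sym.
  apply: connect_trans (repP x); rewrite glued_connect_sym.
  exact: connect1.
have g1 u v : [set u; v] \in E1 -> glued E1 E2 (upper u) (upper v).
  by move=> uv; apply/existsP; exists u; apply/existsP; exists v; rewrite uv !eqxx.
have g2 u v : [set u; v] \in E2 -> glued E1 E2 (lower u) (lower v).
  by move=> uv; apply/existsP; exists u; apply/existsP; exists v; rewrite uv !eqxx orbT.
apply: connect_hom => x y /existsP[u /existsP[v /or3P[]/and3P[uv /eqP-> /eqP->]]].
- exact: edge (g1 _ _ uv).
- by have := edge _ _ (g2 _ _ uv); case: u v {uv} => [?|?] [?|?].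
by have := glued_lower (concat E1 E2) uv; case: u v {uv} => [?|?] [?|?].
Qed.

Lemma connect_stackr : ~~ closed_loop E2 E3 -> forall a b,
  connect (glued E1 (concat E2 E3)) a b = connect glued3 (layer013 a) (layer013 b).
Proof.
move=> /loop_outer noloop a b; apply/idP/idP.
  apply: (connect_hom (h := layer013)); apply: glued_ind => u v.
    by move=> /glued3_1; case: u v => [?|?] [?|?].
  by move=> /concatP /glued23; case: u v => [?|?] [?|?].
pose rep (n : node) : vertex :=
  match n with inl (inl k) => inl k | inl (inr k) => xchoose (noloop k)
  | inr k => inr k end.
have repP n : connect (glued E2 E3) n (outer (rep n)).
  by case: n => [[k|k]|k] //=; apply: (xchooseP (noloop k)).
pose r (n : node4) : node :=
  match n with inl u => inl u | inr (inl k) => lower (rep (inl (inr k)))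
  | inr (inr k) => inr k end.
have rK n : r (layer013 n) = n by case: n => [[k|k]|k].
rewrite -{2}(rK a) -{2}(rK b).
have edge x y : glued E2 E3 x y ->
    connect (glued E1 (concat E2 E3)) (lower (rep x)) (lower (rep y)).
  move=> xy; have [->//|nxy] := eqVneq (rep x) (rep y).
  apply: glued_lower; rewrite inE; apply/existsP; exists (rep x).
  apply/existsP; exists (rep y); rewrite nxy eqxx andbT /=.
  apply: connect_trans (repP y); rewrite glued_connect_sym.
  apply: connect_trans (repP x); rewrite glued_connect_sym.
  exact: connect1.
have g1 u v : [set u; v] \in E2 -> glued E2 E3 (upper u) (upper v).
  by move=> uv; apply/existsP; exists u; apply/existsP; exists v; rewrite uv !eqxx.
have g2 u v : [set u; v] \in E3 -> glued E2 E3 (lower u) (lower v).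
  by move=> uv; apply/existsP; exists u; apply/existsP; exists v; rewrite uv !eqxx orbT.
apply: connect_hom => x y /existsP[u /existsP[v /or3P[]/and3P[uv /eqP-> /eqP->]]].
- by have := glued_upper (concat E2 E3) uv; case: u v {uv} => [?|?] [?|?].
- by have := edge _ _ (g1 _ _ uv); case: u v {uv} => [?|?] [?|?].
by have := edge _ _ (g2 _ _ uv); case: u v {uv} => [?|?] [?|?].
Qed.

Let outerE u : layer023 (outer u) = layer013 (outer u).
Proof. by case: u. Qed.

Lemma concatA : ~~ closed_loop E1 E2 -> ~~ closed_loop E2 E3 ->
  concat (concat E1 E2) E3 = concat E1 (concat E2 E3).
Proof.
move=> n12 n23; apply/setP => B; rewrite !inE.
apply: eq_existsb => u; apply: eq_existsb => v.
by rewrite connect_stackl // connect_stackr // !outerE.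
Qed.

(** A component without outer ends either lies within the lower two diagrams or remains visible on
    whichever inner row is kept. *)
Lemma closed_loopA : ~~ closed_loop E1 E2 ->
  closed_loop (concat E1 E2) E3 = closed_loop E2 E3 || closed_loop E1 (concat E2 E3).
Proof.
move=> n12; have [/existsP[k /forallP loop]|n23] /= := boolP (closed_loop E2 E3).
  apply/existsP; exists k; apply/forallP => u; rewrite connect_stackl //.
  (* The indicator of the loop of the lower two diagrams, extended by false to the top row. *)
  pose c n := [exists x, (layer123 x == n) && connect (glued E2 E3) (middle k) x].
  have cE x : c (layer123 x) = connect (glued E2 E3) (middle k) x.
    apply/existsP/idP => [[z /andP[/eqP/layer123_inj-> //]]|h].
    by exists x; rewrite eqxx.
  have c0 m : c (inl (inl m)) = false.
    by apply/existsP => -[z /andP[/eqP]]; case: z => [[?|?]|?].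
  have c1 m : c (inl (inr m)) = false.
    by rewrite (cE (inl (inl m))); apply/negbTE; apply: (loop (inl m)).
  apply/negP => /(connect_invariant (c := c)) H.
  have : c (layer023 (middle k)) = c (layer023 (outer u)).
    apply: H => x y /existsP[v /existsP[z /or3P[]/and3P[vz /eqP-> /eqP->]]].
    - by case: v z {vz} => [?|?] [?|?]; rewrite /layer01 !(c0, c1).
    - have -> : layer12 v = layer123 (upper v) by case: (v).
      have -> : layer12 z = layer123 (upper z) by case: (z).
      by rewrite !cE; apply/same_connect_r; [exact: glued_connect_sym | exact: glued_upper].
    have -> : layer23 v = layer123 (lower v) by case: (v).
    have -> : layer23 z = layer123 (lower z) by case: (z).
    by rewrite !cE; apply/same_connect_r; [exact: glued_connect_sym | exact: glued_lower].
  rewrite (cE (middle k)) connect0; case: u {H} => m /=; first by rewrite c0.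
  by rewrite (cE (inr m)) (negPf (loop (inr m))).
(* When neither pair of adjacent diagrams has a loop, a node of one inner row is connected to the
   outside or to the other inner row. *)
have mid0 k : (exists u, connect glued3 (inl (inr k)) (layer023 (outer u))) \/
   (exists m, connect glued3 (inl (inr k)) (inr (inl m))).
  have [[m|m] h] := loop_outer n12 k; move: (glued12 h) => /= h'.
    by left; exists (inl m).
  by right; exists m.
have mid1 k : (exists u, connect glued3 (inr (inl k)) (layer023 (outer u))) \/
   (exists m, connect glued3 (inr (inl k)) (inl (inr m))).
  have [[m|m] h] := loop_outer n23 k; move: (glued23 h) => /= h'.
    by right; exists m.
  by left; exists (inr m).
apply/idP/idP => /existsP[k /forallP loop].
  have {}loop u : ~~ connect glued3 (inr (inl k)) (layer023 (outer u)).
    by have := loop u; rewrite connect_stackl.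
  have [[u h]|[m km]] := mid1 k; first by have := loop u; rewrite h.
  apply/existsP; exists m; apply/forallP => u; rewrite connect_stackr //= -outerE.
  by apply: contra (loop u); apply: connect_trans.
have {}loop u : ~~ connect glued3 (inl (inr k)) (layer023 (outer u)).
  by have := loop u; rewrite connect_stackr // outerE.
have [[u h]|[m km]] := mid0 k; first by have := loop u; rewrite h.
apply/existsP; exists m; apply/forallP => u; rewrite connect_stackl //=.
by apply: contra (loop u); apply: connect_trans.
Qed.
End Stack.
End TripleStack.

(** * Words acting on partner functions *)

Section WordAction.
Variable d : nat.
Local Notation vertex := (vertex d).
Implicit Types (f : vertex -> vertex) (g : letter d) (l : seq (letter d)).

(* The partner function of the diagram of g stacked on top of the diagram of f. *)
Definition lact g f : vertex -> vertex :=
  match g with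
  | LS a => perm_act (adj a) f
  | LE a => surg f (inl (lo a)) (inl (hi a))
  end.
Definition loopy g f : bool :=
  if g is LE a then f (inl (lo a)) == inl (hi a) else false.
Definition wact l f := foldr lact f l.
Fixpoint wloop l f :=
  if l is g :: l' then wloop l' f || loopy g (wact l' f) else false.

Lemma lact_fpf g f : fpf_inv f -> fpf_inv (lact g f).
Proof. by case: g => a /= ff; [apply: perm_act_fpf | apply: surg_fpf]. Qed.

Lemma wact_fpf l f : fpf_inv f -> fpf_inv (wact l f).
Proof. by move=> ff; elim: l => //= g l; apply: lact_fpf. Qed.

Lemma cross_edges (a : 'I_d.-1) : edges_of (cross a) = edges_of (pcross (adj a)).
Proof. by apply: eq_edges_of => -[k|k] //=; rewrite tpermV. Qed.

Lemma id_edges : edges_of (@flip d) = edges_of (pcross 1%g).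
Proof. by apply: eq_edges_of => -[k|k] //=; rewrite ?invg1 perm1. Qed.

Lemma letter_loop g f : fpf_inv f ->
  closed_loop (val (letter_diag g)) (edges_of f) = loopy g f.
Proof.
move=> ff; case: g => a /=; first by rewrite cross_edges closed_loop_pcross.
case: eqP => [/(closed_loop_turn ff)->//|/eqP].
by move/(closed_loop_turnN ff).
Qed.

Lemma letter_concat g f : fpf_inv f -> ~~ loopy g f ->
  concat (val (letter_diag g)) (edges_of f) = edges_of (lact g f).
Proof.
move=> ff; case: g => a /= nl; first by rewrite cross_edges concat_pcross.
exact: concat_turn.
Qed.

Lemma flip_fpf : fpf_inv (@flip d).
Proof. by split=> -[]. Qed.

Lemma loop_freeP l : loop_free l = ~~ wloop l (@flip d) /\
  (loop_free l -> word_edges l = edges_of (wact l (@flip d))).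
Proof.
have ff := flip_fpf; elim: l => [|g l [lE IH]] //=.
rewrite lE negb_or andbC.
have [nl /=|] := boolP (wloop l (@flip d)); first by [].
rewrite -lE => lf /=; rewrite IH // letter_loop //; last exact: wact_fpf.
by split=> // h; rewrite letter_concat //; apply: wact_fpf.
Qed.

Lemma word_stack l f : fpf_inv f -> loop_free l ->
  closed_loop (word_edges l) (edges_of f) = wloop l f /\
  (~~ wloop l f -> concat (word_edges l) (edges_of f) = edges_of (wact l f)).
Proof.
move=> ff; elim: l => [|g l IH] /=.
  move=> _; rewrite id_edges closed_loop_pcross //; split=> // _.
  rewrite concat_pcross //; apply: eq_edges_of => u.
  have l1 (v : vertex) : lperm 1%g v = v by case: v => //= k; rewrite perm1.
  by rewrite /perm_act invg1 !l1.
move=> /andP[nl /IH[cE concE]].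
rewrite closed_loopA // cE; have [//|nw] := boolP (wloop l f); rewrite orFb.
have wf := wact_fpf l ff.
rewrite concE // letter_loop //; split=> // ngl.
by rewrite concatA ?cE // concE // letter_concat.
Qed.
End WordAction.

(** * Words of undotted generators *)

Section Extensionality.
Variable d : nat.
Implicit Types (f : vertex d -> vertex d) (g : letter d) (l : seq (letter d)).

Lemma lact_ext g f f' : f =1 f' -> lact g f =1 lact g f'.
Proof. by case: g => a ff u /=; rewrite /perm_act /surg !ff. Qed.

Lemma loopy_ext g f f' : f =1 f' -> loopy g f = loopy g f'.
Proof. by case: g => a ff //=; rewrite ff. Qed.

Lemma wact_ext l f f' : f =1 f' -> wact l f =1 wact l f'.
Proof. by move=> ff; elim: l => //= g l; apply: lact_ext. Qed.

Lemma wloop_ext l f f' : f =1 f' -> wloop l f = wloop l f'.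
Proof. by move=> ff; elim: l => //= g l ->; rewrite (loopy_ext _ (wact_ext l ff)). Qed.

Lemma surg_cup (V : finType) (h : V -> V) a b : fpf_inv h -> a != b -> h a != b -> surg h a b a = b.
Proof. by move=> [_ hn] ab hab; rewrite /surg (tpermD _ (hn a)) 1?eq_sym // tpermR. Qed.

Definition is_swap g := if g is LS _ then true else false.

(** The cup made by an [LE] letter survives all letters above it or is replaced by another one, so a
    word for the identity diagram consists of swaps. *)
Lemma wact_cup l : ~~ wloop l (@flip d) -> ~~ all is_swap l ->
  exists k k', wact l (@flip d) (inl k) = inl k'.
Proof.
have ff := flip_fpf d; elim: l => [|[a|a] l IH] //=; rewrite negb_or.
  move=> /andP[nl _] /(IH nl)[k [k' E]]; exists ((adj a)^-1%g k), ((adj a)^-1%g k').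
  by rewrite /perm_act /= permKV E.
move=> /andP[nl /= nb] _; exists (lo a), (hi a); apply: surg_cup => //.
  exact: wact_fpf.
by rewrite (inj_eq inl_inj) lo_neq_hi.
Qed.
End Extensionality.

Section Words.
Variables (d : nat) (B : pzRingType) (R : {perm 'I_d} -> B) (e : 'I_d -> 'I_d -> B).
Hypothesis H : periplectic_rep R e.

Definition lval (g : letter d) : B :=
  match g with LS a => R (adj a) | LE a => e (lo a) (hi a) end.
Definition wval (l : seq (letter d)) : B := \prod_(g <- l) lval g.

Lemma adjV (a : 'I_d.-1) : ((adj a)^-1 = adj a)%g. Proof. exact: tpermV. Qed.

Lemma letter_form g (p : {perm 'I_d}) L : uniq (pts L) ->
    let f := dpart p (mu L) in
  if loopy g f then lval g * (R p * cups e L) = 0 else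
  exists p' L', [/\ uniq (pts L'), pm (lval g * (R p * cups e L)) (R p' * cups e L')
    & dpart p' (mu L') =1 lact g f].
Proof.
move=> u f; case: g => a /=.
  exists (p * adj a)%g, L; split=> //; first by rewrite (prepM H) mulrA; apply: pm_refl.
  by move=> z; rewrite dpart_lperm /perm_act !adjV.
have := cup_form H p u (lo_neq_hi a); rewrite -/f.
by case: ifP.
Qed.

Lemma word_form l (p : {perm 'I_d}) L : uniq (pts L) ->
    let f := dpart p (mu L) in
  if wloop l f then wval l * (R p * cups e L) = 0 else
  exists p' L', [/\ uniq (pts L'), pm (wval l * (R p * cups e L)) (R p' * cups e L')
    & dpart p' (mu L') =1 wact l f].
Proof.
move=> u f; rewrite /wval; elim: l => [|g l IH].
  by exists p, L; split=> //; rewrite big_nil mul1r; apply: pm_refl.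
rewrite big_cons /=; case: ifP IH => /= [_ IH|_ [p' [L' [u' cE dE]]]].
  by rewrite -mulrA IH mulr0.
have := letter_form g p' u'; rewrite /= (loopy_ext _ dE).
case: ifP => _ [].
  by move=> z; rewrite -mulrA (pm_eq0 (pm_mull _ cE)).
move=> p'' [L'' [u'' cE' dE']]; exists p'', L''; split=> //.
  by rewrite -mulrA; apply: pm_trans (pm_mull _ cE) cE'.
by move=> z; rewrite dE'; apply: lact_ext.
Qed.

Lemma loop_free_form l : loop_free l ->
  exists p L, [/\ uniq (pts L), pm (wval l) (R p * cups e L)
    & word_edges l = edges_of (dpart p (mu L))].
Proof.
have [lE wE] := loop_freeP l => /[dup] lf /wE ->.
have flipE : dpart 1%g (mu (Nil ('I_d * 'I_d))) =1 @flip d.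
  by move=> [k|k] /=; rewrite ?invg1 !perm1 eqxx.
have := @word_form l 1%g [::] isT; rewrite /= (wloop_ext _ flipE).
move: lf; rewrite lE => /negPf-> [p [L [u cE dE]]].
exists p, L; split=> //; first by move: cE; rewrite (prep1 H) !mulr1.
by apply: eq_edges_of => z; rewrite dE; apply/esym/wact_ext.
Qed.

Lemma dpart_mu_fpf (p : {perm 'I_d}) L : uniq (pts L) -> fpf_inv (dpart p (mu L)).
Proof. by move=> u; apply: dpart_fpf; apply: muK. Qed.

Lemma form_unique l p L : uniq (pts L) -> loop_free l ->
  word_edges l = edges_of (dpart p (mu L)) -> pm (wval l) (R p * cups e L).
Proof.
move=> u /loop_free_form[p' [L' [u' cE ->]]] dE.
apply: pm_trans cE (dpart_inj H u' u _).
by apply: edges_of_inj; [apply: dpart_mu_fpf | apply: dpart_mu_fpf |].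
Qed.

Lemma wval_mul l1 l2 l : loop_free l1 -> loop_free l2 ->
  if closed_loop (word_edges l1) (word_edges l2) then wval l1 * wval l2 = 0
  else loop_free l -> word_edges l = concat (word_edges l1) (word_edges l2) ->
    pm (wval l1 * wval l2) (wval l).
Proof.
move=> lf1 /loop_free_form[p [L [u cE ->]]].
have ff := dpart_mu_fpf p u.
have [-> concE] := word_stack ff lf1.
have := word_form l1 p u => /=.
case: ifP concE => [_ _ z|nl -> // [p' [L' [u' cE' dE]]] lf lE].
  by rewrite (pm_eq0 (pm_mull _ cE)).
apply: pm_trans (pm_mull _ cE) _; apply: pm_trans cE' _.
apply: pm_sym; apply: form_unique => //.
by rewrite lE; apply: eq_edges_of => z; rewrite dE.
Qed.

(** The sign matters here, since this value becomes the unit. By [wact_cup] the word has only swaps,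
    so its value is [R p] for a permutation p, which the diagram determines. *)
Lemma wval_id l : loop_free l -> word_edges l = edges_of (@flip d) -> wval l = 1.
Proof.
have [lE wE] := loop_freeP l => /[dup] lf /wE -> E.
have ff := flip_fpf d.
have wf := edges_of_inj (wact_fpf l ff) ff E.
have sw : all (@is_swap d) l.
  apply: contraT => /(wact_cup _)[|k [k']]; first by rewrite -lE.
  by rewrite wf.
have [p [pE dE]] : exists p, wval l = R p /\ dpart p 1%g =1 wact l (@flip d).
  elim: l sw {lE wE lf E wf} => [|[a|a] l IH] //= sw.
    exists 1%g; rewrite /wval big_nil (prep1 H); split=> // -[k|k] /=.
      by rewrite invg1 !perm1 eqxx.
    by rewrite !perm1 eqxx.
  have [p [pE dE]] := IH sw; exists (p * adj a)%g.
  rewrite /wval big_cons -/(wval l) pE (prepM H); split=> // z.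
  by rewrite dpart_lperm /perm_act !adjV dE.
rewrite pE; suff -> : p = 1%g by rewrite (prep1 H).
apply/permP => k; have := dE (inr k); rewrite wf /= perm1 eqxx.
by case.
Qed.
End Words.

(** * Spanning by the regular monomials *)

Lemma count_flatten_nseq (d : nat) (c : 'I_d -> nat) k :
  count_mem k (flatten [seq nseq (c i) i | i <- enum 'I_d]) = c k.
Proof.
rewrite count_flatten -map_comp sumnE big_map big_enum /= (bigD1 k) //=.
rewrite count_nseq /= eqxx mul1n big1 ?addn0 // => i ik.
by rewrite count_nseq /= (negPf ik).
Qed.

Lemma prod_flatten_nseq (B : pzRingType) (d : nat) (y : 'I_d -> B) (c : 'I_d -> nat) :
  \prod_(k < d) y k ^+ c k = \prod_(k <- flatten [seq nseq (c i) i | i <- enum 'I_d]) y k.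
Proof.
have -> : \prod_(k < d) y k ^+ c k = \prod_(k <- enum 'I_d) y k ^+ c k.
  by rewrite enumT [index_enum _]unlock.
elim: (enum _) => [|k ks IH] /=; first by rewrite !big_nil.
rewrite big_cat big_cons /= IH; congr (_ * _).
by elim: (c k) => [|m IHm]; rewrite ?big_nil // exprS IHm big_cons.
Qed.

(** * The filtration by the number of dots *)

Section Filtration.
Variables (C : fieldType) (A : algType C) (d : nat).
Variables (s e : 'I_d.-1 -> A) (y : 'I_d -> A).

(* led n is spanned by the words with at most n dots, ltd n by those with fewer. *)
Inductive led : nat -> A -> Prop :=
| led0 n : led n 0
| ledD n x z : led n x -> led n z -> led n (x + z)
| ledZ n c x : led n x -> led n (c *: x)
| led1 n : led n 1
| ledS n a x : led n x -> led n (s a * x)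
| ledE n a x : led n x -> led n (e a * x)
| ledY n j x : led n x -> led n.+1 (y j * x).

Definition ltd n (x : A) : Prop := if n is n'.+1 then led n' x else x = 0.

Lemma led_succ n x : led n x -> led n.+1 x.
Proof. by elim=> *; by [apply: led0|apply: ledD|apply: ledZ|apply: led1|apply: ledS|apply: ledE|apply: ledY]. Qed.

Lemma led_mono n m x : (n <= m)%N -> led n x -> led m x.
Proof. by move=> /subnK<-; elim: (m - n)%N => //= k IH /IH; apply: led_succ. Qed.

Lemma ltd_mono n m x : (n <= m)%N -> ltd n x -> ltd m x.
Proof.
case: n m => [|n] [|m] //=; first by move=> _ ->; apply: led0.
by rewrite ltnS; apply: led_mono.
Qed.

Lemma ledN n x : led n x -> led n (- x).
Proof. by rewrite -scaleN1r; apply: ledZ. Qed.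

Lemma ltd0 n : ltd n 0. Proof. by case: n => //= n; apply: led0. Qed.
Lemma ltdD n x z : ltd n x -> ltd n z -> ltd n (x + z).
Proof. by case: n => [->->|n] /=; [rewrite addr0 | apply: ledD]. Qed.
Lemma ltdN n x : ltd n x -> ltd n (- x).
Proof. by case: n => [->|n] /=; [rewrite oppr0 | apply: ledN]. Qed.

Lemma ledM n m x z : led n x -> led m z -> led (n + m) (x * z).
Proof.
move=> + mz; elim=> [{}n|{}n u v _ IHu _ IHv|{}n c u _ IH|{}n|{}n a u _ IH|{}n a u _ IH|{}n j u _ IH].
- by rewrite mul0r; apply: led0.
- by rewrite mulrDl; apply: ledD.
- by rewrite -scalerAl; apply: ledZ.
- by rewrite mul1r; apply: led_mono mz; apply: leq_addl.
- by rewrite -mulrA; apply: ledS.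
- by rewrite -mulrA; apply: ledE.
by rewrite -mulrA addSn; apply: ledY.
Qed.

Lemma ltdMl n m x z : led n x -> ltd m z -> ltd (n + m) (x * z).
Proof.
case: m => [_ ->|m hx hz]; first by rewrite mulr0; apply: ltd0.
by rewrite addnS; apply: ledM.
Qed.

Lemma ltdMr n m x z : ltd n x -> led m z -> ltd (n + m) (x * z).
Proof.
case: n => [-> _|n hx hz]; first by rewrite mul0r; apply: ltd0.
by rewrite addSn; apply: ledM.
Qed.

(** On elements with at most n dots this is equality in degree n of the associated graded
    algebra. *)
Definition eqd n (x z : A) : Prop := ltd n (x - z).
Arguments eqd : simpl never.

Lemma eqd_refl n x : eqd n x x. Proof. by rewrite /eqd subrr; apply: ltd0. Qed.
Lemma eqd_sym n x z : eqd n x z -> eqd n z x.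
Proof. by move=> /ltdN; rewrite opprB. Qed.
Lemma eqd_trans z n x t : eqd n x z -> eqd n z t -> eqd n x t.
Proof. by move=> h1 h2; have := ltdD h1 h2; rewrite addrA subrK. Qed.
Lemma eqdMl m n N z x x' : led m z -> eqd n x x' -> (m + n <= N)%N -> eqd N (z * x) (z * x').
Proof. by move=> hz h le; rewrite /eqd -mulrBr; apply: ltd_mono le _; apply: ltdMl. Qed.
Lemma eqdMr m n N z x x' : led m z -> eqd n x x' -> (n + m <= N)%N -> eqd N (x * z) (x' * z).
Proof. by move=> hz h le; rewrite /eqd -mulrBl; apply: ltd_mono le _; apply: ltdMr. Qed.
Lemma eqd_pm n x x' (b : bool) : eqd n x x' -> eqd n ((-1) ^+ b * x) ((-1) ^+ b * x').
Proof.
case: b; rewrite ?expr0 ?mul1r // expr1 !mulN1r => h.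
by rewrite /eqd opprK addrC; apply: eqd_sym.
Qed.

Definition dots (l : seq 'I_d) : A := \prod_(k <- l) y k.

Lemma led_y k : led 1 (y k). Proof. by rewrite -[y k]mulr1; apply/ledY/led1. Qed.
Lemma led_s a : led 0 (s a). Proof. by rewrite -[s a]mulr1; apply/ledS/led1. Qed.
Lemma led_e a : led 0 (e a). Proof. by rewrite -[e a]mulr1; apply/ledE/led1. Qed.
Lemma led_dots l : led (size l) (dots l).
Proof.
rewrite /dots; elim: l => [|k l IH] /=; first by rewrite big_nil; apply: led1.
by rewrite big_cons; apply: ledY.
Qed.

Hypothesis hrel : forall l r, relation s e y l r -> l = r.
Hypothesis torsion_free : forall (x : A) k, x *+ k.+1 = 0 -> x = 0.

Local Notation R := (sperm s).
Local Notation ee := (ecup s e).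
Let H : periplectic_rep R ee := ecup_rep hrel.

Lemma led_perm p : led 0 (R p).
Proof.
have [l ld <-] := perm_wordT p.
rewrite /sperm (coxrep_word (pres_ss hrel) (pres_far hrel) (pres_braid hrel)) //.
elim: l ld => [_|i l IH] /=; first exact: led1.
by case/andP=> id /IH h; rewrite insubT /=; apply: ledS.
Qed.

Lemma led_cup i j : led 0 (ee i j).
Proof.
have [->|/perm_of_pair[a [p [<- <-]]]] := eqVneq i j.
  by rewrite /ecup eqxx; apply: led0.
rewrite -[ee _ _]mulr1 -(spermV hrel p) mulrA -(prepE H) (ecupE hrel).
have h0 : led (0 + 0) (R p * e a) by apply: ledM; [apply: led_perm | apply: led_e].
exact: (ledM h0 (led_perm _)).
Qed.

Lemma led_cups L : led 0 (cups ee L).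
Proof.
elim: L => [|[i j] L IH] /=; first exact: led1.
exact: (ledM (led_cup i j) IH).
Qed.

Lemma dots_cat l1 l2 : dots (l1 ++ l2) = dots l1 * dots l2.
Proof. by rewrite /dots big_cat. Qed.
Lemma dots_cons k l : dots (k :: l) = y k * dots l.
Proof. by rewrite /dots big_cons. Qed.
Lemma dots1 k : dots [:: k] = y k.
Proof. by rewrite /dots big_seq1. Qed.

Lemma dots_comm l1 l2 : dots l1 * dots l2 = dots l2 * dots l1.
Proof.
apply: commr_prod => i _; apply/commr_sym; apply: commr_prod => j _.
exact: (pres_yy hrel).
Qed.

Lemma y_dots k l : y k * dots l = dots l * y k.
Proof. by rewrite -(dots1 k) dots_comm. Qed.

Lemma dots_perm l1 l2 : perm_eq l1 l2 -> dots l1 = dots l2.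
Proof.
move=> h; pattern l2; apply: (catCA_perm_ind _ h) => // l3 l4 l5 ->.
by rewrite !dots_cat !mulrA (dots_comm l3).
Qed.

(** The correction terms of (P.7) carry no dot. *)
Lemma eqd_adj_y a k : eqd 1 (s a * y k) (y (adj a k) * s a).
Proof.
rewrite /eqd /adj; have h1 := led1 0; have he := led_e a.
case: tpermP => [->|->|/eqP kl /eqP kh].
- by rewrite (hrel (P7_sy s e y a)); apply: ledD => //; apply: ledN.
- rewrite -opprB; apply: ledN; rewrite (hrel (P7_ys s e y a)).
  by apply: ledD => //; apply: ledN.
by rewrite (hrel (P2_y s e y kl kh)) subrr; apply: led0.
Qed.

Lemma eqd_perm_y p k : eqd 1 (R p * y k) (y (p k) * R p).
Proof.
have [l ld <-] := perm_wordT p; elim: l ld k => [_|i l IH + k] => [k|].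
  rewrite /perm_word {1 2}/val_word {1 2}/foldr perm1 (sperm1 hrel) mul1r mulr1.
  exact: eqd_refl.
case/andP=> id /IH{}IH.
have aE : adjn d i = adj (Ordinal id) by rewrite /adjn insubT.
rewrite [perm_word d _]/(perm_word d l * adjn d i)%g aE (prepM H) (sperm_adj hrel) -mulrA.
apply: eqd_trans (eqdMl (led_s _) (IH k) _) _ => //.
rewrite permM !mulrA; apply: eqdMr (led_perm _) (eqd_adj_y _ _) _.
by [].
Qed.

Lemma eqd_perm_dots p l : eqd (size l) (R p * dots l) (dots (map p l) * R p).
Proof.
elim: l => [|k l IH]; first by rewrite /dots !big_nil mulr1 mul1r; apply: eqd_refl.
rewrite /= !dots_cons mulrA.
apply: eqd_trans (eqdMr (led_dots l) (eqd_perm_y p k) _) _; first by lia.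
by rewrite -!mulrA; apply: eqdMl (led_y _) IH _.
Qed.

Lemma cup_conj (i j : 'I_d) : i != j -> exists (a : 'I_d.-1) (p : {perm 'I_d}), [/\ p (lo a) = i, p (hi a) = j &
  ee i j = R p * e a * R p^-1%g].
Proof.
move=> /perm_of_pair[a [p [<- <-]]]; exists a, p; split=> //.
by rewrite -(ecupE hrel) (prepE H) -mulrA (spermV hrel) mulr1.
Qed.

Lemma led_permcup p a : led 0 (R p * e a).
Proof. exact: (ledM (led_perm p) (led_e a)). Qed.
Lemma led_cupperm p a : led 0 (e a * R p).
Proof. exact: (ledM (led_e a) (led_perm p)). Qed.

Lemma eqd_cup_yy i j : i != j -> eqd 1 (ee i j * y i) (ee i j * y j).
Proof.
move=> /cup_conj[a [p [<- <- ->]]]; rewrite -!mulrA.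
have move1 k : eqd 1 (R p * (e a * (R p^-1%g * y (p k)))) (R p * (e a * y k * R p^-1%g)).
  have := eqd_perm_y p^-1%g (p k); rewrite permK => h.
  rewrite -(mulrA (e a)); apply: (eqdMl (n := 1) (led_perm p)) _ _ => //.
  by apply: eqdMl (led_e a) h _.
apply: eqd_trans (move1 _) _; apply: eqd_trans _ (eqd_sym (move1 _)).
apply: (eqdMl (n := 1) (led_perm p)) _ _ => //.
apply: (eqdMr (n := 1) (led_perm _)) _ _ => //.
by rewrite /eqd -mulrBr (hrel (P8_l s e y a)); apply: led_e.
Qed.

Lemma eqd_yy_cup i j : i != j -> eqd 1 (y i * ee i j) (y j * ee i j).
Proof.
move=> /cup_conj[a [p [<- <- ->]]]; rewrite !mulrA.
have move1 k : eqd 1 (y (p k) * R p * e a * R p^-1%g) (R p * (y k * e a) * R p^-1%g).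
  have h := eqd_sym (eqd_perm_y p k).
  rewrite (mulrA (R p)); apply: (eqdMr (n := 1) (led_perm _)) _ _ => //.
  exact: eqdMr (led_e a) h _.
apply: eqd_trans (move1 _) _; apply: eqd_trans _ (eqd_sym (move1 _)).
apply: (eqdMr (n := 1) (led_perm _)) _ _ => //.
apply: (eqdMl (n := 1) (led_perm p)) _ _ => //.
by rewrite /eqd -mulrBl (hrel (P8_r s e y a)); apply/ledN/led_e.
Qed.

Lemma eqd_cup_y i j k : i != j -> k != i -> k != j -> eqd 1 (ee i j * y k) (y k * ee i j).
Proof.
move=> /cup_conj[a [p [<- <- ->]]] ki kj; have [k' kE] : exists k', k = p k'.
  by exists (p^-1%g k); rewrite permKV.
rewrite {k}kE !(inj_eq perm_inj) in ki kj *.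
have h1 := eqd_perm_y p^-1%g (p k'); rewrite permK in h1.
rewrite -mulrA; apply: eqd_trans (eqdMl (led_permcup p a) h1 _) _ => //.
have -> : R p * e a * (y k' * R p^-1%g) = R p * y k' * (e a * R p^-1%g).
  by rewrite -!mulrA (mulrA (e a)) (hrel (P5_ey s e y ki kj)) !mulrA.
rewrite !mulrA -(mulrA (y _ * _)) -(mulrA (_ * y _)).
exact: eqdMr (led_cupperm _ _) (eqd_perm_y p k') _.
Qed.

Lemma eqd_cup_dots i j l : i != j -> i \notin l -> j \notin l ->
  eqd (size l) (ee i j * dots l) (dots l * ee i j).
Proof.
move=> ij; elim: l => [|k l IH]; first by rewrite /dots !big_nil mulr1 mul1r => *; apply: eqd_refl.
rewrite !inE !negb_or => /andP[ik il] /andP[jk jl]; rewrite !dots_cons mulrA.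
apply: eqd_trans (eqdMr (led_dots l) (eqd_cup_y ij _ _) _) _; try by rewrite // eq_sym.
by rewrite -!mulrA; apply: eqdMl (led_y _) (IH il jl) _.
Qed.

Lemma eqd_cup_nseq i j l : i != j -> all (pred2 i j) l ->
  eqd (size l) (ee i j * dots l) (ee i j * dots (nseq (size l) i)).
Proof.
move=> ij; elim: l => [|k l IH] /=; first by move=> _; apply: eqd_refl.
move=> /andP[kij /IH{}IH].
have E u : ee i j * dots (k :: u) = ee i j * dots u * y k.
  by rewrite -mulrA -(dots1 k) -dots_cat (@dots_perm (u ++ [:: k]) (k :: u)) // cats1 perm_rcons.
rewrite E; apply: eqd_trans (eqdMr (led_y k) IH _) _; first by rewrite addn1.
rewrite -mulrA -(dots1 k) dots_comm dots1 mulrA dots_cons mulrA.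
apply: (eqdMr (n := 1) (led_dots _)) _ _; last by rewrite size_nseq.
case/orP: kij => /eqP->; first exact: eqd_refl.
exact/eqd_sym/eqd_cup_yy.
Qed.

Lemma dots_nseq k r : dots (nseq r k) = y k ^+ r.
Proof. by elim: r => [|r IH] /=; rewrite ?dots_cons ?IH ?exprS // /dots big_nil. Qed.

Lemma eqd_circle i j r : i != j -> eqd r (ee i j * dots (nseq r i) * ee i j) 0.
Proof.
move=> /cup_conj[a [p [<- _ ->]]].
have := eqd_perm_dots p^-1%g (nseq r (p (lo a))).
rewrite map_nseq permK size_nseq => h.
have -> : R p * e a * R p^-1%g * dots (nseq r (p (lo a))) * (R p * e a * R p^-1%g)
   = (R p * e a) * (R p^-1%g * dots (nseq r (p (lo a)))) * (R p * (e a * R p^-1%g)).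
  by rewrite !mulrA.
apply: eqd_trans (eqdMr _ (eqdMl (led_permcup p a) h (leqnn _)) _) _.
- exact: (ledM (led_perm p) (led_cupperm _ _)).
- by rewrite add0n !addn0.
rewrite !mulrA -(mulrA _ (R p^-1%g)) (spermVl hrel) mulr1 dots_nseq.
rewrite -(mulrA (R p)) -(mulrA (R p)) (circle_lo hrel torsion_free).
by rewrite mulr0 mul0r; apply: eqd_refl.
Qed.

Lemma eqd_gen_r M a b r : led 0 M -> eqd 1 (M * y a) (y b * M) ->
  eqd r (M * dots (nseq r a)) (dots (nseq r b) * M).
Proof.
move=> hM h; elim: r => [|r IH]; first by rewrite /dots !big_nil mulr1 mul1r; apply: eqd_refl.
have nS k : dots (nseq r.+1 k) = y k * dots (nseq r k) by rewrite !dots_nseq exprS.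
rewrite !nS mulrA.
apply: eqd_trans (eqdMr (led_dots _) h _) _; first by rewrite size_nseq.
by rewrite -!mulrA; apply: eqdMl (led_y _) IH _.
Qed.

Lemma eqd_gen_l M (rho : 'I_d -> 'I_d) l : led 0 M -> (forall i, eqd 1 (y i * M) (y (rho i) * M)) ->
  eqd (size l) (dots l * M) (dots (map rho l) * M).
Proof.
move=> hM h; elim: l => [|k l IH]; first exact: eqd_refl.
rewrite /= !dots_cons -!mulrA.
apply: eqd_trans (eqdMl (led_y k) IH (leqnn _)) _; rewrite add1n.
rewrite !mulrA !y_dots -!mulrA.
by apply: eqdMl (led_dots _) (h k) _; rewrite size_map addn1.
Qed.

Lemma eqd_cups_free L k : uniq (pts L) -> k \notin pts L ->
  eqd 1 (cups ee L * y k) (y k * cups ee L).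
Proof.
elim: L => [|[i j] L IH] /=; first by rewrite mul1r mulr1 => *; apply: eqd_refl.
rewrite -/(pts ((i, j) :: L)) => /uniq_pts[ij _ _ uL].
rewrite in_pts !negb_or => /and3P[ki kj kL]; rewrite -mulrA.
apply: eqd_trans (eqdMl (led_cup i j) (IH uL kL) _) _ => //.
rewrite !mulrA; exact: eqdMr (led_cups L) (eqd_cup_y ij ki kj) _.
Qed.

Lemma eqd_cups_r L k : uniq (pts L) -> k \in pts L ->
  eqd 1 (cups ee L * y k) (cups ee L * y (mu L k)).
Proof.
move=> u kL; have [L' [u' _ [b ->]]] := cups_extract H u kL.
have [km kL' mL' uL'] := uniq_pts u'.
rewrite -!mulrA; apply: eqd_pm.
apply: eqd_trans (eqdMl (led_cup _ _) (eqd_cups_free uL' kL') (leqnn _)) _.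
apply: eqd_trans (eqd_sym (eqdMl (led_cup _ _) (eqd_cups_free uL' mL') (leqnn _))).
by rewrite !mulrA; apply: eqdMr (led_cups L') (eqd_cup_yy km) _.
Qed.

Lemma eqd_cups_l L k : uniq (pts L) -> k \in pts L ->
  eqd 1 (y k * cups ee L) (y (mu L k) * cups ee L).
Proof.
move=> u kL; have [L' [u' _ [b ->]]] := cups_extract H u kL.
have [km kL' mL' uL'] := uniq_pts u'.
rewrite !(mulrA _ ((-1) ^+ b)) !(commr_sign _ b) -!mulrA; apply: eqd_pm.
by rewrite !mulrA; apply: eqdMr (led_cups L') (eqd_yy_cup km) _.
Qed.

Section Form.
Variables (p : {perm 'I_d}) (L : seq ('I_d * 'I_d)).
Hypothesis uL : uniq (pts L).
Let M := R p * cups ee L.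

Lemma led_body : led 0 M.
Proof. exact: (ledM (led_perm p) (led_cups L)). Qed.

Lemma eqd_body_free k : k \notin pts L -> eqd 1 (M * y k) (y (p k) * M).
Proof.
move=> kL; rewrite /M -mulrA.
apply: eqd_trans (eqdMl (led_perm p) (eqd_cups_free uL kL) (leqnn _)) _.
by rewrite !mulrA; apply: eqdMr (led_cups L) (eqd_perm_y p k) _.
Qed.

Lemma eqd_body_r k : k \in pts L -> eqd 1 (M * y k) (M * y (mu L k)).
Proof.
by move=> kL; rewrite /M -!mulrA; apply: eqdMl (led_perm p) (eqd_cups_r uL kL) _.
Qed.

Lemma eqd_body_l k : k \in pts L -> eqd 1 (y (p k) * M) (y (p (mu L k)) * M).
Proof.
move=> kL; have h z := eqd_sym (eqd_perm_y p z); rewrite /M !mulrA.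
apply: eqd_trans (eqdMr (led_cups L) (h _) (leqnn _)) _.
apply: eqd_trans (eqd_sym (eqdMr (led_cups L) (h _) (leqnn _))).
by rewrite -!mulrA; apply: eqdMl (led_perm p) (eqd_cups_l uL kL) _.
Qed.

Definition form (al be : seq 'I_d) : A := dots al * M * dots be.
End Form.

(** In degree n the element is zero or, up to sign, an undotted body with all n dots at its ends.
    This class is stable under left multiplication by the generators, a dot raising n by one. *)
Definition good n (x : A) : Prop :=
  eqd n x 0 \/ exists al p L be, [/\ uniq (pts L), size al + size be = n &
    exists2 z, eqd n x z & pm z (form p L al be)]%N.

Lemma good_eqd n x x' : eqd n x x' -> good n x' -> good n x.
Proof.
move=> h [h0|[al [p [L [be [u sz [z hz pz]]]]]]]; first by left; apply: eqd_trans h h0.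
by right; exists al, p, L, be; split=> //; exists z => //; apply: eqd_trans h hz.
Qed.

Lemma good_pm n x x' : pm x x' -> good n x' -> good n x.
Proof.
move=> [b ->] [h0|[al [p [L [be [u sz [z hz pz]]]]]]].
  by left; rewrite -[0](mulr0 ((-1) ^+ b)); apply: eqd_pm.
right; exists al, p, L, be; split=> //; exists ((-1) ^+ b * z); first exact: eqd_pm.
by apply: pm_trans pz; exists b.
Qed.

Lemma good_mul al x be n N : (size al + n + size be = N)%N -> good n x ->
  good N (dots al * x * dots be).
Proof.
move=> <-.
have mulE u v : eqd n u v -> eqd (size al + n + size be) (dots al * u * dots be) (dots al * v * dots be).
  by move=> h; apply: eqdMr (led_dots be) (eqdMl (led_dots al) h (leqnn _)) _.
case=> [/mulE h0|[al' [p [L [be' [u sz [z hz pz]]]]]]]; first by left; rewrite mulr0 mul0r in h0.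
right; exists (al ++ al'), p, L, (be' ++ be); split=> //.
  by rewrite !size_cat -sz; lia.
exists (dots al * z * dots be); first exact: mulE.
apply: pm_trans (pm_mulr _ (pm_mull _ pz)) _.
by rewrite /form !dots_cat !mulrA; apply: pm_refl.
Qed.

Lemma good_form p L al be : uniq (pts L) -> good (size al + size be) (form p L al be).
Proof.
move=> u; right; exists al, p, L, be; split=> //.
by exists (form p L al be); [apply: eqd_refl | apply: pm_refl].
Qed.

Lemma good1 : good 0 1.
Proof.
have := @good_form 1%g [::] [::] [::] isT.
by rewrite /form /= (sperm1 hrel) /dots !big_nil !mulr1.
Qed.

Lemma good_y n k x : good n x -> good n.+1 (y k * x).
Proof.
have := @good_mul [:: k] x [::] n n.+1; rewrite dots1 /dots big_nil mulr1; apply.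
by rewrite addn0.
Qed.

Lemma good_perm n q x : good n x -> good n (R q * x).
Proof.
case=> [h0|[al [p [L [be [u sz [z hz pz]]]]]]].
  by left; rewrite -[0](mulr0 (R q)); apply: eqdMl (led_perm q) h0 _.
apply: good_eqd (eqdMl (led_perm q) hz (leqnn _)) _.
apply: good_pm (pm_mull _ pz) _; rewrite add0n /form !mulrA.
have := good_form (p * q)%g (map q al) be u; rewrite size_map sz.
apply: good_eqd; rewrite /form (prepM H) !mulrA -sz.
apply: eqdMr (led_dots be) _ (leqnn _).
apply: (eqdMr (n := size al) (led_cups L)) _ _; last by rewrite addn0.
apply: (eqdMr (n := size al) (led_perm p)) _ _; last by rewrite addn0.
exact: eqd_perm_dots.
Qed.

(** The dots caught between the cup and the body leave along the edge on which they sit. On a free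
    strand they go to the bottom; on a top cup they go to its other foot [m] and pass the new cup
    there; if that cup closes up with the new one, the circle kills them. *)
Lemma good_cup_dots i j r p L : i != j -> uniq (pts L) ->
  good r (ee i j * dots (nseq r i) * (R p * cups ee L)).
Proof.
move=> ij u; pose k := (p^-1)%g i; pose l := (p^-1)%g j.
have [iE jE] : i = p k /\ j = p l by rewrite !permKV.
have kl : k != l by rewrite (inj_eq perm_inj).
have body := led_body p L; have ecup0 := led_cup i j.
have noloop : dpart p (mu L) (inl i) != inl j -> forall al be, (size al + size be = r)%N ->
    good r (dots al * (ee i j * (R p * cups ee L)) * dots be).
  move=> nl al be sz.
  have := cup_form H p u ij; cbv zeta; rewrite (negPf nl) => -[p' [L' [u' cE _]]].
  apply: good_pm (pm_mulr _ (pm_mull _ cE)) _.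
  by rewrite -sz; apply: good_form.
have fE : dpart p (mu L) (inl i) = if mu L k == k then inr k else inl (p (mu L k)) by [].
have [kL|kL] := boolP (k \in pts L); last first.
  rewrite mu_out // eqxx in fE.
  have h := eqd_gen_r r body (eqd_body_free p u kL); rewrite -iE in h.
  rewrite -mulrA; apply: good_eqd (eqdMl ecup0 (eqd_sym h) (leqnn _)) _.
  rewrite add0n mulrA -[X in X * _]mul1r.
  have <- : dots [::] = 1 by rewrite /dots big_nil.
  by apply: noloop; rewrite ?fE // size_nseq.
have /andP[mL mk] := mu_in u kL; rewrite (negPf mk) in fE.
have [ml|ml] := eqVneq (mu L k) l.
  left; have [L' [u' _ [b cE]]] := cups_extract H u kL; rewrite cE.
  have h := eqd_perm_dots p (nseq r k); rewrite map_nseq -iE size_nseq in h.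
  rewrite mulrA -(mulrA (ee i j)).
  set U := _ * cups ee L'.
  have led_U : led 0 U.
    by apply: (ledM (led_cup _ _) (led_cups L')).
  have led_bU : led 0 ((-1) ^+ b * U).
    by case: b {cE}; rewrite ?expr0 ?mul1r // expr1 mulN1r; apply: ledN.
  apply: eqd_trans (eqdMr led_bU (eqdMl ecup0 (eqd_sym h) (leqnn _)) _) _.
    by rewrite addn0.
  rewrite (mulrA (ee i j)) iE jE -(prepE H) -2!mulrA -[0](mulr0 (R p)).
  apply: (eqdMl (n := r) (led_perm p)) _ _ => //.
  rewrite (mulrA (dots _)) (commr_sign _ b) -!mulrA.
  rewrite (mulrA _ ((-1) ^+ b)) (commr_sign _ b) -!mulrA -[0](mulr0 ((-1) ^+ b)).
  apply: eqd_pm; rewrite /U ml !mulrA -[0](mul0r (cups ee L')).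
  apply: (eqdMr (n := r) (led_cups L')) _ _; last by rewrite addn0.
  exact: eqd_circle.
have nl : dpart p (mu L) (inl i) != inl j.
  by rewrite fE jE (inj_eq inl_inj) (inj_eq perm_inj).
set m := p (mu L k).
have h : eqd r (dots (nseq r i) * (R p * cups ee L)) (dots (nseq r m) * (R p * cups ee L)).
  have h1 := @eqd_gen_l _ (fun z => if z == i then m else z) (nseq r i) body.
  move: h1; rewrite size_nseq map_nseq eqxx; apply => z.
  case: eqVneq => [->|_]; last exact: eqd_refl.
  by rewrite /m {1}iE; apply: eqd_body_l.
rewrite -mulrA; apply: good_eqd (eqdMl ecup0 h (leqnn _)) _; rewrite add0n.
have mi : m != i by rewrite /m [X in _ != X]iE (inj_eq perm_inj).
have mj : m != j by rewrite /m jE (inj_eq perm_inj).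
have h2 : eqd r (ee i j * dots (nseq r m)) (dots (nseq r m) * ee i j).
  rewrite -{1}(size_nseq r m); apply: eqd_cup_dots => //.
    by apply: contra mi => /nseqP[->].
  by apply: contra mj => /nseqP[->].
rewrite mulrA; apply: good_eqd (eqdMr body h2 _) _; first by rewrite addn0.
rewrite -[X in good _ X]mulr1 -(mulrA (dots _)) -(_ : dots [::] = 1); last by rewrite /dots big_nil.
by apply: noloop; rewrite // size_nseq addn0.
Qed.

(** Dots away from i and j pass the cup; those at its feet are gathered at i, which is the situation
    of [good_cup_dots]. *)
Lemma good_cup n i j x : i != j -> good n x -> good n (ee i j * x).
Proof.
move=> ij; case=> [h0|[al [p [L [be [u sz [z hz pz]]]]]]].
  by left; rewrite -[0](mulr0 (ee i j)); apply: eqdMl (led_cup i j) h0 _.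
apply: good_eqd (eqdMl (led_cup i j) hz (leqnn _)) _.
apply: good_pm (pm_mull _ pz) _; rewrite add0n /form.
pose a1 := filter (pred2 i j) al; pose a0 := filter (predC (pred2 i j)) al.
have szE : (size al = size a1 + size a0)%N by rewrite !size_filter count_predC.
have -> : dots al = dots a0 * dots a1.
  rewrite dots_comm -dots_cat; apply: dots_perm.
  by rewrite perm_sym perm_filterC.
have a0i : i \notin a0 by rewrite mem_filter /= eqxx.
have a0j : j \notin a0 by rewrite mem_filter /= eqxx orbT.
have h1 := eqd_cup_dots ij a0i a0j.
have h2 := eqd_cup_nseq ij (filter_all (pred2 i j) al); rewrite -/a1 in h2.
have body := led_body p L.
rewrite !mulrA -(mulrA _ (R p)).
apply: good_eqd (eqdMr (led_dots be) (eqdMr body (eqdMr (led_dots a1) h1 (leqnn _)) (leqnn _)) _) _.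
  by rewrite -sz szE addn0 (addnC (size a0)).
rewrite -(mulrA _ (ee i j)).
apply: good_eqd (eqdMr (led_dots be) (eqdMr body (eqdMl (led_dots a0) h2 (leqnn _)) (leqnn _)) _) _.
  by rewrite -sz szE addn0 (addnC (size a0)).
rewrite -(mulrA (dots a0)); apply: good_mul (good_cup_dots _ p ij u).
by rewrite -sz szE (addnC (size a0)).
Qed.

Inductive span (P : A -> Prop) : A -> Prop :=
| span0 : span P 0
| spanD c u x : P u -> span P x -> span P (c *: u + x).

Lemma span_add P x z : span P x -> span P z -> span P (x + z).
Proof. by elim=> [|c u {}x Pu _ IH] hz; rewrite ?add0r // -addrA; apply: spanD => //; apply: IH. Qed.
Lemma span_scale P c x : span P x -> span P (c *: x).
Proof.
elim=> [|c' u {}x Pu _ IH]; first by rewrite scaler0; apply: span0.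
by rewrite scalerDr scalerA; apply: spanD.
Qed.
Lemma span_map (P Q : A -> Prop) (f : A -> A) x : linear f -> (forall u, P u -> Q (f u)) ->
  span P x -> span Q (f x).
Proof.
move=> lf PQ; elim=> [|c u {}x Pu _ IH].
  by have := lf (-1) 0 0; rewrite scaler0 addr0 scaleN1r addNr => ->; apply: span0.
by rewrite lf; apply: spanD => //; apply: PQ.
Qed.
Lemma span_trans (P Q : A -> Prop) x : (forall u, P u -> span Q u) -> span P x -> span Q x.
Proof.
move=> PQ; elim=> [|c u {}x Pu _ IH]; first exact: span0.
by apply: span_add => //; apply/span_scale/PQ.
Qed.

Definition goodle n x := exists2 m, (m <= n)%N & good m x.

Lemma led_goodle n x : led n x -> span (goodle n) x.
Proof.
have lin z : linear (fun x : A => z * x) by move=> c u v; rewrite mulrDr scalerAr.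
elim=> [{}n|{}n u v _ IHu _ IHv|{}n c u _ IH|{}n|{}n a u _ IH|{}n a u _ IH|{}n j u _ IH].
- exact: span0.
- exact: span_add.
- exact: span_scale.
- rewrite -[1]addr0 -[1]scale1r; apply: spanD (span0 _).
  by exists 0%N; last exact: good1.
- apply: span_map IH => //= z [m mn gz]; exists m => //.
  by rewrite -(sperm_adj hrel); apply: good_perm.
- apply: span_map IH => //= z [m mn gz]; exists m => //.
  by rewrite -(ecupE hrel); apply: good_cup => //; apply: lo_neq_hi.
by apply: span_map IH => //= z [m mn gz]; exists m.+1 => //; apply: good_y.
Qed.

(** Bottom dots on free strands move to the top, those on a cap to its right end, as regularity
    demands. *)
Lemma eqd_body_dots p (L : seq ('I_d * 'I_d)) be : uniq (pts L) ->
  exists ga de : seq 'I_d, [/\ (size ga + size de = size be)%N,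
   all (fun k : 'I_d => (mu L k < k)%N) de &
   eqd (size be) (R p * cups ee L * dots be) (form p L ga de)].
Proof.
move=> u; have body := led_body p L; elim: be => [|k be [ga [de [sz hde h]]]].
  exists [::], [::]; split=> //.
  by rewrite /form /dots !big_nil mul1r; apply: eqd_refl.
have [kL|kL] := boolP (k \in pts L); last first.
  exists (p k :: ga), de; split=> //; first by rewrite /= addSn sz.
  rewrite dots_cons mulrA.
  apply: eqd_trans (eqdMr (led_dots be) (eqd_body_free p u kL) (leqnn _)) _.
  rewrite /form -!mulrA in h; rewrite /form dots_cons -!mulrA.
  exact: eqdMl (led_y _) h _.
pose m := if (mu L k < k)%N then k else mu L k.
have /andP[mL mk] := mu_in u kL.
exists ga, (m :: de); split=> //=; first by rewrite addnS sz.
  rewrite hde andbT /m; case: ifP => // nlt; rewrite (muK u).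
  by rewrite ltn_neqAle eq_sym mk leqNgt nlt.
rewrite dots_cons mulrA.
have hm : eqd 1 (R p * cups ee L * y k) (R p * cups ee L * y m).
  by rewrite /m; case: ifP => _; [apply: eqd_refl | apply: eqd_body_r].
apply: eqd_trans (eqdMr (led_dots be) hm (leqnn _)) _.
rewrite -[X in eqd _ X _]mulrA -(dots1 m) dots_comm dots1 mulrA.
apply: eqd_trans (eqdMr (led_y m) h _) _; first by rewrite addn1.
by rewrite /form dots_cons -mulrA -(dots1 m) dots_comm !dots1; apply: eqd_refl.
Qed.

Lemma dots_prod l : dots l = \prod_(k < d) y k ^+ count_mem k l.
Proof.
rewrite prod_flatten_nseq; apply: dots_perm; apply/allP => k _.
by rewrite /= count_flatten_nseq.
Qed.

Variable w : brauer d -> seq (letter d).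
Hypothesis hw : word_choice w.

Definition monomial (D : dot_diagram d) : A :=
  (\prod_(k < d) y k ^+ top_dots D k) * wval R ee (w (Defs.shape D))
  * (\prod_(k < d) y k ^+ bot_dots D k).

Definition is_monomial (x : A) : Prop := exists2 D, regular D & x = monomial D.

Lemma form_regular p L al be : uniq (pts L) ->
  exists2 D, regular D & exists2 z, eqd (size al + size be) (form p L al be) z & pm z (monomial D).
Proof.
move=> u; have body := led_body p L; have ff := dpart_mu_fpf p u.
have [ga [de [sz hde hbe]]] := eqd_body_dots p be u.
(* A dot at the right end of a top cup goes to the left end; all other dots stay. *)
pose rho i := if (p (mu L (p^-1%g i)) < i)%N then p (mu L (p^-1%g i)) else i.
have hrho i : eqd 1 (y i * (R p * cups ee L)) (y (rho i) * (R p * cups ee L)).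
  rewrite /rho; case: ifP => lt; last exact: eqd_refl.
  rewrite -{1}(permKV p i); apply: eqd_body_l => //.
  by rewrite mu_pts //; apply: contraTneq lt => ->; rewrite permKV ltnn.
have [hg1 hg2 _ _] := hw.
have gB : is_brauer (edges_of (dpart p (mu L))) by case: ff; apply: edges_of_brauer.
pose g : brauer d := exist (@is_brauer d) _ gB.
pose al' := map rho (al ++ ga).
pose D : dot_diagram d := (g, [ffun k => count_mem k al'], [ffun k => count_mem k de]).
exists D.
  apply/andP; split; apply/forallP => k; apply/implyP; rewrite /= !ffunE.
    rewrite -lt0n -has_count has_pred1 => /(allP hde) mk.
    apply/existsP; exists (mu L k); rewrite mk mem_edges_of // -(inj_eq (inv_inj ff.1)).
    have /negPf mkk : mu L k != k by apply: contraTneq mk => ->; rewrite ltnn.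
    by rewrite ff.1 /= mkk.
  move=> /existsP[l /andP[lk]]; rewrite mem_edges_of // => /eqP kE.
  rewrite -leqn0 leqNgt -has_count has_pred1; apply/negP => /mapP[i _ kr].
  have {kE} : dpart p (mu L) (inl k) = inl l by rewrite kE ff.1.
  have {kr} : ~~ (p (mu L (p^-1%g k)) < k)%N.
    rewrite kr /rho; case: ifP => [lt|->//]; rewrite permK (muK u) permKV -leqNgt.
    exact: ltnW.
  rewrite -leqNgt => kl /=; case: eqP => // _ [E].
  by move: kl; rewrite E leqNgt lk.
exists (dots al' * (R p * cups ee L) * dots de); last first.
  rewrite /monomial /=; under eq_bigr do rewrite ffunE.
  rewrite -dots_prod; under eq_bigr do rewrite ffunE.
  rewrite -dots_prod; apply: pm_mulr; apply: pm_mull; apply: pm_sym.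
  by apply: form_unique => //; rewrite hg1.
rewrite {1}/form -(mulrA (dots al)).
apply: eqd_trans (eqdMl (led_dots al) hbe (leqnn _)) _.
rewrite /form !mulrA -dots_cat -!(mulrA _ (R p)) -sz addnA -size_cat.
by apply: eqdMr (led_dots de) (eqd_gen_l _ body hrho) (leqnn _).
Qed.

(** Replacing an element of degree m by a regular monomial makes an error with fewer than m dots,
    which the induction absorbs. *)
Lemma led_span n x : led n x -> span is_monomial x.
Proof.
elim/ltn_ind: n x => n IH x /led_goodle; apply: span_trans => {}x [m mn gx].
have low z : ltd m z -> span is_monomial z.
  case: m mn {gx} => [_ ->|m mn] /=; first exact: span0.
  exact: IH.
case: gx => [|[al [p [L [be [u sz [z hz pz]]]]]]]; first by rewrite /eqd subr0 => /low.
have [D rD [z' hz' pz']] := form_regular p al be u.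
have [b zE] := pz; have [b' zE'] := pz'; rewrite -(subrK z x).
apply: span_add; first exact: low.
rewrite zE -(subrK z' (form _ _ _ _)) mulrDr; apply: span_add.
  apply: low; rewrite sz in hz'.
  by case: (b); rewrite ?expr0 ?mul1r // expr1 mulN1r; apply: ltdN.
have -> : (-1) ^+ b * z' = ((-1) ^+ (b (+) b')) *: monomial D + 0.
  by rewrite addr0 zE' mulrA -signr_addb mulr_sign scaler_sign.
by apply: spanD (span0 _); exists D.
Qed.
End Filtration.

(** * The representation on oriented matchings *)

Section Matchings.
Variables (C : fieldType) (X : finType).
Local Notation P := (X + X)%type.
Local Notation perms := {perm (X + X)%type}.

Definition swap_sides (u : P) : P := match u with inl x => inr x | inr x => inl x end.
Lemma swap_sidesK : involutive swap_sides. Proof. by case. Qed.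
(** The matching by vertical edges, that is, the identity diagram; every other matching is described
    relative to it. *)
Definition fl : perms := perm (inv_inj swap_sidesK).
Lemma flE u : fl u = swap_sides u. Proof. exact: permE. Qed.
Lemma flK : involutive fl. Proof. by move=> u; rewrite !flE swap_sidesK. Qed.
Lemma fl_neq u : fl u != u. Proof. by rewrite flE; case: u. Qed.

Definition base (u : P) : X := match u with inl x => x | inr x => x end.
Lemma base_fl u : base (fl u) = base u. Proof. by rewrite flE; case: u. Qed.
Lemma base_eq u v : (base u == base v) = (u == v) || (u == fl v).
Proof.
rewrite flE; case: u v => [x|x] [z|z] //=; rewrite ?orbF //;
  by rewrite ?(inj_eq inl_inj) ?(inj_eq inr_inj).
Qed.

(** Membership in the centralizer of [fl], the hyperoctahedral group of the edges. *)
Definition flcomm (h : perms) : bool := [forall u, h (fl u) == fl (h u)].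
Lemma flcommP (h : perms) : reflect (forall u, h (fl u) = fl (h u)) (flcomm h).
Proof. exact: 'forall_eqP. Qed.

Lemma flcommM (h k : perms) : flcomm h -> flcomm k -> flcomm (h * k)%g.
Proof. by move=> /flcommP hh /flcommP kh; apply/flcommP => u; rewrite !permM hh kh. Qed.

(** The permutation induced on the edges; for h in the centralizer of [fl] the default is not
    reached. *)
Definition edge_perm (h : perms) : {perm X} :=
  odflt 1%g [pick q : {perm X} | [forall x, q x == base (h (inl x))]].

Lemma edge_permE (h : perms) u : flcomm h -> edge_perm h (base u) = base (h u).
Proof.
move=> /flcommP hh.
have hb v : base (h v) = base (h (inl (base v))).
  case: v => [x|x] //=; have -> : inr x = fl (inl x) by rewrite flE.
  by rewrite hh base_fl.
have inj : injective (fun x => base (h (inl x))).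
  move=> x z /eqP; rewrite base_eq -hh !(inj_eq perm_inj) flE /= orbF.
  by move=> /eqP[].
rewrite /edge_perm; case: pickP => [q /forallP hq|/(_ (perm inj))/negP[]] /=.
  by rewrite (eqP (hq _)) -hb.
by apply/forallP => x; rewrite permE.
Qed.

(* The sign with which an automorphism of the matching fl permutes the edges. *)
Definition chi (h : perms) : bool := odd_perm (edge_perm h).

Lemma chiM (h k : perms) : flcomm h -> flcomm k -> chi (h * k)%g = chi h (+) chi k.
Proof.
move=> hh kh; rewrite /chi -odd_permM; congr odd_perm; apply/permP => x.
have -> : x = base (inl x) by [].
by rewrite permM !edge_permE ?flcommM // permM.
Qed.

Lemma flcomm_edge a : flcomm (tperm a (fl a)).
Proof.
apply/flcommP => u; have [->|ua] := eqVneq u a; first by rewrite tpermL tpermR flK.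
have [->|ufa] := eqVneq u (fl a); first by rewrite tpermR flK tpermL.
rewrite !tpermD //; first by rewrite eq_sym.
- by rewrite eq_sym.
- by rewrite -(inj_eq (inv_inj flK)) flK eq_sym.
by rewrite (inj_eq perm_inj) eq_sym.
Qed.

Lemma chi_edge a : chi (tperm a (fl a)) = false.
Proof.
rewrite /chi; suff -> : edge_perm (tperm a (fl a)) = 1%g by rewrite odd_perm1.
apply/permP => x; rewrite perm1 -[x]/(base (inl x)) edge_permE ?flcomm_edge //.
by case: tpermP => [->|->|//]; rewrite base_fl.
Qed.

Definition pair_swap (a c : P) : perms := (tperm a c * tperm (fl a) (fl c))%g.

Lemma pair_swapE a c u : a != c -> a != fl c -> pair_swap a c u =
  if u == a then c else if u == c then a else if u == fl a then fl c
  else if u == fl c then fl a else u.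
Proof.
move=> ac afc; have fac : fl a != c by rewrite -(inj_eq (@perm_inj _ fl)) flK.
rewrite permM; have [->|ua] := eqVneq u a.
  by rewrite tpermL tpermD // fl_neq.
have [->|uc] := eqVneq u c; first by rewrite tpermR tpermD ?fl_neq // eq_sym.
rewrite (tpermD (_ : a != u)) 1?eq_sym //.
have [->|ufa] := eqVneq u (fl a); first by rewrite tpermL.
have [->|ufc] := eqVneq u (fl c); first by rewrite tpermR.
by rewrite tpermD // eq_sym.
Qed.

Lemma flcomm_pair a c : a != c -> a != fl c -> flcomm (pair_swap a c).
Proof.
move=> ac afc; apply/flcommP => u.
have fi := inj_eq (@perm_inj _ fl); have fK u' v' : (fl u' == v') = (u' == fl v').
  by rewrite -fi flK.
rewrite !pair_swapE // !fK !flK.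
have [->|ua] := eqVneq u a.
  by rewrite (negPf afc) [a == fl a]eq_sym (negPf (fl_neq a)).
have [->|uc] := eqVneq u c.
  by rewrite [c == fl a]eq_sym fK (negPf afc) [c == fl c]eq_sym (negPf (fl_neq c)).
have [//|ufa] := eqVneq u (fl a).
  by rewrite flK.
by case: eqVneq => // _; rewrite flK.
Qed.

Lemma chi_pair a c : a != c -> a != fl c -> chi (pair_swap a c).
Proof.
move=> ac afc; rewrite /chi; have bac : base a != base c by rewrite base_eq negb_or ac.
suff -> : edge_perm (pair_swap a c) = tperm (base a) (base c) by rewrite odd_tperm.
apply/permP => x; rewrite -[x]/(base (inl x)) edge_permE ?flcomm_pair // pair_swapE //.
set u : P := inl x.
have [->|ua] := eqVneq u a; first by rewrite tpermL.
have [->|uc] := eqVneq u c; first by rewrite tpermR.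
have [->|ufa] := eqVneq u (fl a); first by rewrite !base_fl tpermL.
have [->|ufc] := eqVneq u (fl c); first by rewrite !base_fl tpermR.
by rewrite tpermD // eq_sym base_eq negb_or ?ua ?uc.
Qed.

(* A permutation g stands for the oriented matching whose i-th edge is the
   image by g of the i-th edge of fl. *)
Definition matching (g : perms) : perms := (fl ^ g)%g.

Lemma matchingE g u : matching g (g u) = g (fl u).
Proof. by rewrite /matching permJ. Qed.
Lemma matchingM g s u : matching (g * s)%g u = s (matching g (s^-1%g u)).
Proof. by rewrite /matching conjgM -{1}(permKV s u) permJ. Qed.
Lemma matchingK g : involutive (matching g).
Proof. by move=> u; rewrite -(permKV g u) !matchingE flK. Qed.
Lemma matching_neq g u : matching g u != u.
Proof. by rewrite -(permKV g u) matchingE (inj_eq perm_inj) fl_neq. Qed.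
Lemma matching_comm h g : flcomm h -> matching (h * g)%g = matching g.
Proof.
move=> /flcommP hh; apply/permP => u; rewrite -(permKV (h * g)%g u) matchingE.
by rewrite !(permM h g) hh matchingE.
Qed.
Lemma matching_eq g k : matching g = matching k -> flcomm (g * k^-1)%g.
Proof.
move=> E; apply/flcommP => u; apply: (@perm_inj _ k).
by rewrite !(permM g) permKV -matchingE E -{1}(permKV k (g u)) matchingE.
Qed.

Definition is_matching (m : perms) : bool := [exists g, m == matching g].
Local Notation matchings := {m : perms | is_matching m}.
Lemma matchingP g : is_matching (matching g). Proof. by apply/existsP; exists g. Qed.
Definition tomatch (g : perms) : matchings := exist is_matching _ (matchingP g).
Lemma tomatch_eq g k : (tomatch g == tomatch k) = (matching g == matching k).
Proof. by []. Qed.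

Definition orient (m : matchings) : perms := xchoose (existsP (valP m)).
Lemma orientK m : tomatch (orient m) = m.
Proof. by apply/eqP; rewrite -val_eqE /= eq_sym; exact: (xchooseP (existsP (valP m))). Qed.
Lemma matching_orient m : matching (orient m) = val m.
Proof. by rewrite -{2}(orientK m). Qed.

(** The predecessor of the number of matchings, so that matrices of size [nmatch.+1] form a nonzero
    ring. *)
Definition nmatch := #|{: matchings}|.-1.
Lemma nmatchE : #|{: matchings}| = nmatch.+1.
Proof. by rewrite prednK //; apply/card_gt0P; exists (tomatch 1%g). Qed.

Definition rank_match (m : matchings) : 'I_nmatch.+1 := cast_ord nmatchE (enum_rank m).
Lemma rank_match_inj : injective rank_match.
Proof. by move=> m m' /cast_ord_inj/enum_rank_inj. Qed.
Lemma rank_match_surj i : exists m, i = rank_match m.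
Proof.
exists (enum_val (cast_ord (esym nmatchE) i)).
by rewrite /rank_match enum_valK cast_ordKV.
Qed.

Local Notation B := 'M[C]_nmatch.+1.
Local Notation V := 'cV[C]_nmatch.+1.

Definition sgnm (g : perms) : bool := chi (g * (orient (tomatch g))^-1)%g.
(** The vector of g in the representation induced from the character [chi] of the centralizer of
    [fl]; [sgnm] compares g with the chosen representative of its matching. *)
Definition vecc (g : perms) : V :=
  (-1) ^+ sgnm g *: delta_mx (rank_match (tomatch g)) 0.

Lemma tomatch_comm h g : flcomm h -> tomatch (h * g)%g = tomatch g.
Proof. by move=> hh; apply: val_inj; rewrite /= matching_comm. Qed.

Lemma vecc_comm h g : flcomm h -> vecc (h * g)%g = (-1) ^+ chi h *: vecc g.
Proof.
move=> hh; rewrite /vecc scalerA -signr_addb tomatch_comm // /sgnm tomatch_comm //.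
rewrite -mulgA (chiM hh) //; apply: matching_eq.
by rewrite matching_orient.
Qed.

Lemma vecc_orient m : vecc (orient m) = delta_mx (rank_match m) 0.
Proof.
rewrite /vecc /sgnm orientK mulgV.
suff -> : chi 1%g = false by rewrite expr0 scale1r.
have c1 : flcomm 1%g by apply/flcommP => u; rewrite !perm1.
by have := chiM c1 c1; rewrite mulg1; case: chi.
Qed.

Lemma vecc_ext (M N : B) : (forall g, M *m vecc g = N *m vecc g) -> M = N.
Proof.
move=> E; apply/matrixP => i j; have [m ->] := rank_match_surj j.
have := E (orient m); rewrite vecc_orient => /matrixP/(_ i 0).
rewrite !mxE.
rewrite (bigD1 (rank_match m)) //= big1 ?addr0 => [|k km]; last first.
  by rewrite mxE (negPf km) mulr0.
rewrite (bigD1 (rank_match m)) //= big1 ?addr0 => [|k km]; last first.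
  by rewrite mxE (negPf km) mulr0.
by rewrite !mxE !eqxx !mulr1.
Qed.

Definition equivar (F : perms -> V) :=
  forall h g, flcomm h -> F (h * g)%g = (-1) ^+ chi h *: F g.
(** Only the chosen representatives enter; equivariance of F makes the matrix correct on the vectors
    of all g. *)
Definition opmx (F : perms -> V) : B :=
  \sum_(m : matchings) F (orient m) *m delta_mx 0 (rank_match m).

Lemma opmxE F g : equivar F -> opmx F *m vecc g = F g.
Proof.
move=> eF; rewrite /opmx mulmx_suml (bigD1 (tomatch g)) //= big1 ?addr0; last first.
  move=> m mg; rewrite /vecc -scalemxAr -mulmxA mul_delta_mx_cond.
  by rewrite (inj_eq rank_match_inj) (negPf mg) mulmx0 scaler0.
rewrite /vecc -scalemxAr -mulmxA mul_delta_mx.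
have -> : delta_mx 0 0 = 1%:M :> 'M[C]_1.
  by apply/matrixP => i j; rewrite !mxE !ord1.
rewrite mulmx1 -{3}(mulgKV (orient (tomatch g)) g) eF //.
by apply: matching_eq; rewrite matching_orient.
Qed.

Definition match_perm (s : perms) : B := opmx (fun g => vecc (g * s)%g).
(** Exchanging j with the partner of i joins i to j and joins their former partners to each other.
    The minus sign is dictated by [prep_near], the only relation of [periplectic_rep] that is not
    homogeneous in the cups. *)
Definition match_cup (i j : P) : B :=
  opmx (fun g => if matching g i == j then 0 else - vecc (g * tperm j (matching g i))%g).

Lemma match_permE s g : match_perm s *m vecc g = vecc (g * s)%g.
Proof. by rewrite opmxE // => h k hh /=; rewrite -mulgA (vecc_comm _ hh). Qed.

Lemma match_cupE i j g : match_cup i j *m vecc g =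
  if matching g i == j then 0 else - vecc (g * tperm j (matching g i))%g.
Proof.
rewrite opmxE // => h k hh /=; rewrite matching_comm //; case: ifP => _; first by rewrite scaler0.
by rewrite -mulgA (vecc_comm _ hh) scalerN.
Qed.

(** Matchings are symmetric in the orientation of each edge and, by [vecc_pair], alternating in the
    order of their edges. *)
Lemma vecc_edge g a : vecc (g * tperm a (matching g a))%g = vecc g.
Proof.
rewrite -{1 2}(permKV g a) matchingE; set b := (g^-1)%g a.
by rewrite -tpermJ -conjgC vecc_comm ?flcomm_edge // chi_edge expr0 scale1r.
Qed.

Lemma vecc_pair g a c : a != c -> matching g a != c ->
  vecc (g * (tperm a c * tperm (matching g a) (matching g c)))%g = - vecc g.
Proof.
rewrite -(permKV g a) -(permKV g c) !matchingE; set a' := (g^-1)%g a; set c' := (g^-1)%g c.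
rewrite !(inj_eq perm_inj) => ac fac.
have afc : a' != fl c' by rewrite -(inj_eq (@perm_inj _ fl)) flK.
have ac' : a' != c' by rewrite (inj_eq perm_inj).
clearbody a' c'; rewrite -(tpermJ a' c' g) -(tpermJ (fl a') (fl c') g) -conjMg -conjgC.
rewrite -/(pair_swap a' c') vecc_comm ?flcomm_pair // chi_pair //.
by rewrite expr1 scaleN1r.
Qed.

Lemma matching_tperm g a b u :
  matching (g * tperm a b)%g u = tperm a b (matching g (tperm a b u)).
Proof. by rewrite matchingM tpermV. Qed.

(** Both transpositions lead to the same matching, with two of its edges exchanged. *)
Lemma vecc_pairN g a c : a != c -> matching g a != c ->
  vecc (g * tperm a c)%g = - vecc (g * tperm (matching g a) (matching g c))%g.
Proof.
move=> ac mac; set m := matching g.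
have mcK : matching g (matching g c) = c by rewrite matchingK.
have mca : m c != a by rewrite /m -(inj_eq (@perm_inj _ (matching g))) mcK eq_sym.
have [h1 h2] : m a != a /\ m c != c by rewrite !matching_neq.
have E1 : matching (g * tperm a c)%g a = m c.
  by rewrite matching_tperm tpermL tpermD // eq_sym.
have E2 : matching (g * tperm a c)%g c = m a.
  by rewrite matching_tperm tpermR tpermD // eq_sym.
have := @vecc_pair (g * tperm a c)%g a c ac; rewrite E1 E2 h2 => /(_ isT).
rewrite !mulgA -(mulgA g) tperm2 mulg1 (tpermC (m c)) => ->.
by rewrite opprK.
Qed.

Local Notation Rm := match_perm.
Local Notation em := match_cup.

Lemma match_cupC i j : i != j -> em j i = - em i j.
Proof.
move=> ij; apply: vecc_ext => g; rewrite mulNmx !match_cupE.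
have mK := matchingK g; have mi := inj_eq (@perm_inj _ (matching g)).
have -> : (matching g j == i) = (matching g i == j) by rewrite -mi mK eq_sym.
case: eqVneq => [_|mij]; first by rewrite oppr0.
rewrite opprK; apply/eqP; rewrite eqr_oppLR; apply/eqP.
rewrite (@vecc_pairN g i) ?mK //; first by rewrite tpermC.
  by rewrite -mi mK.
by rewrite mi.
Qed.

Lemma mulmxMA (M N : B) (v : V) : (M * N) *m v = M *m (N *m v).
Proof. by rewrite -mulmxA. Qed.

Lemma match_near g i j k : uniq [:: i; j; k] -> matching g j = k ->
  em i j *m vecc g = Rm (tperm j k) *m (Rm (tperm i j) *m vecc g).
Proof.
rewrite /= !inE !negb_or andbT => /andP[/andP[ij ik] jk] mj.
have mk : matching g k = j by rewrite -mj matchingK.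
have mi := inj_eq (@perm_inj _ (matching g)).
have e1 : vecc (g * tperm j k)%g = vecc g by rewrite -mj vecc_edge.
have e2 : vecc (g * tperm i j * tperm j k)%g = vecc (g * tperm i k)%g.
  rewrite -mulgA (_ : (tperm i j * tperm j k = tperm j k * tperm i k)%g).
    by rewrite mulgA -(match_permE (tperm i k) (g * tperm j k)%g) e1 match_permE.
  by apply: tperm_rot; rewrite /= !inE negb_or ij ik jk.
rewrite match_cupE !match_permE e2.
rewrite -[X in _ == X]mk mi (negPf ik).
rewrite (@vecc_pairN g j (matching g i)) ?matchingK ?opprK ?mj.
- by rewrite tpermC.
- by rewrite -mk mi eq_sym.
by rewrite -mj mi eq_sym.
Qed.

Lemma match_cup_first g i j : i != j -> matching g i != j ->
  matching (g * tperm j (matching g i))%g i = j.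
Proof.
move=> ij mij; rewrite matching_tperm (@tpermD _ _ _ i) ?tpermR ?matching_neq //.
by rewrite eq_sym.
Qed.

(** The interacting case: an edge of the matching joins a foot of one cup to a foot of the other.
    [match_far] reduces the other coincidences to it by reversing cups. *)
Lemma match_far_spec g i j k l : uniq [:: i; j; k; l] -> matching g i = k ->
  em i j *m (em k l *m vecc g) = em k l *m (em i j *m vecc g).
Proof.
move=> u mik; have mK := matchingK g; have mi := inj_eq (@perm_inj _ (matching g)).
have mk : matching g k = i by rewrite -mik mK.
move: u; rewrite /= !inE !negb_or andbT.
move=> /andP[/and3P[ij ik il] /andP[/andP[jk jl] kl]].
have ji : j != i by rewrite eq_sym.
rewrite !match_cupE mik mk [k == j]eq_sym (negPf jk) (negPf il) !mulmxN !match_cupE.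
rewrite !matching_tperm.
rewrite (tpermR l i) (tpermR j k).
have [mjl|mjl] := eqVneq (matching g j) l.
  have -> : matching g l = j by rewrite -mjl mK.
  by rewrite mjl !tpermD ?eqxx // eq_sym.
set q := matching g j; set r := matching g l.
have rl : r != l by rewrite matching_neq.
have ri : r != i by rewrite /r -mk mi eq_sym.
have rj : r != j by rewrite /r -mi mK eq_sym.
have rk : r != k by rewrite /r -mik mi eq_sym.
have qj : q != j by rewrite matching_neq.
have qk : q != k by rewrite /q -mik mi.
have rq : r != q by rewrite mi eq_sym.
have lq : l != q by rewrite eq_sym.
rewrite (@tpermD _ l i r) 1?eq_sym // (@tpermD _ j k q) 1?eq_sym //.
rewrite (negPf rj) (negPf mjl); congr (- - _).
have E1 : vecc (g * tperm l i)%g = - vecc (g * tperm r k)%g.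
  by rewrite (@vecc_pairN g l i) ?mik // eq_sym.
have E2 : vecc (g * tperm j k * tperm r k)%g = - vecc (g * tperm j k * tperm l q)%g.
  have m2l : matching (g * tperm j k)%g l = r.
    by rewrite matching_tperm (@tpermD _ j k l) // tpermD // eq_sym.
  have m2q : matching (g * tperm j k)%g q = k.
    by rewrite matching_tperm (@tpermD _ j k q) 1?eq_sym // mK tpermL.
  by rewrite (@vecc_pairN _ l q lq) m2l ?m2q ?opprK.
rewrite -match_permE E1 mulmxN match_permE -[RHS]opprK -E2; congr (- vecc _).
rewrite -!mulgA; congr (g * _)%g.
rewrite (tpermC r k); apply/esym/tperm_rot.
by rewrite /= !inE negb_or jk ![_ == r]eq_sym rj rk.
Qed.

Lemma match_far i j k l : uniq [:: i; j; k; l] -> em i j * em k l = em k l * em i j.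
Proof.
move=> u; apply: vecc_ext => g; rewrite !mulmxMA.
have mK := matchingK g; have mi := inj_eq (@perm_inj _ (matching g)).
move: (u); rewrite /= !inE !negb_or andbT.
move=> /andP[/and3P[ij ik il] /andP[/andP[jk jl] kl]].
have lk : l != k by rewrite eq_sym.
have ji : j != i by rewrite eq_sym.
have [mik|mik] := eqVneq (matching g i) k; first exact: match_far_spec.
have [mil|mil] := eqVneq (matching g i) l.
  rewrite (match_cupC lk) !mulNmx !mulmxN; congr (- _); apply: match_far_spec => //.
  by rewrite /= !inE !negb_or ij ik il jk jl lk.
have [mjk|mjk] := eqVneq (matching g j) k.
  rewrite (match_cupC ji) !mulNmx !mulmxN; congr (- _); apply: match_far_spec => //.
  by rewrite /= !inE !negb_or ji ik il jk jl kl.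
have [mjl|mjl] := eqVneq (matching g j) l.
  rewrite (match_cupC ji) (match_cupC lk) !mulNmx !mulmxN.
  congr (- - _); apply: match_far_spec => //.
  by rewrite /= !inE !negb_or ji ik il jk jl lk.
have mki : matching g k != i by rewrite -mi mK eq_sym.
have mkj : matching g k != j by rewrite -mi mK eq_sym.
have mli : matching g l != i by rewrite -mi mK eq_sym.
have mlj : matching g l != j by rewrite -mi mK eq_sym.
rewrite !match_cupE.
have m1i : matching (g * tperm l (matching g k))%g i = matching g i.
  have E : tperm l (matching g k) i = i by rewrite tpermD // eq_sym.
  by rewrite matching_tperm E tpermD ?mi // eq_sym.
have m2k : matching (g * tperm j (matching g i))%g k = matching g k.
  have E : tperm j (matching g i) k = k by rewrite tpermD.
  by rewrite matching_tperm E tpermD ?mi // eq_sym.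
case: (eqVneq (matching g k) l) => mkl; case: (eqVneq (matching g i) j) => mij;
  rewrite ?mulmx0 // ?mulmxN !match_cupE ?m1i ?m2k ?mij ?mkl ?eqxx ?(negPf mij) ?(negPf mkl) ?oppr0 //.
congr (- - vecc _); rewrite -!mulgA; congr (g * _)%g.
rewrite (conjgC (tperm l _)) tpermJ !tpermD //; try by rewrite eq_sym.
  by rewrite mi.
Qed.

Lemma match_rep : periplectic_rep Rm em.
Proof.
have mi g := inj_eq (@perm_inj _ (matching g)).
split.
- by apply: vecc_ext => g; rewrite match_permE mulg1 mul1mx.
- by move=> p q; apply: vecc_ext => g; rewrite mulmxMA !match_permE mulgA.
- move=> p i j; apply: vecc_ext => g; rewrite !mulmxMA match_permE !match_cupE.
  rewrite matchingM permK (inj_eq perm_inj); case: ifP => _; first by rewrite mulmx0.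
  by rewrite mulmxN match_permE -!mulgA -tpermJ -conjgC.
- move=> i j ij; apply: vecc_ext => g; rewrite mulmxMA match_cupE.
  case: eqVneq => mij; first by rewrite mulmx0.
  rewrite mulmxN match_permE -{2}(match_cup_first ij mij) vecc_edge //.
- exact: match_cupC.
- move=> i j ij; apply: vecc_ext => g; rewrite mulmxMA mul0mx match_cupE.
  case: eqVneq => mij; first by rewrite mulmx0.
  by rewrite mulmxN match_cupE match_cup_first // eqxx oppr0.
- exact: match_far.
move=> i j k u; apply: vecc_ext => g; rewrite !mulmxMA [em j k *m _]match_cupE.
case: eqVneq => mjk; first by rewrite !mulmx0.
rewrite !mulmxN; congr (- _); apply: match_near => //.
apply: match_cup_first => //.
by move: u; rewrite /= !inE => /and3P[].
Qed.
End Matchings.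

(** * Dots as Jucys-Murphy elements *)

Section ThreeStrands.
Variables (X : finType) (B : pzRingType) (R : {perm X} -> B) (e : X -> X -> B).
Hypothesis H : periplectic_rep R e.
Local Notation s i j := (R (tperm i j)).

Lemma rep_sC i j : s i j = s j i. Proof. by rewrite tpermC. Qed.

Lemma rep_rot a b c : uniq [:: a; b; c] -> s b c * s a b = s a c * s b c.
Proof. by move=> u; rewrite -!(prepM H) tperm_rot. Qed.

Variables p q t : X.
Hypothesis u : uniq [:: p; q; t].

Let pq : p != q. Proof. by move: u; rewrite /= !inE negb_or andbT => /andP[/andP[]]. Qed.
Let qt : q != t. Proof. by move: u; rewrite /= !inE negb_or andbT => /andP[/andP[]]. Qed.
Let pt : p != t. Proof. by move: u; rewrite /= !inE negb_or andbT => /andP[/andP[]]. Qed.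
Let u_tpq : uniq [:: t; p; q].
Proof. by rewrite /= !inE negb_or ![t == _]eq_sym pt qt pq. Qed.
Let u_tqp : uniq [:: t; q; p].
Proof. by rewrite /= !inE negb_or ![t == _]eq_sym pt qt eq_sym pq. Qed.
Let u_ptq : uniq [:: p; t; q].
Proof. by rewrite /= !inE negb_or pt pq eq_sym qt. Qed.

Let A1 : e q t * e p q = - (s p t * e p q).
Proof.
by rewrite -[LHS]mulrNN -!(prepC H) // (rep_near_l H u_tqp) (prepC H pq) mulrN rep_sC.
Qed.
Let A2 : e q t * e p q = e q t * s p t. Proof. exact: rep_near_r. Qed.
Let A3 : e p q * e q t = s p t * e q t. Proof. exact: rep_near_l. Qed.
Let A4 : e p q * e q t = - (e p q * s p t).
Proof.
by rewrite -[LHS]mulrNN -!(prepC H) // (rep_near_r H u_tqp) (prepC H pq) mulNr rep_sC.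
Qed.
Let r1 : s q t * s p q = s p t * s q t. Proof. exact: rep_rot. Qed.
Let r2 : s p q * s p t = s q t * s p q.
Proof. by rewrite (rep_sC p t) (rep_rot u_tpq) (rep_sC t q). Qed.
Let r3 : s p t * s p q = s p q * s q t.
Proof. by rewrite (rep_sC p t) (rep_sC p q) -(rep_rot u_tqp) (rep_sC t q). Qed.
Let r4 : s q t * s p t = s p q * s q t.
Proof. by rewrite (rep_sC q t) (rep_rot u_ptq). Qed.

Let tq : tperm p t q = q. Proof. by rewrite tpermD // eq_sym. Qed.

(** For three consecutive strands p, q, t this and the following identities are the braid relation
    and the three-strand relations of (P.6). *)
Lemma near_braid : s p q * s q t * s p q = s q t * s p q * s q t.
Proof. by rewrite -[LHS]mulrA {1}r1 mulrA r2. Qed.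
Lemma near_see : s p q * e q t * e p q = - (s q t * e p q).
Proof. by rewrite -mulrA A1 mulrN mulrA r2 -mulrA (prep_se H). Qed.
Lemma near_ees : e p q * e q t * s p q = e p q * s q t.
Proof. by rewrite A4 mulNr -mulrA r3 mulrA (rep_es H) // mulNr opprK. Qed.
Lemma near_ees' : e q t * e p q * s q t = - (e q t * s p q).
Proof. by rewrite A2 -mulrA -r1 mulrA (rep_es H) // mulNr. Qed.
Lemma near_see' : s q t * e p q * e q t = s p q * e q t.
Proof. by rewrite -mulrA A3 mulrA r4 -mulrA (prep_se H). Qed.
Lemma near_eee' : e q t * e p q * e q t = - e q t.
Proof.
rewrite A2 -mulrA (prepE H) tpermR tq (prepC H pq) mulNr mulrN mulrA A2.
by rewrite -mulrA (rep_tt H) mulr1.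
Qed.
Lemma near_eee : e p q * e q t * e p q = - e p q.
Proof.
rewrite A4 mulNr -mulrA (prepE H) tpermL tq (prepC H qt) mulNr mulrN opprK.
by rewrite mulrA A4 mulNr -mulrA (rep_tt H) mulr1.
Qed.
End ThreeStrands.

(** * The defining relations for Jucys-Murphy elements *)

Section JucysMurphyRelations.
Variables (X : finType) (B : nzRingType) (R : {perm X} -> B) (e : X -> X -> B).
Hypothesis H : periplectic_rep R e.
Hypothesis torsion_free : forall (x : B) k, x *+ k.+1 = 0 -> x = 0.
(** The strands of the algebra sit at [st] inside a larger set; [below i] may contain further
    strands, which the crossings and cups of the algebra do not touch. *)
Variables (d : nat) (st : 'I_d -> X) (below : 'I_d -> {set X}).
Hypothesis st_inj : injective st.
Hypothesis st_below : forall i j, (st j \in below i) = (j < i)%N.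
Hypothesis below_hi : forall a : 'I_d.-1, below (hi a) = st (lo a) |: below (lo a).
Hypothesis below_sub : forall i j : 'I_d, (i < j)%N -> st i |: below i \subset below j.

Local Notation s i j := (R (tperm i j)).
Local Notation x a := (st (lo a)).
Local Notation z a := (st (hi a)).
Let y i := jm R e (below i) (st i).

Let st_self i : st i \notin below i. Proof. by rewrite st_below ltnn. Qed.
Let st_neq i j : (st i == st j) = (i == j). Proof. exact: inj_eq. Qed.
Let xz a : x a != z a. Proof. by rewrite st_neq lo_neq_hi. Qed.
Let far_uniq (a b : 'I_d.-1) : far a b -> uniq [:: x a; z a; x b; z b].
Proof.
rewrite /far /= !inE !st_neq -!val_eqE /=; move: (val a) (val b) => m n.
by lia.
Qed.

Let near_uniq (a b : 'I_d.-1) : b = a.+1 :> nat -> z a = x b /\ uniq [:: x a; x b; z b].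
Proof.
move=> ab; split; first by congr st; apply: val_inj.
rewrite /= !inE !st_neq -!val_eqE /=; move: ab; rewrite -![nat_of_ord _]/(val _).
by move: (val a) (val b) => m n ->; lia.
Qed.

Let yy (i j : 'I_d) : (i < j)%N -> y i * y j = y j * y i.
Proof. by move=> ij; apply: (jm_comm H) => //; apply: below_sub. Qed.

Let yyC (i j : 'I_d) : y i * y j = y j * y i.
Proof.
by case: (ltngtP i j) => [/yy//|/yy->//|/val_inj->].
Qed.

Let ey_r a : e (x a) (z a) * (y (lo a) - y (hi a)) = e (x a) (z a).
Proof.
have xS := st_self (lo a).
have zS : z a \notin below (lo a) by rewrite st_below /= -leqNgt leqW.
rewrite /y below_hi {2}/jm big_setU1 //= -/(jm R e _ _) opprD addrCA mulrDr (jm_pair_r H) //.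
by rewrite addr0 mulrN mulrDr (rep_es H) // (prep_ee H) // addr0 opprK.
Qed.

Let ey_l a : (y (lo a) - y (hi a)) * e (x a) (z a) = - e (x a) (z a).
Proof.
have xS := st_self (lo a).
have zS : z a \notin below (lo a) by rewrite st_below /= -leqNgt leqW.
rewrite /y below_hi {2}/jm big_setU1 //= -/(jm R e _ _) opprD addrCA mulrDl (jm_pair_l H) //.
by rewrite addr0 mulNr mulrDl (prep_se H) // (prep_ee H) // addr0.
Qed.

Let y_hi a : y (hi a) = s (x a) (z a) * y (lo a) * s (x a) (z a) + s (x a) (z a) + e (x a) (z a).
Proof. by rewrite /y below_hi (jm_next H) // st_below /= -leqNgt leqW. Qed.

Lemma jm_relation l r :
  relation (fun a => s (x a) (z a)) (fun a => e (x a) (z a)) y l r -> l = r.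
Proof.
case.
- by move=> a; apply: (rep_tt H).
- move=> a b /far_uniq; rewrite /= !inE !negb_or andbT.
  move=> /andP[/and3P[_ h1 h2] /andP[/andP[h3 h4] _]].
  by rewrite -!(prepM H) (conjgC (tperm (x b) _)) tpermJ !tpermD.
- by move=> a b /near_uniq[-> u]; apply: (near_braid H).
- move=> a i il ih; have sti : tperm (x a) (z a) (st i) = st i.
    by rewrite tpermD // st_neq eq_sym.
  rewrite /y (jm_perm H) ?sti // => t; case: tpermP => [->|->|_ _] //; rewrite !st_below /=;
  by move: il ih; rewrite -!val_eqE /=; lia.
- by move=> a; apply: (prep_ee H).
(* (P.4) requires no computation with the sums: it follows from (P.8) and commutation by sliding a
   dot around the circle. *)
- move=> a k _ _; apply: (circle_eq0 torsion_free (z := y (hi a))) => //.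
- move=> a b /far_uniq; rewrite /= !inE !negb_or andbT.
  move=> /andP[/and3P[_ h1 h2] /andP[/andP[h3 h4] _]].
  by rewrite (prepE H) !tpermD.
- by move=> a b /far_uniq; apply: (prep_far H).
(* The two strands of the cup are both below i or both above it. *)
- move=> a i il ih; case: (ltnP (hi a) i) => hi_i.
    by apply: (jm_mem H) => //; rewrite st_below //; apply: ltn_trans hi_i => /=.
  apply: (jm_far H); rewrite ?st_below ?st_neq ?ltnn ?lo_neq_hi //.
  + by move: il ih hi_i; rewrite -!val_eqE /=; lia.
  + by rewrite -leqNgt.
  + by rewrite eq_sym.
  by rewrite eq_sym.
- by move=> i j; apply: yyC.
- by move=> a; apply: (rep_es H).
- by move=> a; rewrite (prep_se H).
- by move=> a b /near_uniq[-> u]; apply: (near_see H).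
- by move=> a b /near_uniq[-> u]; apply: (near_ees H).
- by move=> a b /near_uniq[-> u]; apply: (near_ees' H).
- by move=> a b /near_uniq[-> u]; apply: (near_see' H).
- by move=> a b /near_uniq[-> u]; apply: (near_eee' H).
- by move=> a b /near_uniq[-> u]; apply: (near_eee H).
- move=> a; rewrite y_hi !mulrDl -(mulrA _ (s _ _)) (rep_tt H) mulr1 (rep_es H) //.
  by rewrite -addrA opprD addrA subrr add0r opprD opprK addrC.
- move=> a; rewrite y_hi !mulrDr !mulrA (rep_tt H) mul1r (prep_se H) //.
  by rewrite -addrA opprD addrA subrr add0r opprD addrC.
- exact: ey_r.
- exact: ey_l.
Qed.
End JucysMurphyRelations.

(** * Threads through auxiliary strands *)

Section Coefficients.
Variables (C : fieldType) (X : finType).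
Local Notation perms := {perm (X + X)%type}.
Local Notation V := 'cV[C]_(nmatch X).+1.

(* The coefficient of vecc C g in v. *)
Definition cf (g : perms) (v : V) : C := (-1) ^+ sgnm g * v (rank_match (tomatch g)) 0.

Lemma cfD g u v : cf g (u + v) = cf g u + cf g v.
Proof. by rewrite /cf !mxE mulrDr. Qed.
Lemma cf0 g : cf g 0 = 0. Proof. by rewrite /cf mxE mulr0. Qed.
Lemma cfZ g c v : cf g (c *: v) = c * cf g v.
Proof. by rewrite /cf !mxE mulrCA. Qed.
Lemma cfN g v : cf g (- v) = - cf g v.
Proof. by rewrite -scaleN1r cfZ mulN1r. Qed.
Lemma cf_sum g I (r : seq I) (Q : pred I) F : cf g (\sum_(i <- r | Q i) F i) = \sum_(i <- r | Q i) cf g (F i).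
Proof. by rewrite (big_morph (cf g) (cfD g) (cf0 g)). Qed.

Lemma cf_vecc g : cf g (vecc C g) = 1.
Proof. by rewrite /cf /vecc !mxE !eqxx mulr1 -signr_addb addbb. Qed.

Lemma cf_vecc_neq g k : matching g != matching k -> cf g (vecc C k) = 0.
Proof.
move=> ne; rewrite /cf /vecc !mxE (inj_eq (@rank_match_inj X)) tomatch_eq.
by rewrite (negPf ne) !mulr0.
Qed.

Lemma cf_vecc_sign g k : matching g = matching k -> cf g (vecc C k) = (-1) ^+ chi (k * g^-1)%g.
Proof.
move=> E; rewrite -{1}(mulgKV g k) vecc_comm; last by apply: matching_eq.
by rewrite cfZ cf_vecc mulr1.
Qed.

Lemma cf_perm g s k : cf g (vecc C (k * s)%g) = cf (g * s^-1)%g (vecc C k).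
Proof.
have mE : (matching g == matching (k * s)%g) = (matching (g * s^-1)%g == matching k).
  by rewrite /matching !conjgM -(inj_eq (@conjg_inj _ s^-1%g)) conjgK.
have [E|ne] := eqVneq (matching g) (matching (k * s)%g); last first.
  by rewrite (cf_vecc_neq ne) cf_vecc_neq // -mE.
rewrite !cf_vecc_sign //; last by apply/eqP; rewrite -mE E.
by rewrite invMg invgK mulgA.
Qed.

Lemma vecc_decomp (v : V) : v = \sum_(m : {m : perms | is_matching m}) cf (orient m) v *: vecc C (orient m).
Proof.
apply/matrixP => i j; rewrite ord1 {j}; have [m ->] := rank_match_surj i.
rewrite summxE (bigD1 m) //= big1 ?addr0 => [|m' mm']; last first.
  rewrite vecc_orient !mxE (inj_eq (@rank_match_inj X)) eq_sym (negPf mm').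
  by rewrite mulr0.
rewrite vecc_orient !mxE !eqxx mulr1 /cf orientK.
have -> : sgnm (orient m) = false.
  have := cf_vecc (orient m); rewrite /cf vecc_orient orientK !mxE !eqxx mulr1.
  rewrite /sgnm orientK mulgV.
  have c1 : flcomm (1%g : perms) by apply/flcommP => u; rewrite !perm1.
  by have := chiM c1 c1; rewrite mulg1; case: chi.
by rewrite expr0 mul1r.
Qed.
End Coefficients.

Section Threads.
Variables (C : fieldType) (n d : nat).
Local Notation X := 'I_(n + d).
Local Notation P := (X + X)%type.
Local Notation perms := {perm P}.
Local Notation U := ('I_d + 'I_d)%type.
Local Notation V := 'cV[C]_(nmatch X).+1.

Definition pt (u : U) : P := match u with inl k => inl (rshift n k) | inr k => inr (rshift n k) end.
Definition aux (z : P) : bool := (base z < n)%N.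

Lemma pt_inj : injective pt.
Proof. by case=> k [] k' //= [] /eqP; rewrite eqn_add2l => /eqP/val_inj->. Qed.
Lemma aux_pt u : aux (pt u) = false.
Proof. by case: u => k; rewrite /aux /= ltnNge leq_addr. Qed.
Lemma aux_fl z : aux (fl _ z) = aux z. Proof. by rewrite /aux base_fl. Qed.

Definition strand (x : 'I_n) : P := inl (lshift d x).
Lemma aux_strand x : aux (strand x). Proof. by rewrite /aux /=. Qed.
Lemma auxP z : aux z -> exists x, z = strand x \/ z = fl _ (strand x).
Proof.
move=> az; exists (Ordinal az); rewrite flE.
by case: z az => x az; [left | right]; congr (_ _); apply: val_inj.
Qed.
Lemma base_strand z x : base z = lshift d x -> z = strand x \/ z = fl _ (strand x).
Proof. by rewrite flE; case: z => q /= ->; [left | right]. Qed.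
Lemma aux_neq_pt z u : aux z -> z != pt u.
Proof. by apply: contraTneq => ->; rewrite aux_pt. Qed.

(** A dot touches at most one new auxiliary strand, so this set measures how many dots must have
    acted. *)
Definition touched (g : perms) : {set 'I_n} := [set x | matching g (strand x) != fl _ (strand x)].

Lemma untouched_tperm (g : perms) p u x : x \notin touched g -> base p != lshift d x ->
  x \notin touched (g * tperm p (pt u))%g.
Proof.
rewrite !inE !negbK => /eqP xg px; rewrite matching_tperm.
have h (q : P) : base q = lshift d x -> tperm p (pt u) q = q.
  move=> bq; rewrite tpermD //; first by apply: contraNneq px => ->; rewrite bq.
  by rewrite eq_sym aux_neq_pt // /aux bq /=.
by rewrite (h (strand x)) // xg h // base_fl.
Qed.

Lemma untouched_tperm2 (g : perms) p u x : ~~ (aux p && (matching g p == fl _ p)) ->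
  x \notin touched g -> x \notin touched (g * tperm p (pt u))%g.
Proof.
move=> np xg; apply: untouched_tperm => //; apply: contra np => /eqP px.
rewrite /aux px /= ltn_ord; move: xg; rewrite inE negbK => /eqP xg.
by case: (base_strand px) => ->; [rewrite xg eqxx | rewrite -{1}xg matchingK flK eqxx].
Qed.

Lemma touch_new (g : perms) p u : (#|touched g| < #|touched (g * tperm p (pt u))%g|)%N ->
  aux p /\ matching g p = fl _ p.
Proof.
move=> lt; suff: aux p && (matching g p == fl _ p) by case/andP=> -> /eqP.
rewrite -[_ && _]negbK; apply/negP => np.
move: lt; rewrite ltnNge; apply/negP; rewrite negbK; apply/subset_leq_card/subsetP => x.
by apply: contraTT => /(untouched_tperm2 _ np).
Qed.

Lemma touch_le (g : perms) p u : (#|touched (g * tperm p (pt u))%g| <= #|touched g|.+1)%N.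
Proof.
have [ap|nap] := boolP (aux p); last first.
  apply/leqW/subset_leq_card/subsetP => x; apply: contraTT => /untouched_tperm2-> //.
  by rewrite (negPf nap).
have [y yE] : exists y : 'I_n, base p = lshift d y.
  by exists (Ordinal ap); apply: val_inj.
apply: leq_trans (subset_leq_card (_ : _ \subset y |: touched g)) _; last first.
  by rewrite cardsU1; case: (_ \notin _); rewrite ?add1n ?add0n.
apply/subsetP => x; rewrite in_setU1; apply: contraTT; rewrite negb_or => /andP[xy xg].
apply: untouched_tperm => //; rewrite yE; apply: contra xy => /eqP h.
by apply/eqP/val_inj; have := congr1 val h.
Qed.

(* Pulling the end of the thread starting at u back over one auxiliary strand. *)
Definition pull (u : U) (g : perms) : perms := (g * tperm (fl _ (matching g (pt u))) (pt u))%g.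
Definition pullable (u : U) (g : perms) : bool := aux (matching g (pt u)).

Lemma pull_strand u g : pullable u g -> let z := fl _ (matching g (pt u)) in
  matching (pull u g) z = fl _ z.
Proof.
move=> pu z; rewrite /pull -/z matching_tperm tpermL.
have -> : matching g (pt u) = fl _ z by rewrite /z flK.
by rewrite tpermD // eq_sym ?fl_neq // aux_neq_pt // aux_fl /z aux_fl.
Qed.

Lemma touch_pull u g : pullable u g -> #|touched g| = #|touched (pull u g)|.+1.
Proof.
move=> pu; pose z := fl _ (matching g (pt u)).
have pz : matching (pull u g) z = fl _ z := pull_strand pu.
have zE : matching g (fl _ z) = pt u by rewrite /z flK matchingK.
have /auxP[x xz] : aux z by rewrite /z aux_fl.
have hE : pull u g = (g * tperm z (pt u))%g by [].
have gE : g = (pull u g * tperm z (pt u))%g by rewrite hE -mulgA tperm2 mulg1.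
have xg : x \in touched g.
  rewrite inE; clearbody z; case: xz zE => -> zE; apply/eqP => h.
    by move: (aux_pt u); rewrite -zE -h matchingK aux_strand.
  by move: (aux_pt u); rewrite -zE flK h aux_fl aux_strand.
apply/eqP; rewrite eqn_leq {1}gE touch_le /=.
apply: proper_card; apply/properP; split.
  apply/subsetP => x'; apply: contraTT => x'g; rewrite hE; apply: untouched_tperm => //.
  apply: contraNneq x'g => zx; suff -> : x' = x by [].
  apply: val_inj; have /(congr1 val) /= <- := zx.
  by clearbody z; case: xz => ->; rewrite ?base_fl.
exists x => //; rewrite inE negbK; clearbody z; case: xz pz => -> pz; first by rewrite pz.
by rewrite -{1}(flK (strand x)) -pz matchingK.
Qed.

Definition below_top (k : 'I_d) : {set P} := [set z : P | if z is inl x then (x < n + k)%N else false].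
Definition below_bot (k : 'I_d) : {set P} := [set z : P | if z is inr x then (x < n + k)%N else false].

(* The sign of ybot makes dots at the two ends of a vertical line agree. *)
Definition ytop k := jm (@match_perm C X) (@match_cup C X) (below_top k) (pt (inl k)).
Definition ybot k := - jm (@match_perm C X) (@match_cup C X) (below_bot k) (pt (inr k)).
Definition ydot (u : U) := match u with inl k => ytop k | inr k => ybot k end.

Definition level r (v : V) : Prop := forall g, (r < #|touched g|)%N -> cf g v = 0.

Lemma level_vecc g : level #|touched g| (vecc C g).
Proof.
move=> k kg; apply: cf_vecc_neq; apply: contraTneq kg => E.
have -> : touched k = touched g by apply/setP => x; rewrite !inE E.
by rewrite ltnn.
Qed.

Lemma level_vecc_le r g : (#|touched g| <= r)%N -> level r (vecc C g).
Proof. by move=> gr k rk; apply: level_vecc; apply: leq_ltn_trans gr rk. Qed.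

Lemma touched_eq g k : matching g = matching k -> touched g = touched k.
Proof. by move=> E; apply/setP => x; rewrite !inE E. Qed.

Section Pull.
Variables (u : U) (r : nat).

(** A transposition touching one more strand must attach the end u to a vertical auxiliary edge.
    Then x can be read off from g, and k is recovered by [pull]. *)
Lemma cf_swap_new g k x : (#|touched k| <= r)%N -> #|touched g| = r.+1 ->
  cf g (vecc C (k * tperm x (pt u))%g) =
  if pullable u g && (fl _ (matching g (pt u)) == x) then cf (pull u g) (vecc C k) else 0.
Proof.
move=> kr gr.
have [E|ne] := eqVneq (matching g) (matching (k * tperm x (pt u))%g); last first.
  rewrite cf_vecc_neq //; case: ifP => // /andP[pu /eqP xE].
  rewrite cf_vecc_neq //; apply: contra ne => /eqP mE; apply/eqP.
  have gE : g = (pull u g * tperm x (pt u))%g by rewrite /pull xE -mulgA tperm2 mulg1.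
  by apply/permP => t; rewrite {1}gE (matchingM (pull u g)) mE matchingM.
have gE := touched_eq E.
have [ax kx] : aux x /\ matching k x = fl _ x.
  by apply: (@touch_new k x u); rewrite -gE gr ltnS.
have gu : matching g (pt u) = fl _ x.
  by rewrite E matching_tperm tpermR kx tpermD // eq_sym ?fl_neq // aux_neq_pt // aux_fl.
rewrite /pullable gu aux_fl ax flK eqxx /= /pull gu flK.
by rewrite cf_perm tpermV.
Qed.

(** As for transpositions, but the cup term attaches u to x itself instead of the other end of the
    strand of x, and with the opposite sign. *)
Lemma cf_cup_new g k x : (#|touched k| <= r)%N -> #|touched g| = r.+1 -> x != pt u ->
  cf g (match_cup C x (pt u) *m vecc C k) =
  - (if pullable u g && (matching g (pt u) == x) then cf (pull u g) (vecc C k) else 0).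
Proof.
move=> kr gr xu; rewrite match_cupE; case: eqVneq => [kx|kx].
  rewrite cf0; case: ifP => [/andP[pu /eqP xE]|_]; last by rewrite oppr0.
  rewrite cf_vecc_neq ?oppr0 //.
  have := pull_strand pu; rewrite xE /= flK => h.
  apply/eqP => E; rewrite E in h; move: (pu); rewrite /pullable xE => ax.
  by move: (aux_pt u); rewrite -kx -h matchingK aux_fl ax.
rewrite cfN tpermC cf_swap_new //; congr (- _).
have [pu|//] := boolP (pullable u g); rewrite !andTb.
have [E|ne] := eqVneq (matching (pull u g)) (matching k); last first.
  by rewrite cf_vecc_neq // !if_same.
have := pull_strand pu; rewrite /= E flK => h.
by rewrite -(inj_eq (@perm_inj _ (matching k))) h matchingK.
Qed.
End Pull.

Definition below (u : U) : {set P} := match u with inl k => below_top k | inr k => below_bot k end.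
Definition jmu (u : U) := jm (@match_perm C X) (@match_cup C X) (below u) (pt u).

Definition bottom (u : U) : bool := if u is inl _ then false else true.

Lemma ydotE u : ydot u = (-1) ^+ bottom u *: jmu u.
Proof. by case: u => k; rewrite /ydot ?expr0 ?scale1r // expr1 scaleN1r. Qed.

Lemma below_pt u x : x \in below u -> x != pt u.
Proof.
apply: contraTneq => ->; case: u => k; rewrite inE /=; by rewrite ltnn.
Qed.

(** Exactly one end of each auxiliary strand is below u. Hence, for given g, exactly one of the
    transposition term and the cup term can reach g, and nothing cancels in [cf_jmu_vecc]. *)
Lemma below_aux u z : aux z -> (fl _ z \in below u) = (z \notin below u).
Proof.
have h (x : X) (k : 'I_d) : (x < n)%N -> (x < n + k)%N by move=> xn; apply: ltn_addr.
by rewrite flE /aux; case: u z => k [x|x] /= xn; rewrite !inE /= h.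
Qed.

Lemma jmu_vecc u k : jmu u *m vecc C k =
  \sum_(x in below u) (vecc C (k * tperm x (pt u))%g + match_cup C x (pt u) *m vecc C k).
Proof.
rewrite /jmu /jm mulmx_suml; apply: eq_bigr => x _.
by rewrite mulmxDl match_permE.
Qed.

Lemma cf_jmu_vecc u r g k : (#|touched k| <= r)%N -> #|touched g| = r.+1 ->
  cf g (jmu u *m vecc C k) =
  if pullable u g then (-1) ^+ (matching g (pt u) \in below u) * cf (pull u g) (vecc C k) else 0.
Proof.
move=> kr gr; rewrite jmu_vecc cf_sum.
pose z := matching g (pt u); pose c := cf (pull u g) (vecc C k).
rewrite (eq_bigr (fun x => (if pullable u g && (fl _ z == x) then c else 0) -
   (if pullable u g && (z == x) then c else 0))); last first.
  by move=> x xu; rewrite cfD (@cf_swap_new u r g k x kr gr) (@cf_cup_new u r g k x kr gr (below_pt xu)).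
have [az|naz] := boolP (pullable u g); last by rewrite big1 // => x _; rewrite subrr.
rewrite -/z sumrB.
have ind t : \sum_(x in below u) (if true && (t == x) then c else 0) = if t \in below u then c else 0.
  have [tb|tb] := boolP (t \in below u).
    rewrite (bigD1 t) //= eqxx big1 ?addr0 // => x /andP[_ xt].
    by rewrite eq_sym (negPf xt).
  by rewrite big1 // => x xb; case: eqVneq => // tx; rewrite tx xb in tb.
rewrite !ind below_aux //; case: (z \in below u); rewrite /= ?expr1 ?expr0 ?mulN1r ?mul1r.
  by rewrite sub0r.
by rewrite subr0.
Qed.

Lemma level_sum r I (s : seq I) (Q : pred I) (F : I -> V) :
  (forall i, Q i -> level r (F i)) -> level r (\sum_(i <- s | Q i) F i).
Proof. by move=> h g gr; rewrite cf_sum big1 // => i Qi; apply: h. Qed.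

Lemma level_jmu u r k : (#|touched k| <= r)%N -> level r.+1 (jmu u *m vecc C k).
Proof.
move=> kr; rewrite jmu_vecc; apply: level_sum => x xu g gr; rewrite cfD.
have h p : (#|touched (k * tperm p (pt u))%g| <= r.+1)%N.
  by apply: leq_trans (touch_le _ _ _) _; rewrite ltnS.
rewrite (level_vecc_le (h x)) // add0r match_cupE; case: ifP => _; first exact: cf0.
by rewrite cfN tpermC (level_vecc_le (h _)) // oppr0.
Qed.

Lemma level_decomp r v (F : V -> C) : level r v -> (forall x y, F (x + y) = F x + F y) ->
  (forall c x, F (c *: x) = c * F x) ->
  F v = \sum_(m : {m : perms | is_matching m} | (#|touched (orient m)| <= r)%N)
           cf (orient m) v * F (vecc C (orient m)).
Proof.
move=> lv FD FZ; have F0 : F 0 = 0 by have := FZ 0 0; rewrite scale0r mul0r.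
rewrite {1}(vecc_decomp v) (big_morph F FD F0).
rewrite [RHS]big_mkcond; apply: eq_bigr => m _; rewrite FZ; case: leqP => // rm.
by rewrite lv // mul0r.
Qed.

Lemma cf_ydot u r g v : level r v -> #|touched g| = r.+1 -> exists b : bool,
  cf g (ydot u *m v) = if pullable u g then (-1) ^+ b * cf (pull u g) v else 0.
Proof.
move=> lv gr; set b1 := matching g (pt u) \in below u.
have E : cf g (jmu u *m v) = if pullable u g then (-1) ^+ b1 * cf (pull u g) v else 0.
  rewrite (@level_decomp r v (fun v => cf g (jmu u *m v)) lv).
  - rewrite (@level_decomp r v (fun v => cf (pull u g) v) lv).
    + case: ifP => pu; last by rewrite big1 // => m mr; rewrite (cf_jmu_vecc _ mr gr) pu mulr0.
      rewrite big_distrr /=; apply: eq_bigr => m mr.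
      by rewrite (cf_jmu_vecc _ mr gr) pu mulrCA.
    + by move=> x y; apply: cfD.
    by move=> c x; apply: cfZ.
  - by move=> x y; rewrite mulmxDr cfD.
  by move=> c x; rewrite -scalemxAr cfZ.
rewrite ydotE -scalemxAl; exists (bottom u (+) b1); rewrite cfZ E; case: ifP => _; last by rewrite mulr0.
by rewrite signr_addb mulrA.
Qed.

Lemma level_ydot u r v : level r v -> level r.+1 (ydot u *m v).
Proof.
move=> lv g gr; rewrite ydotE -scalemxAl cfZ.
rewrite (@level_decomp r v (fun v => cf g (jmu u *m v)) lv).
- by rewrite big1 ?mulr0 // => m mr; rewrite (level_jmu _ mr) ?mulr0.
- by move=> x y; rewrite mulmxDr cfD.
by move=> c x; rewrite -scalemxAr cfZ.
Qed.

Definition ydots (l : seq U) (v : V) : V := foldr (fun u v => ydot u *m v) v l.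
Fixpoint pulls (l : seq U) (g : perms) : option perms :=
  if l is u :: l' then if pullable u g then pulls l' (pull u g) else None else Some g.

Lemma level_ydots l v : level 0 v -> level (size l) (ydots l v).
Proof. by move=> lv; elim: l => //= u l; apply: level_ydot. Qed.

(** At the maximal number of touched strands every dot must have threaded a strand, so the
    coefficient is found by pulling the dots back one at a time, with a single possible source at
    each stage. *)
Lemma cf_ydots l g v : level 0 v -> #|touched g| = size l -> exists b : bool,
  cf g (ydots l v) = if pulls l g is Some g' then (-1) ^+ b * cf g' v else 0.
Proof.
move=> lv; elim: l g => [|u l IH] g /= gs; first by exists false; rewrite mul1r.
have [b ->] := cf_ydot u (@level_ydots l v lv) gs.
have [pu|_] := boolP (pullable u g); last by exists false.
have [|b' ->] := IH (pull u g); first by apply: succn_inj; rewrite -gs (touch_pull pu).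
exists (b (+) b'); case: pulls => [g'|]; last by rewrite mulr0.
by rewrite signr_addb mulrA.
Qed.

(* The connected components of link are the threads: chains of edges of the
   matching passing through the auxiliary strands. *)
Definition link (g : perms) : rel P := fun a b => (b == matching g a) || (aux a && (b == fl _ a)).
Definition conn g := connect (link g).

Lemma conn_sym g : connect_sym (link g).
Proof.
apply: sym_connect_sym => a b; rewrite /link; congr (_ || _).
  by apply/eqP/eqP => ->; rewrite matchingK.
by apply/andP/andP => -[ab /eqP->]; rewrite aux_fl flK eqxx.
Qed.

Lemma conn_matching g a : conn g a (matching g a).
Proof. by apply: connect1; rewrite /link eqxx. Qed.
Lemma conn_aux g a : aux a -> conn g a (fl _ a).
Proof. by move=> aa; apply: connect1; rewrite /link aa eqxx orbT. Qed.

Section PullConn.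
Variables (u : U) (g : perms).
Hypothesis pu : pullable u g.
Let z := fl _ (matching g (pt u)).
Let g' := pull u g.

Let az : aux z. Proof. by rewrite /z aux_fl. Qed.
Let zu : z != pt u. Proof. exact: aux_neq_pt. Qed.
Let fzu : fl _ z != pt u. Proof. by rewrite aux_neq_pt // aux_fl. Qed.
Let gu : matching g (pt u) = fl _ z. Proof. by rewrite /z flK. Qed.
Let gfz : matching g (fl _ z) = pt u. Proof. by rewrite -gu matchingK. Qed.
Let g'E a : matching g' a = tperm z (pt u) (matching g (tperm z (pt u) a)).
Proof. exact: matching_tperm. Qed.
Let g'z : matching g' z = fl _ z. Proof. exact: pull_strand. Qed.
Let gzu : matching g z != pt u.
Proof. by rewrite -gfz (inj_eq perm_inj) eq_sym fl_neq. Qed.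
Let g'u : matching g' (pt u) = matching g z.
Proof. by rewrite g'E tpermR tpermD // eq_sym // matching_neq. Qed.
Let g'out a : a != z -> a != fl _ z -> a != pt u -> a != matching g z -> matching g' a = matching g a.
Proof.
move=> h1 h2 h3 h4; rewrite g'E (@tpermD _ _ _ a) 1?eq_sym // tpermD //.
  by rewrite -(inj_eq (@perm_inj _ (matching g))) matchingK eq_sym.
by rewrite -gfz (inj_eq perm_inj) eq_sym.
Qed.

Lemma conn_z : conn g z (pt u).
Proof.
by apply: connect_trans (conn_aux _ az) _; rewrite -[X in connect _ _ X]gfz; apply: conn_matching.
Qed.
Let conn_fz : conn g (fl _ z) (pt u).
Proof. by rewrite -gfz; apply: conn_matching. Qed.

(** Pulling shortens the thread ending at u by the strand of z and changes no other connection. *)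
Lemma conn_pull a b : a != z -> a != fl _ z -> b != z -> b != fl _ z -> conn g a b = conn g' a b.
Proof.
move=> az1 az2 bz1 bz2.
(* The strand cut off by the pull is contracted to the end u of its former thread. *)
pose h c := if (c == z) || (c == fl _ z) then pt u else c.
have hE c : c != z -> c != fl _ z -> h c = c by rewrite /h => /negPf-> /negPf->.
apply/idP/idP.
  rewrite -{2}(hE a) // -{2}(hE b) //; apply: connect_hom => c e.
  have hz : h z = pt u by rewrite /h eqxx.
  have hfz : h (fl _ z) = pt u by rewrite /h eqxx orbT.
  rewrite /link => /orP[/eqP->|/andP[ac /eqP->]].
    have [->|cz] := eqVneq c z.
      rewrite hz hE ?matching_neq //; first by rewrite -g'u; apply: conn_matching.
      by rewrite -gu (inj_eq perm_inj).
    have [->|cfz] := eqVneq c (fl _ z); first by rewrite gfz hfz hE // eq_sym.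
    rewrite (hE c) //; have [->|cu] := eqVneq c (pt u); first by rewrite gu hfz.
    have [->|cgz] := eqVneq c (matching g z).
      by rewrite matchingK hz -g'u conn_sym; apply: conn_matching.
    rewrite hE; first by rewrite -g'out //; apply: conn_matching.
      by rewrite -(inj_eq (@perm_inj _ (matching g))) matchingK.
    by rewrite -gu (inj_eq perm_inj).
  have [->|cz] := eqVneq c z; first by rewrite hz hfz.
  have [->|cfz] := eqVneq c (fl _ z); first by rewrite flK hz hfz.
  rewrite !hE //; first exact: conn_aux.
    by rewrite -(inj_eq (@perm_inj _ (fl _))) flK.
  by rewrite (inj_eq perm_inj).
apply: (@connect_hom _ _ _ _ id) => c e.
rewrite /link => /orP[/eqP->|/andP[ac /eqP->]]; last exact: conn_aux.
have [->|cz] := eqVneq c z; first by rewrite g'z; apply: conn_aux.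
have [->|cfz] := eqVneq c (fl _ z).
  rewrite -{2}g'z matchingK conn_sym; exact: conn_aux.
have [->|cu] := eqVneq c (pt u).
  by rewrite g'u; apply: connect_trans (_ : connect _ _ z) _; [rewrite conn_sym; apply: conn_z|apply: conn_matching].
have [->|cgz] := eqVneq c (matching g z).
  rewrite -g'u matchingK g'u conn_sym.
  by apply: connect_trans (_ : connect _ _ z) _; [rewrite conn_sym; apply: conn_z|apply: conn_matching].
by rewrite g'out //; apply: conn_matching.
Qed.

Lemma conn_pull_z v : conn g' (pt v) z = false.
Proof.
apply/negP => /(connect_invariant (c := fun c => (c == z) || (c == fl _ z))) H.
have g'fz : matching g' (fl _ z) = z by rewrite -g'z matchingK.
have : (pt v == z) || (pt v == fl _ z) = (z == z) || (z == fl _ z).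
  apply: H => c e /orP[/eqP->|/andP[_ /eqP->]].
    by rewrite -{2}g'z -{3}g'fz !(inj_eq perm_inj) orbC.
  by rewrite -{3}[z](flK z) !(inj_eq perm_inj) orbC.
by rewrite eqxx eq_sym (negPf (aux_neq_pt _ az)) eq_sym (negPf (aux_neq_pt _ _)) // aux_fl.
Qed.

Lemma conn_pull_pt v w : conn g (pt v) (pt w) = conn g' (pt v) (pt w).
Proof. by rewrite conn_pull // eq_sym aux_neq_pt // aux_fl. Qed.

(** Each auxiliary strand is counted once, by its top end. *)
Definition strands (g : perms) (v : U) := #|[set x | conn g (pt v) (strand x)]|.

Lemma strands_pull v : strands g v = (strands g' v + conn g (pt v) (pt u))%N.
Proof.
have [x0 xz] := auxP az.
have cz w : conn g w (pt u) = conn g w (strand x0).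
  apply/idP/idP => h; apply: connect_trans h _.
    rewrite conn_sym; case: xz => E; last rewrite -[strand x0]flK -E.
      by rewrite -E; apply: conn_z.
    exact: conn_fz.
  case: xz => E; last rewrite -[strand x0]flK -E; last exact: conn_fz.
  by rewrite -E; apply: conn_z.
have c'z : conn g' (pt v) (strand x0) = false.
  case: xz => E; first by rewrite -E conn_pull_z.
  apply/negP => h; have := conn_pull_z v; rewrite E; move/negP; apply.
  by apply: connect_trans h _; apply: conn_aux; apply: aux_strand.
have cx x : x != x0 -> conn g (pt v) (strand x) = conn g' (pt v) (strand x).
  move=> xx0; have sx : base (strand x) != base z.
    by case: xz => ->; rewrite ?base_fl /= (inj_eq (@lshift_inj _ _)).
  rewrite conn_pull //; try by rewrite eq_sym aux_neq_pt // aux_fl.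
    by apply: contraNneq sx => ->.
  by apply: contraNneq sx => ->; rewrite base_fl.
rewrite /strands (cardsD1 x0) inE -cz addnC; congr (_ + _)%N.
rewrite [RHS](cardsD1 x0) inE c'z add0n; apply: eq_card => x; rewrite !inE.
by have [//|xx0] := eqVneq x x0; rewrite cx.
Qed.
End PullConn.
End Threads.

Arguments pt : simpl never.

(** * Stacks acting on matchings *)

Section MatrixAction.
Variables (C : fieldType) (n d : nat).
Hypothesis char0 : forall k, k.+1%:R != 0 :> C.
Local Notation X := 'I_(n + d).
Local Notation P := (X + X)%type.
Local Notation B := 'M[C]_((nmatch X).+1).
Local Notation V := 'cV[C]_(nmatch X).+1.
Local Notation Rm := (@match_perm C X).
Local Notation em := (@match_cup C X).
Local Notation pt := (@pt n d).

Definition gen_mx (g : generator d) : B :=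
  match g with
  | inl (LS a) => Rm (tperm (pt (inl (lo a))) (pt (inl (hi a))))
  | inl (LE a) => em (pt (inl (lo a))) (pt (inl (hi a)))
  | inr j => ytop C n j
  end.

Definition word_mx (u : {fmonom (generator d)}) : B := \prod_(g <- (u : seq (generator d))) gen_mx g.
Lemma word_mxP : {morph word_mx : x y / mmul x y >-> x * y} /\ word_mx mone = 1.
Proof.
split=> [x y|]; rewrite /word_mx; first by rewrite fmM big_cat.
by rewrite fm1 big_nil.
Qed.
HB.instance Definition _ := isMultiplicative.Build {fmonom (generator d)} B word_mx word_mxP.

Definition stack_mx : stacks C d -> B := mmap (@scalar_mx C _) word_mx.

Lemma stack_mxD : {morph stack_mx : x y / x + y}. Proof. exact: mmapD. Qed.
Lemma stack_mxB : {morph stack_mx : x y / x - y}. Proof. exact: mmapB. Qed.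
Lemma stack_mx0 : stack_mx 0 = 0. Proof. exact: mmap0. Qed.
Lemma stack_mxM : {morph stack_mx : x y / x * y}.
Proof.
have [h _] : MMorphism.axiom stack_mx; last exact: h.
by apply: commr_mmap_is_multiplicative => x m m'; exact: (esym (scalar_mxC _ _)).
Qed.
Lemma stack_mx1 : stack_mx 1 = 1. Proof. exact: mmap1. Qed.
Lemma stack_mxZ c x : stack_mx (c *: x) = c *: stack_mx x.
Proof. by rewrite /stack_mx mmapZ; exact: mul_scalar_mx. Qed.
Lemma stack_mx_gen g : stack_mx (fgen C g) = gen_mx g.
Proof. by rewrite /stack_mx mmapU mul1r /word_mx fmU big_seq1. Qed.

HB.instance Definition _ := GRing.isZmodMorphism.Build _ _ stack_mx stack_mxB.
HB.instance Definition _ := GRing.isMonoidMorphism.Build _ _ stack_mx (conj stack_mx1 stack_mxM).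

Lemma matrix_torsion_free (x : B) k : x *+ k.+1 = 0 -> x = 0.
Proof.
move=> /eqP; rewrite -scaler_nat scaler_eq0 (negPf (char0 k)) /=.
by move/eqP.
Qed.

Lemma stack_mx_relation l r : relation (@fs C d) (@fe C d) (@fy C d) l r -> stack_mx l = stack_mx r.
Proof.
move=> /(relation_morph stack_mx) h.
have st_inj : injective (fun j : 'I_d => pt (inl j)) by move=> i j /pt_inj[].
apply: (jm_relation (match_rep C X) matrix_torsion_free st_inj (below := @below_top n d)).
- by move=> i j; rewrite inE /= ltn_add2l.
- move=> a; apply/setP => -[x|x]; rewrite !inE //= (inj_eq inl_inj) -val_eqE /= addnS ltnS.
  by rewrite leq_eqVlt.
- move=> i j ij; apply/subsetP => -[x|x]; rewrite !inE //= (inj_eq inl_inj) -val_eqE /=.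
  by move=> h'; have : (x <= n + i)%N; [lia | move=> h2; lia].
have ext (s s' e e' : 'I_d.-1 -> B) (y y' : 'I_d -> B) a b :
    s =1 s' -> e =1 e' -> y =1 y' -> relation s e y a b -> relation s' e' y' a b.
  by move=> /boolp.funext-> /boolp.funext-> /boolp.funext->.
by apply: ext h => a; apply: stack_mx_gen.
Qed.

Lemma stack_mx_ideal x : in_ideal x -> stack_mx x = 0.
Proof.
elim=> [|l r lr|y z _ Iy _ Iz|y z _ Iz|y z _ Iy].
- exact: stack_mx0.
- by rewrite stack_mxB (stack_mx_relation lr) subrr.
- by rewrite stack_mxD Iy Iz addr0.
- by rewrite stack_mxM Iz mulr0.
- by rewrite stack_mxM Iy mul0r.
Qed.

(* g is the matching of the diagram f together with the auxiliary strands. *)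
Definition extends (f : vertex d -> vertex d) (g : {perm P}) : Prop :=
  (forall u, matching g (pt u) = pt (f u)) /\
  (forall x, matching g (strand d x) = fl _ (strand d x)).

Lemma ptP z : ~~ aux z -> exists u, z = pt u.
Proof.
rewrite /aux -leqNgt; case: z => x /= nx.
  have xd : (x - n < d)%N by have := ltn_ord x; lia.
  by exists (inl (Ordinal xd)); congr inl; apply: val_inj; rewrite /= subnKC.
have xd : (x - n < d)%N by have := ltn_ord x; lia.
by exists (inr (Ordinal xd)); congr inr; apply: val_inj; rewrite /= subnKC.
Qed.

Lemma extends_aux f g z : extends f g -> aux z -> matching g z = fl _ z.
Proof.
by move=> [_ h] /auxP[x [->|->]]; rewrite ?flK // -h matchingK.
Qed.

Lemma extends_matching f f' g k : extends f g -> extends f' k -> f =1 f' ->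
  matching g = matching k.
Proof.
move=> fg fk ff; apply/permP => z.
have [az|/ptP[u ->]] := boolP (aux z).
  by rewrite (extends_aux fg) // (extends_aux fk).
by have [h1 _] := fg; have [h2 _] := fk; rewrite h1 h2 ff.
Qed.

Lemma extends_touched f g : extends f g -> #|touched g| = 0%N.
Proof. by move=> [_ h]; apply: eq_card0 => x; rewrite !inE h eqxx. Qed.

Lemma extends_tperm f g a b : extends f g ->
  extends (fun u => tperm a b (f (tperm a b u))) (g * tperm (pt a) (pt b))%g.
Proof.
have tp u : tperm (pt a) (pt b) (pt u) = pt (tperm a b u) by rewrite (inj_tperm _ _ _ (@pt_inj n d)).
have ts z : aux z -> tperm (pt a) (pt b) z = z.
  by move=> az; rewrite tpermD // eq_sym aux_neq_pt.
move=> [h1 h2]; split=> [u|x]; rewrite matching_tperm; first by rewrite tp h1 tp.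
by rewrite (ts (strand d x)) ?aux_strand // h2 ts // aux_fl aux_strand.
Qed.

Lemma extends_ext f f' g : f =1 f' -> extends f g -> extends f' g.
Proof. by move=> ff [h1 h2]; split=> // u; rewrite h1 ff. Qed.

Lemma extends_flip : extends (@flip d) 1%g.
Proof.
have m1 : matching 1%g = fl X by rewrite /matching conjg1.
by split=> u; rewrite m1 // flE; case: u.
Qed.

Lemma letter_extends (l : letter d) f g : extends f g -> ~~ loopy l f ->
  exists2 g', extends (lact l f) g' &
    exists b : bool, gen_mx (inl l) *m vecc C g = (-1) ^+ b *: vecc C g'.
Proof.
move=> fg; case: l => a /= nl.
  exists (g * tperm (pt (inl (lo a))) (pt (inl (hi a))))%g; last first.
    by exists false; rewrite match_permE scale1r.
  apply: extends_ext (extends_tperm _ _ fg) => u.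
  by rewrite /perm_act adjV /adj !lperm_tperm.
have [h1 h2] := fg.
exists (g * tperm (pt (inl (hi a))) (pt (f (inl (lo a)))))%g.
  exact: extends_ext (extends_tperm _ _ fg).
exists true; rewrite match_cupE h1 (inj_eq (@pt_inj n d)) (negPf nl).
by rewrite expr1 scaleN1r.
Qed.

Lemma word_extends (l : seq (letter d)) : loop_free l ->
  exists2 g, extends (wact l (@flip d)) g & exists b : bool,
    stack_mx (\prod_(g <- l) fgen C (inl g)) *m vecc C 1%g = (-1) ^+ b *: vecc C g.
Proof.
have [-> _] := loop_freeP l; rewrite rmorph_prod; elim: l => [|l ls IH] /=.
  move=> _; exists 1%g; first exact: extends_flip.
  by exists false; rewrite big_nil mul1mx scale1r.
rewrite negb_or => /andP[/IH[g fg [b E]] nl].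
have [g' fg' [b' E']] := letter_extends fg nl.
exists g' => //; exists (b (+) b'); rewrite big_cons -mulmxA E -scalemxAr stack_mx_gen E'.
by rewrite scalerA signr_addb.
Qed.

Local Notation ydots := (@ydots C n d).

Lemma ydots_cat l1 l2 v : ydots (l1 ++ l2) v = ydots l1 (ydots l2 v).
Proof. by rewrite /ydots foldr_cat. Qed.

Lemma stack_mx_dots l v : stack_mx (\prod_(k <- l) fy C k) *m v = ydots (map inl l) v.
Proof.
rewrite rmorph_prod; elim: l => [|k l IH] /=; first by rewrite big_nil mul1mx.
by rewrite big_cons -mulmxA IH stack_mx_gen.
Qed.

Definition is_inl (z : P) : bool := if z is inl _ then true else false.

Lemma ybot_comm_perm k a b : is_inl a -> is_inl b ->
  Rm (tperm a b) * ybot C n k = ybot C n k * Rm (tperm a b).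
Proof.
move=> la lb; rewrite /ybot mulrN mulNr (jm_perm (match_rep C X)).
  by rewrite tpermD //; case: a la => //; case: b lb.
move=> x; case: tpermP => [->|->|//]; rewrite !inE.
  by case: a la => //; case: b lb.
by case: a la => //; case: b lb.
Qed.

Lemma ybot_comm_cup k a b : is_inl a -> is_inl b -> a != b ->
  em a b * ybot C n k = ybot C n k * em a b.
Proof.
move=> la lb ab; rewrite /ybot mulrN mulNr (jm_far (match_rep C X)) // ?inE /= ?ltnn //.
- by case: (a) la.
- by case: (b) lb.
- by case: (a) la.
by case: (b) lb.
Qed.

(** Generators act on top ends and [ybot] on bottom ends, so bottom dots can be carried through the
    body of a diagram. *)
Lemma ybot_comm_gen k g : gen_mx g * ybot C n k = ybot C n k * gen_mx g.
Proof.
case: g => [[a|a]|j] /=.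
- exact: ybot_comm_perm.
- by apply: ybot_comm_cup => //; rewrite (inj_eq (@pt_inj n d)) (inj_eq inl_inj) lo_neq_hi.
apply/commr_sym; rewrite /ytop /jm; apply: commr_sum => x xb; apply: commr_sym.
have xl : is_inl x by move: xb; rewrite inE; case: (x).
apply: commr_sym; apply: commrD; apply: commr_sym; first exact: ybot_comm_perm.
apply: ybot_comm_cup => //; exact: (@below_pt n d (inl j)).
Qed.

Lemma ydots_bot_comm g l v : gen_mx g *m ydots (map inr l) v = ydots (map inr l) (gen_mx g *m v).
Proof.
elim: l => //= k l IH; rewrite mulmxA [gen_mx g *m ybot C n k]ybot_comm_gen.
by rewrite -mulmxA IH.
Qed.

(** On vertical edges exchanging two top ends amounts, by [vecc_pairN], to minus exchanging the two
    bottom ends; the terms of the two sums correspond under [fl]. *)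
Lemma ytop_bot (k : 'I_d) : ytop C n k *m vecc C 1%g = ybot C n k *m vecc C 1%g.
Proof.
have m1 : matching 1%g = fl X by rewrite /matching conjg1.
rewrite -[ytop C n k]/(@jmu C n d (inl k)) -[ybot C n k]/(- @jmu C n d (inr k)) mulNmx.
rewrite !jmu_vecc (reindex_inj (@perm_inj _ (fl X))) -sumrN /=.
apply: eq_big => [x|x]; first by rewrite flE !inE; case: x.
rewrite flE inE; case: x => x //= xk.
have xk1 : inl x != pt (inl k) by rewrite (inj_eq inl_inj) -val_eqE /= ltn_eqF.
have xk2 : inr x != pt (inr k) by rewrite (inj_eq inr_inj) -val_eqE /= ltn_eqF.
rewrite opprD !mul1g !match_cupE !m1 !flE /= !mul1g; congr (_ + _).
  have := @vecc_pairN C X 1%g (inl x) (pt (inl k)) xk1.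
  by rewrite !m1 !flE /= !mul1g => ->.
congr (- _); have := @vecc_pairN C X 1%g (pt (inl k)) (inr x).
have mk : matching 1%g (pt (inl k)) = pt (inr k) by rewrite m1 flE.
have mx : matching 1%g (inr x) = inl x by rewrite m1 flE.
by rewrite mk mx !mul1g eq_sym [pt (inr k) == _]eq_sym; apply.
Qed.

Lemma ydots_top_bot l : ydots (map inl l) (vecc C 1%g) = ydots (map inr (rev l)) (vecc C 1%g).
Proof.
elim: l => //= k l ->; rewrite [ytop C n k *m _](ydots_bot_comm (inr k)) /= ytop_bot.
by rewrite rev_cons map_rcons -cats1 ydots_cat.
Qed.

Section Monomial.
Variables (w : brauer d -> seq (letter d)) (hw : word_choice w).

Definition dot_list (D : dot_diagram d) : seq (vertex d) :=
  map inl (flatten [seq nseq (top_dots D k) k | k <- enum 'I_d]) ++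
  map inr (rev (flatten [seq nseq (bot_dots D k) k | k <- enum 'I_d])).

(** The bottom dots act first, on vertical edges, where [ydots_top_bot] turns them into [ybot]; they
    then commute through the body, so that all dots act on the matching of the diagram. *)
Lemma stack_mx_monomial D f : fpf_inv f -> val (Defs.shape D) = edges_of f ->
  exists2 g, extends f g & exists b : bool,
    stack_mx (dot_stack C w D) *m vecc C 1%g = (-1) ^+ b *: ydots (dot_list D) (vecc C g).
Proof.
move=> ff Df; have [hw1 hw2 _ _] := hw.
have lf := hw2 (Defs.shape D); have [g fg [b E]] := word_extends lf.
have fE : wact (w (Defs.shape D)) (@flip d) =1 f.
  apply: edges_of_inj => //; first by apply: wact_fpf; apply: flip_fpf.
  by rewrite -Df -hw1; apply/esym; have [_] := loop_freeP (w (Defs.shape D)); apply.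
exists g; first exact: extends_ext fg.
exists b; rewrite /dot_stack !prod_flatten_nseq !stack_mxM -!mulmxA (stack_mx_dots _ (vecc C 1%g)) ydots_top_bot.
set be := rev _; rewrite stack_mx_dots /dot_list -/be ydots_cat; set al := flatten _.
have comm l v : stack_mx (\prod_(g <- l) fgen C (inl g)) *m ydots (map inr be) v
    = ydots (map inr be) (stack_mx (\prod_(g <- l) fgen C (inl g)) *m v).
  rewrite rmorph_prod; elim: l => [|x l IH]; first by rewrite big_nil !mul1mx.
  by rewrite big_cons /= -!mulmxA IH stack_mx_gen ydots_bot_comm.
rewrite comm E.
have lin l c v : ydots l (c *: v) = c *: ydots l v.
  by elim: l => //= x l ->; rewrite scalemxAr.
by rewrite !lin.
Qed.
End Monomial.

(** As long as fewer than n dots have been used, an untouched auxiliary strand is left; threading it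
    at u is undone by a pull. *)
Lemma pulls_exist (l : seq (vertex d)) (g0 : {perm P}) : #|touched g0| = 0%N -> (size l <= n)%N ->
  exists2 g, pulls l g = Some g0 & #|touched g| = size l.
Proof.
move=> g00; elim: l => [|u l IH] /= ln; first by exists g0.
have [g gE tg] := IH (ltnW ln).
have [x] : exists x, x \notin touched g.
  apply/existsP; rewrite -negb_forall; apply/negP => /forallP h.
  have : #|touched g| = n by rewrite -[RHS]card_ord; apply: eq_card => x; rewrite h.
  by rewrite tg => E; rewrite E ltnn in ln.
rewrite inE negbK => /eqP gx; pose z := strand d x.
have fz : tperm z (pt u) (fl _ z) = fl _ z.
  by rewrite tpermD // eq_sym ?fl_neq // aux_neq_pt // aux_fl aux_strand.
have mu' : matching (g * tperm z (pt u))%g (pt u) = fl _ z.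
  by rewrite matching_tperm tpermR gx fz.
have pu : pullable u (g * tperm z (pt u))%g by rewrite /pullable mu' aux_fl aux_strand.
have pE : pull u (g * tperm z (pt u))%g = g.
  by rewrite /pull mu' flK -mulgA tperm2 mulg1.
exists (g * tperm z (pt u))%g; first by rewrite pu pE.
by rewrite (touch_pull pu) pE tg.
Qed.

Lemma extends_conn f g v w : fpf_inv f -> extends f g ->
  conn g (pt v) (pt w) = (w == v) || (w == f v).
Proof.
move=> [fK _] fg; have [h1 h2] := fg; apply/idP/orP => [|[/eqP->|/eqP->]]; first 1 last.
- exact: connect0.
- by rewrite -h1; apply: conn_matching.
pose c z := if [pick u | z == pt u] is Some u then (u == v) || (u == f v) else false.
have cpt u : c (pt u) = (u == v) || (u == f v).
  rewrite /c; case: pickP => [u' /eqP/pt_inj<-//|/(_ u)].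
  by rewrite eqxx.
have caux z : aux z -> c z = false.
  rewrite /c; case: pickP => // u /eqP ->; by rewrite aux_pt.
move=> /(connect_invariant (c := c)); rewrite !cpt eqxx => /(_ _)/esym/orP; apply.
move=> a b /orP[/eqP->|/andP[aa /eqP->]]; last by rewrite !caux // aux_fl.
have [aa|/ptP[u ->]] := boolP (aux a).
  by rewrite (extends_aux fg) // !caux // aux_fl.
by rewrite h1 !cpt (can2_eq fK fK) (inj_eq (inv_inj fK)) orbC.
Qed.

Lemma extends_strands f g v : fpf_inv f -> extends f g -> strands g v = 0%N.
Proof.
move=> ff fg; apply: eq_card0 => x; rewrite !inE.
have [h1 h2] := fg; apply/negP => /(connect_invariant (c := @aux n d)).
rewrite aux_pt aux_strand => /(_ _) h; suff: false = true by []; apply: h => a b.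
move=> /orP[/eqP->|/andP[aa /eqP->]]; last by rewrite aux_fl.
have [aa|/ptP[u ->]] := boolP (aux a); first by rewrite (extends_aux fg) ?aux_fl.
by rewrite h1 !aux_pt.
Qed.

(** The left-hand sides depend on g alone, so g determines the partner function f and, for each
    edge, the number of dots at its two ends together, whatever the order of the pulls. *)
Lemma pulls_threads l g g' f : fpf_inv f -> pulls l g = Some g' -> extends f g' ->
  (forall v w, conn g (pt v) (pt w) = (w == v) || (w == f v)) /\
  (forall v, strands g v = count_mem v l + count_mem (f v) l)%N.
Proof.
move=> ff + fg; elim: l g => [|u l IH] g /=.
  move=> [->]; split=> *; first exact: extends_conn.
  by rewrite (extends_strands _ ff fg).
case: ifP => // pu /IH[h1 h2].
have h3 v w : conn g (pt v) (pt w) = (w == v) || (w == f v) by rewrite (conn_pull_pt pu) h1.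
split=> // v; rewrite (strands_pull pu) h2 h3.
have [_ fn] := ff; have := fn v; case: (eqVneq u v) => [->|_] /=; rewrite ?addn0 ?add0n.
  by rewrite eq_sym => /negPf->; lia.
by move=> _; case: (u == f v); lia.
Qed.
End MatrixAction.

(** * Linear independence of the regular monomials *)

Section RegularDots.
Variable d : nat.
Implicit Types (D : dot_diagram d) (f : vertex d -> vertex d) (v : vertex d).

Lemma count_dot_list_top D k : count_mem (inl k) (dot_list D) = top_dots D k.
Proof.
rewrite count_cat !count_map -[RHS](count_flatten_nseq (top_dots D)) addnC.
rewrite (eq_count (a2 := pred0)) ?count_pred0 ?add0n //.
Qed.

Lemma count_dot_list_bot D k : count_mem (inr k) (dot_list D) = bot_dots D k.
Proof.
rewrite count_cat !count_map -[RHS](count_flatten_nseq (bot_dots D)) count_rev.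
rewrite (eq_count (a2 := pred0)) ?count_pred0 // add0n.
Qed.

(* The ends of edges at which a regular diagram carries no dot: exactly one of
   the two ends of every edge. *)
Definition bare f v : bool :=
  match v, f v with
  | inl k, inl l => (l < k)%N
  | inl _, inr _ => false
  | inr _, inl _ => true
  | inr k, inr l => (k < l)%N
  end.

Lemma bare_flip f v : fpf_inv f -> bare f (f v) = ~~ bare f v.
Proof.
move=> [fK fn]; have := fn v; have := fK v; rewrite /bare.
case: v => k.
  case: (f (inl k)) => [l|l] -> //=.
  by rewrite (inj_eq inl_inj) -val_eqE /=; lia.
case: (f (inr k)) => [l|l] -> //=.
by rewrite (inj_eq inr_inj) -val_eqE /=; lia.
Qed.

Lemma bare_dots D f v : regular D -> fpf_inv f -> val (Defs.shape D) = edges_of f ->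
  bare f v -> count_mem v (dot_list D) = 0%N.
Proof.
move=> /andP[/forallP rb /forallP rt] ff Df; rewrite /bare; case: v => k.
  rewrite count_dot_list_top; case E: (f _) => [l|//] lk; apply/eqP; apply: (implyP (rt k)).
  apply/existsP; exists l; rewrite lk Df setUC mem_edges_of // E eqxx //.
rewrite count_dot_list_bot => h; apply/eqP; apply: contraTT h => /(implyP (rb k)).
case/existsP => l /andP[lk]; rewrite Df setUC mem_edges_of // => /eqP <-; lia.
Qed.

(** Regularity leaves dots at one end of each edge only, so the number of dots on an edge gives the
    number at each end. *)
Lemma regular_count D f v : regular D -> fpf_inv f -> val (Defs.shape D) = edges_of f ->
  count_mem v (dot_list D) =
  if bare f v then 0%N else (count_mem v (dot_list D) + count_mem (f v) (dot_list D))%N.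
Proof.
move=> rD ff Df; case: ifP => [|bv]; first exact: bare_dots.
by rewrite (@bare_dots D f (f v)) ?addn0 // bare_flip // bv.
Qed.

Lemma regular_dots_eq D D' f : regular D -> regular D' -> fpf_inv f ->
  val (Defs.shape D) = edges_of f -> val (Defs.shape D') = edges_of f ->
  (forall v, count_mem v (dot_list D) + count_mem (f v) (dot_list D)
    = count_mem v (dot_list D') + count_mem (f v) (dot_list D'))%N -> D = D'.
Proof.
move=> rD rD' ff Df Df' E.
have cE v : count_mem v (dot_list D) = count_mem v (dot_list D').
  by rewrite (regular_count v rD ff Df) (regular_count v rD' ff Df') E.
have tE : top_dots D = top_dots D'.
  by apply/ffunP => k; rewrite -!count_dot_list_top cE.
have bE : bot_dots D = bot_dots D'.
  by apply/ffunP => k; rewrite -!count_dot_list_bot cE.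
have sE : Defs.shape D = Defs.shape D' by apply: val_inj; rewrite Df Df'.
by case: D D' tE bE sE {rD rD' Df Df' E cE} => [[? ?] ?] [[? ?] ?]; rewrite /top_dots /bot_dots /Defs.shape /= => -> -> ->.
Qed.
End RegularDots.

Section Independence.
Variables (C : fieldType) (d : nat).
Hypothesis char0 : forall k, k.+1%:R != 0 :> C.
Variables (w : brauer d -> seq (letter d)) (hw : word_choice w).

Lemma brauer_form (g : brauer d) : exists2 f, fpf_inv f & val g = edges_of f.
Proof. exact: brauer_edges (valP g). Qed.

(** The matching g isolates D0 among the diagrams with no more dots: with fewer dots the level is
    too low, and with equally many a nonzero coefficient forces equal threads. *)
Lemma cf_monomial n (D0 D : dot_diagram d) (g0 : {perm ('I_(n + d) + 'I_(n + d))}) f0 g :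
  regular D0 -> regular D -> fpf_inv f0 -> val (Defs.shape D0) = edges_of f0 ->
  extends f0 g0 -> pulls (dot_list D0) g = Some g0 ->
  #|touched g| = size (dot_list D0) -> (size (dot_list D) <= size (dot_list D0))%N ->
  exists b : bool,
  cf g (@stack_mx C n d (dot_stack C w D) *m vecc C 1%g) = if D == D0 then (-1) ^+ b else 0.
Proof.
move=> rD0 rD ff0 Df0 fg0 pg0 tg; have [f ff Df] := brauer_form (Defs.shape D).
have [k fk [b ->]] := @stack_mx_monomial C n d w hw D f ff Df.
rewrite leq_eqVlt => /orP[/eqP sD|lt]; last first.
  exists false; have -> : D == D0 = false by apply: contraTF lt => /eqP->; rewrite ltnn.
  rewrite cfZ level_ydots ?mulr0 //.
    by have := @level_vecc C n d k; rewrite (extends_touched fk).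
  by rewrite tg.
have lk : level 0 (vecc C k) by have := @level_vecc C n d k; rewrite (extends_touched fk).
have [b' E] := @cf_ydots C n d (dot_list D) g _ lk (etrans tg (esym sD)).
rewrite cfZ E.
case pE: (pulls (dot_list D) g) => [g'|]; last first.
  have -> : D == D0 = false by apply: contra_eqF pE => /eqP->; rewrite pg0.
  by exists false; rewrite mulr0.
have [mE|mN] := eqVneq (matching g') (matching k); last first.
  have -> : D == D0 = false.
    apply: contraNF mN => /eqP DD; move: pE; rewrite DD pg0 => -[<-].
    have ff' : f0 =1 f by apply: edges_of_inj => //; rewrite -Df -Df0 DD.
    by apply/eqP/(extends_matching fg0 fk ff').
  by exists false; rewrite cf_vecc_neq // !mulr0.
have fg' : extends f g'.
  by have [h1 h2] := fk; split=> ?; rewrite mE.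
have [c1 n1] := pulls_threads ff pE fg'.
have [c0 n0] := pulls_threads ff0 pg0 fg0.
have f0E : f0 =1 f.
  move=> v; apply/eqP; have [_ fn] := ff0.
  by have := c1 v (f0 v); rewrite c0 eqxx orbT (negPf (fn v)) /= => <-.
have DD : D = D0.
  apply: (@regular_dots_eq d D D0 f) => // [|v].
    by rewrite Df0; apply: eq_edges_of.
  by rewrite -n1 n0 f0E.
rewrite DD eqxx cf_vecc_sign //; exists (b (+) (b' (+) chi (k * g'^-1)%g)).
by rewrite !signr_addb.
Qed.

Lemma exists_maximal_size (T : eqType) (F : T -> nat) (s : seq T) : s != [::] ->
  exists2 x, x \in s & {in s, forall z, (F z <= F x)%N}.
Proof.
elim: s => // a s IH _; have [->|/IH[x xs h]] := eqVneq s [::].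
  by exists a => [|z]; rewrite inE // => /eqP->.
have [ax|xa] := leqP (F a) (F x).
  by exists x => [|z]; rewrite inE ?xs ?orbT // => /predU1P[->|/h].
exists a => [|z]; rewrite inE ?eqxx // => /predU1P[->//|/h/leq_trans]; apply.
exact: ltnW.
Qed.

Theorem dot_monomials_free (v : dot_space C d) : proj (as_stacks w v) = 0 -> v = 0.
Proof.
rewrite -[0 in X in X -> _](raddf0 (@proj C d)) => /proj_eqP; rewrite subr0 => Iv.
apply/eqP; apply: contraT => v0.
have : (msupp v : seq _) != [::].
  apply: contra v0 => /eqP h; apply/eqP/malgP => D; apply/eqP.
  by rewrite mcoeff0 mcoeff_eq0 -[_ \in _]/(D \in (msupp v : seq _)) h.
case/(exists_maximal_size (fun D : reg_diagram d => size (dot_list (val D)))) => D0 D0v maxD0.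
(* The size of the representation depends on v: D0 has the most dots in its support, and there is
   one auxiliary strand for each of them. *)
set n := size (dot_list (val D0)) in maxD0.
have [f0 ff0 Df0] := brauer_form (Defs.shape (val D0)).
have [g0 fg0 _] := @stack_mx_monomial C n d w hw (val D0) f0 ff0 Df0.
have [g pg tg] := @pulls_exist n d (dot_list (val D0)) g0 (extends_touched fg0) (leqnn _).
have /(congr1 (fun M => cf g (M *m vecc C 1%g))) := stack_mx_ideal n char0 Iv.
rewrite mul0mx cf0 /as_stacks raddf_sum mulmx_suml cf_sum.
rewrite (bigD1_seq D0) ?fset_uniq //= big_seq_cond big1 ?addr0.
  rewrite [stack_mx _ _]stack_mxZ -scalemxAl cfZ.
  have [b ->] := cf_monomial (valP D0) (valP D0) ff0 Df0 fg0 pg tg (leqnn _).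
  rewrite eqxx => /eqP; rewrite mulf_eq0 signr_eq0 orbF.
  by move: D0v; rewrite -mcoeff_neq0 => /negPf->.
move=> D /andP[Dv DD0].
rewrite [stack_mx _ _]stack_mxZ -scalemxAl cfZ.
have [b ->] := cf_monomial (valP D0) (valP D) ff0 Df0 fg0 pg tg (maxD0 _ Dv).
by rewrite (inj_eq val_inj) (negPf DD0) mulr0.
Qed.
End Independence.

(** * The diagram algebra *)

(** Both sides of a relation are fixed expressions in the generators, so relations between images
    are images of relations. This shows that the quotient satisfies the presentation. *)
Lemma relation_lift d (A B : nzRingType) (f : {rmorphism A -> B})
    (s e : 'I_d.-1 -> A) (y : 'I_d -> A) l r :
  relation (f \o s) (f \o e) (f \o y) l r ->
  exists l' r', [/\ relation s e y l' r', l = f l' & r = f r'].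
Proof.
pose fE := (rmorphM f, rmorphB f, rmorphN f, rmorph0 f, rmorph1 f, rmorphXn f).
have lift l' r' l0 r0 : relation s e y l' r' -> l0 = f l' -> r0 = f r' ->
    exists l' r', [/\ relation s e y l' r', l0 = f l' & r0 = f r'].
  by move=> h -> ->; exists l', r'.
case.
- by move=> a; apply: lift (P1 s e y a) _ _; rewrite ?fE.
- by move=> a b h; apply: lift (P2_far s e y h) _ _; rewrite ?fE.
- by move=> a b h; apply: lift (P2_braid s e y h) _ _; rewrite ?fE.
- by move=> a i h h'; apply: lift (P2_y s e y h h') _ _; rewrite ?fE.
- by move=> a; apply: lift (P3 s e y a) _ _; rewrite ?fE.
- by move=> a i h h'; apply: lift (P4 s e y h h') _ _; rewrite ?fE.
- by move=> a b h; apply: lift (P5_se s e y h) _ _; rewrite ?fE.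
- by move=> a b h; apply: lift (P5_ee s e y h) _ _; rewrite ?fE.
- by move=> a i h h'; apply: lift (P5_ey s e y h h') _ _; rewrite ?fE.
- by move=> i j; apply: lift (P5_yy s e y i j) _ _; rewrite ?fE.
- by move=> a; apply: lift (P6_es s e y a) _ _; rewrite ?fE.
- by move=> a; apply: lift (P6_se s e y a) _ _; rewrite ?fE.
- by move=> a b h; apply: lift (P6_see s e y h) _ _; rewrite ?fE.
- by move=> a b h; apply: lift (P6_ees s e y h) _ _; rewrite ?fE.
- by move=> a b h; apply: lift (P6_ees' s e y h) _ _; rewrite ?fE.
- by move=> a b h; apply: lift (P6_see' s e y h) _ _; rewrite ?fE.
- by move=> a b h; apply: lift (P6_eee' s e y h) _ _; rewrite ?fE.
- by move=> a b h; apply: lift (P6_eee s e y h) _ _; rewrite ?fE.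
- by move=> a; apply: lift (P7_sy s e y a) _ _; rewrite ?fE.
- by move=> a; apply: lift (P7_ys s e y a) _ _; rewrite ?fE.
- by move=> a; apply: lift (P8_l s e y a) _ _; rewrite ?fE.
by move=> a; apply: lift (P8_r s e y a) _ _; rewrite ?fE.
Qed.

Lemma lrmorph_context (K : pzRingType) (A B : lalgType K) (f : {lrmorphism A -> B}) t c u v l r :
  f l = f r -> f (t + c *: (u * l * v)) = f (t + c *: (u * r * v)).
Proof. by move=> E; rewrite !linearD !linearZ /= !rmorphM /= E. Qed.

Lemma rmorph_circle (A B : pzRingType) (f : {rmorphism A -> B}) a x z m n :
  f (a * x ^+ m * z ^+ n * a) = f a * f x ^+ m * f z ^+ n * f a.
Proof. by rewrite !rmorphM !rmorphXn. Qed.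

Lemma rmorph_dots (A B : pzRingType) (f : {rmorphism A -> B}) d (a : 'I_d -> A) t b x :
  f ((\prod_(k < d) a k ^+ t k) * x * \prod_(k < d) a k ^+ b k)
  = (\prod_(k < d) f (a k) ^+ t k) * f x * \prod_(k < d) f (a k) ^+ b k.
Proof.
rewrite !rmorphM !rmorph_prod.
by congr (_ * _ * _); apply: eq_bigr => k _; rewrite rmorphXn.
Qed.

(** Transport of structure along a linear bijection. *)
Lemma pullback_product (C : fieldType) (V : lmodType C) (A : algType C)
    (Phi : {linear V -> A}) (Psi : A -> V) (one : V) :
  cancel Phi Psi -> cancel Psi Phi -> Phi one = 1 ->
  let mul x y := Psi (Phi x * Phi y) in
  [/\ (forall x, linear (mul x)) /\ (forall y, linear (mul^~ y)),
      [/\ associative mul, left_id one mul & right_id one mul],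
      (forall v x y, Phi v = Phi x * Phi y <-> v = mul x y),
      (forall x y, Phi x * Phi y = 0 -> mul x y = 0)
    & forall x y c z, Phi x * Phi y = c *: Phi z -> mul x y = c *: z].
Proof.
move=> PhiK PsiK Phi1 mul; have inj := can_inj PhiK.
have PhiM x y : Phi (mul x y) = Phi x * Phi y by apply: PsiK.
split.
- split=> x c u v; apply: inj; rewrite [RHS]linearP /= !PhiM linearP /=.
    by rewrite mulrDr scalerAr.
  by rewrite mulrDl scalerAl.
- by split=> [x y z|x|x]; apply: inj; rewrite !PhiM ?mulrA // Phi1 ?mul1r ?mulr1.
- by move=> v x y; rewrite -PhiM; split=> [/inj|->].
- by move=> x y E; apply: inj; rewrite PhiM raddf0.
by move=> x y c z E; apply: inj; rewrite PhiM linearZ.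
Qed.

(** * Diagrammatic moves and equality in the algebra *)

Section Moves.
Variables (C : fieldType) (d : nat).
Local Notation stacks := (stacks C d).
Local Notation moves := (clos_refl_trans stacks (@move_step C d)).

Lemma malgUU (u v : {fmonom (generator d)}) : << u >> * << v >> = << mmul u v >> :> stacks.
Proof. by rewrite malgM_def fgmulUU mulr1. Qed.

Lemma stacks_ind (P : stacks -> Prop) : P 0 ->
  (forall (a : C) (u : {fmonom (generator d)}) x, P x -> P (a *: << u >> + x)) ->
  forall x, P x.
Proof.
move=> P0 PD x.
have -> : x = \sum_(u <- msupp x) x@_u *: << u >>.
  rewrite {1}[x]monalgE; apply: eq_bigr => u _; apply/malgP => v.
  by rewrite mcoeffZ !mcoeffU mulr_natr.
by elim: (enum_fset _) => [|u us IH]; rewrite ?big_nil // big_cons; apply: PD.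
Qed.

(** A move happens inside a single stack, with one word above and one below. Quantifying over these
    words lets the induction pass products, whose other factor is first expanded into words. *)
Lemma ideal_moves x : in_ideal x ->
  forall (c : C) (u v : {fmonom (generator d)}) z, moves (z + c *: (<< u >> * x * << v >>)) z.
Proof.
elim=> [|l r lr|{}x y _ IHx _ IHy|{}x y _ IHy|{}x y _ IHx] c u v z.
- by rewrite mulr0 mul0r scaler0 addr0; apply: rt_refl.
(* The right-hand side of the relation is taken out of z, and the move puts it back in place of the
   left-hand side. *)
- rewrite mulrBr mulrBl scalerBr addrCA addrC.
  rewrite -[X in moves _ X](subrK (c *: (<< u >> * r * << v >>))).
  by apply: rt_step; apply: move_lr.
- rewrite mulrDr mulrDl scalerDr addrA.
  by refine (rt_trans _ _ _ _ _ (IHy _ _ _ _) _); apply: IHx.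
- elim/stacks_ind: x z => [|a u' x IH] z.
    by rewrite !(mul0r, mulr0) scaler0 addr0; apply: rt_refl.
  rewrite mulrDl mulrDr mulrDl scalerDr addrA; apply: rt_trans (IH _) _.
  by rewrite -scalerAl -stacks_scaleAr -scalerAl scalerA mulrA malgUU; apply: IHy.
elim/stacks_ind: y z => [|a v' y IH] z.
  by rewrite !(mul0r, mulr0) scaler0 addr0; apply: rt_refl.
rewrite !mulrDr mulrDl scalerDr addrA; apply: rt_trans (IH _) _.
by rewrite -2!stacks_scaleAr -scalerAl scalerA -!mulrA malgUU mulrA; apply: IHx.
Qed.

Hypothesis char0 : forall k, k.+1%:R != 0 :> C.

Lemma proj_relation l r : relation (@fs C d) (@fe C d) (@fy C d) l r -> proj l = proj r.
Proof. by move=> lr; apply/proj_eqP/ideal_rel. Qed.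

Local Notation s := (fun a => proj (@fs C d a)).
Local Notation e := (fun a => proj (@fe C d a)).
Local Notation y := (fun i => proj (@fy C d i)).

Lemma periplectic_relation (l r : periplectic C d) : relation s e y l r -> l = r.
Proof. move=> lr; have [l' [r' [/proj_relation E -> ->]]] := @relation_lift d _ _ (@proj C d) (@fs C d) (@fe C d) (@fy C d) l r lr.
exact: E. Qed.

Lemma periplectic_torsion_free (x : periplectic C d) k : x *+ k.+1 = 0 -> x = 0.
Proof. by move=> /eqP; rewrite -scaler_nat scaler_eq0 (negPf (char0 k)) => /eqP. Qed.

Lemma move_step_proj (x z : stacks) : move_step x z -> proj x = proj z.
Proof.
case=> [t c u v l r lr|t c u v l r lr|t c u v a m n].
- by apply: (lrmorph_context (f := @proj C d)); apply: proj_relation.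
- by apply: (lrmorph_context (f := @proj C d)); apply/esym/proj_relation.
rewrite -[X in _ = proj X]addr0 -[X in _ = proj (_ + X)](scaler0 _ c).
rewrite -[X in _ = proj (_ + _ *: X)](mul0r << v >>) -[X in _ = proj (_ + _ *: (X * _))](mulr0 << u >>).
apply: (lrmorph_context (f := @proj C d)).
rewrite rmorph_circle; rewrite [RHS](raddf0 (@proj C d)).
exact: (circle periplectic_relation periplectic_torsion_free).
Qed.

Lemma movesP (x z : stacks) : moves x z <-> proj x = proj z.
Proof.
split=> [|/proj_eqP/ideal_moves h].
  by elim=> [? ? /move_step_proj//|//|? ? ? _ -> _ ->].
have := h 1 mone mone z; have -> : << mone >> = 1 :> stacks by [].
by rewrite scale1r mul1r mulr1 addrC subrK.
Qed.
End Moves.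

(** * The regular monomials as a basis of the algebra *)

Section Basis.
Variables (C : fieldType) (d : nat).
Hypothesis char0 : forall k, k.+1%:R != 0 :> C.
Variables (w : brauer d -> seq (letter d)) (hw : word_choice w).
Local Notation stacks := (stacks C d).
Local Notation s := (fun a => proj (@fs C d a)).
Local Notation e := (fun a => proj (@fe C d a)).
Local Notation y := (fun i => proj (@fy C d i)).

Lemma led_proj (x : stacks) : exists n, led s e y n (proj x).
Proof.
elim/stacks_ind: x => [|a u x [n hn]]; first by exists 0%N; rewrite raddf0; apply: led0.
have [m hm] : exists m, led s e y m (proj (<< u >> : stacks)).
  case: u => us; elim: us => [|g us [m IH]].
    by exists 0%N; rewrite -fmE; apply: led1.
  have -> : << FMonom (g :: us) >> = fgen C g * << FMonom us >> :> stacks.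
    rewrite malgUU; congr (<< _ >>); apply/eqP; rewrite -val_eqE /=.
    by rewrite fmM fmU.
  rewrite rmorphM; case: g => [[a'|a']|i].
  - by exists m; apply: (ledS (s := s)).
  - by exists m; apply: (ledE (e := e)).
  - by exists m.+1; apply: (ledY (y := y)).
exists (m + n)%N; rewrite linearP; apply: ledD.
  by apply: ledZ; apply: led_mono hm; rewrite leq_addr.
by apply: led_mono hn; rewrite leq_addl.
Qed.

Lemma as_stacksE (E : {fset reg_diagram d}) (v : dot_space C d) : (msupp v `<=` E)%fset ->
  as_stacks w v = \sum_(D <- E) v@_D *: dot_stack C w (val D).
Proof.
move=> le; rewrite [LHS](big_fset_incl _ le) => //= D _ /mcoeff_outdom->.
by rewrite scale0r.
Qed.

Lemma as_stacks_linear : linear (@as_stacks C d w).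
Proof.
move=> c u v.
have le : (msupp (c *: u + v) `<=` msupp u `|` msupp v)%fset.
  apply/fsubsetP => D; rewrite in_fsetU -!mcoeff_neq0; apply: contraNT.
  rewrite negb_or !negbK => /andP[/eqP u0 /eqP v0].
  by rewrite mcoeffD mcoeffZ u0 v0 mulr0 addr0.
rewrite (as_stacksE le) (as_stacksE (fsubsetUl _ (msupp v))) (as_stacksE (fsubsetUr (msupp u) _)).
rewrite scaler_sumr -big_split; apply: eq_bigr => D _.
by rewrite mcoeffD mcoeffZ scalerDl scalerA.
Qed.

Definition realize (v : dot_space C d) : periplectic C d := proj (as_stacks w v).
Lemma realize_linear : linear realize.
Proof. by move=> c u v; rewrite /realize as_stacks_linear linearP. Qed.
HB.instance Definition _ :=
  GRing.isLinear.Build C (dot_space C d) (periplectic C d) _ realize realize_linear.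

Lemma realize_basis D : realize (basis C D) = dot_monomial C w (val D).
Proof.
rewrite /realize (as_stacksE (E := [fset D]%fset)); last exact: msuppU_le.
by rewrite big_seq_fset1 mcoeffUU scale1r.
Qed.

Lemma realize_inj : injective realize.
Proof.
apply: raddf_inj => v; exact: (dot_monomials_free char0 hw).
Qed.

Local Notation R := (sperm s).
Local Notation ee := (ecup s e).
Let rel : forall l r, relation s e y l r -> l = r := @periplectic_relation C d.
Let rep : periplectic_rep R ee := ecup_rep rel.

Lemma proj_word l : proj (\prod_(g <- l) fgen C (inl g)) = wval R ee l.
Proof.
rewrite rmorph_prod; apply: eq_bigr => -[a|a] _ /=; first by rewrite (sperm_adj rel).
by rewrite (ecupE rel).
Qed.

Lemma dot_monomialE D : dot_monomial C w D = monomial s e y w D.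
Proof.
by rewrite /monomial -proj_word; apply: (rmorph_dots (@proj C d)).
Qed.

Lemma realize_surj x : exists v, realize v = x.
Proof.
have [z <-] : exists z, proj z = x by eexists; apply: projK.
have [n] := led_proj z => /(led_span rel (periplectic_torsion_free char0) hw).
elim=> [|c u {}x [D rD ->] _ [v <-]]; first by exists 0; rewrite raddf0.
exists (c *: basis C (exist _ D rD) + v).
by rewrite realize_linear realize_basis dot_monomialE.
Qed.

Definition unrealize x : dot_space C d := sval (cid (realize_surj x)).
Lemma unrealizeK : cancel unrealize realize.
Proof. by move=> x; rewrite /unrealize; case: cid. Qed.
Lemma realizeK : cancel realize unrealize.
Proof. by move=> v; apply: realize_inj; rewrite unrealizeK. Qed.

Lemma realize_undotted g : realize (basis C (undotted g)) = wval R ee (w g).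
Proof.
rewrite realize_basis dot_monomialE /monomial !big1 ?mul1r ?mulr1 // => k _;
  by rewrite /top_dots /bot_dots /= ffunE expr0.
Qed.

Lemma wval_id_diag : wval R ee (w (id_diag d)) = 1.
Proof. by have [h1 h2 _ _] := hw; apply: (wval_id rep); rewrite ?h1 ?h2. Qed.

Lemma realize_line i : realize (basis C (dotted_line i)) = y i.
Proof.
rewrite realize_basis dot_monomialE /monomial wval_id_diag mulr1.
rewrite [X in _ * X]big1 ?mulr1 => [|k _]; last by rewrite /bot_dots /= ffunE expr0.
rewrite (eq_bigr (fun k => if k == i then y k else 1)) => [|k _].
  by rewrite -big_mkcond big_pred1_eq.
by rewrite /top_dots /= ffunE; case: eqP.
Qed.

Lemma words_mul (g1 g2 : brauer d) (F : brauer d -> periplectic C d) :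
  (forall g, F g = wval R ee (w g)) ->
  if closed_loop (val g1) (val g2) then F g1 * F g2 = 0
  else exists (g : brauer d) (b : bool), val g = concat (val g1) (val g2) /\
    F g1 * F g2 = (-1) ^+ b *: F g.
Proof.
move=> FE; rewrite !FE; have [h1 h2 _ _] := hw.
have mE l := wval_mul rep l (h2 g1) (h2 g2).
(* With a loop the conclusion does not involve the third word, so the empty one serves as a
   dummy. *)
rewrite !h1 in mE; case: ifP mE => [cl mE|ncl mEN]; first exact: (mE [::]).
have [f ff gf] := brauer_form g2.
have [cE concE] := word_stack ff (h2 g1).
move: concE; rewrite -cE h1 -gf ncl => /(_ isT) concE.
have [wK wn] := wact_fpf (w g1) ff.
have Bc : is_brauer (concat (val g1) (val g2)) by rewrite concE; apply: edges_of_brauer.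
have [g gE] : exists g : brauer d, val g = concat (val g1) (val g2) by exists (exist (@is_brauer d) _ Bc).
have [|b bE] := mEN (w g) (h2 g); first by rewrite h1.
exists g, b; split; first exact: gE.
by rewrite bE FE mulr_sign scaler_sign.
Qed.
End Basis.

Theorem theorem6p8 (R : realType) (d : nat) (hd : (0 < d)%N)
    (w : brauer d -> seq (letter d)) (hw : word_choice w) :
  exists mul : dot_space R[i] d -> dot_space R[i] d -> dot_space R[i] d,
  [/\ (forall x, linear (mul x)) /\ (forall y, linear (mul^~ y)),
      forall (D1 D2 : reg_diagram d) (v : dot_space R[i] d),
        evaluates w (dot_stack R[i] w (val D1) * dot_stack R[i] w (val D2)) v
        <-> v = mul (basis R[i] D1) (basis R[i] D2),
      forall g1 g2 : brauer d,
        if closed_loop (val g1) (val g2)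
        then mul (basis R[i] (undotted g1)) (basis R[i] (undotted g2)) = 0
        else exists (g : brauer d) (b : bool),
          val g = concat (val g1) (val g2) /\
          mul (basis R[i] (undotted g1)) (basis R[i] (undotted g2))
            = (-1) ^+ b *: basis R[i] (undotted g),
      [/\ associative mul,
          left_id (basis R[i] (undotted (id_diag d))) mul
        & right_id (basis R[i] (undotted (id_diag d))) mul]
    & exists Phi : {linear dot_space R[i] d -> periplectic R[i] d},
      [/\ bijective Phi,
          Phi (basis R[i] (undotted (id_diag d))) = 1
            /\ {morph Phi : x y / mul x y >-> x * y},
          (forall a, Phi (basis R[i] (undotted (s_diag a))) = proj (fs R[i] a))
            /\ (forall a,
                  Phi (basis R[i] (undotted (eps_diag a))) = proj (fe R[i] a)),
          forall i, Phi (basis R[i] (dotted_line i)) = proj (fy R[i] i)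
        & forall D : reg_diagram d,
            Phi (basis R[i] D) = dot_monomial R[i] w (val D)]].
Proof.
have char0 k : k.+1%:R != 0 :> R[i] by rewrite Num.Theory.pnatr_eq0.
have [_ _ ws we] := hw.
pose Phi : {linear dot_space R[i] d -> periplectic R[i] d} := @realize R[i] d w.
have PhiB D : Phi (basis R[i] D) = dot_monomial R[i] w (val D) := @realize_basis R[i] d w D.
have PhiU := @realize_undotted R[i] d w : forall g, Phi (basis R[i] (undotted g)) = _.
have Phi1 : Phi (basis R[i] (undotted (id_diag d))) = 1 := etrans (PhiU _) (@wval_id_diag R[i] d w hw).
have PhiK := realizeK char0 hw : cancel Phi _.
have PsiK := unrealizeK char0 hw : cancel _ Phi.
have [lin unital mulP mul0 mulZ] := pullback_product PhiK PsiK Phi1.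
(* The witness, the product transported along [Phi], is found by unification with [lin]. *)
eexists; split.
- exact: lin.
- move=> D1 D2 v; apply: iff_trans (mulP v _ _).
  apply: iff_trans (movesP char0 _ _) _.
  have PD : Phi (basis R[i] D1) * Phi (basis R[i] D2) =
      proj (dot_stack R[i] w (val D1) * dot_stack R[i] w (val D2)).
    apply: etrans (congr2 _ (PhiB D1) (PhiB D2)) _.
    exact: (esym (rmorphM (@proj R[i] d) (dot_stack R[i] w (val D1)) (dot_stack R[i] w (val D2)))).
  have Pv : Phi v = proj (as_stacks w v) by [].
  split=> E; first by refine (etrans Pv (etrans _ (esym PD))); apply: esym E.
  by refine (etrans (esym PD) (etrans _ Pv)); apply: esym E.
- move=> g1 g2; have := @words_mul R[i] d w hw g1 g2 _ PhiU; case: ifP => _; first exact: mul0.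
  by move=> [g [b [gE E]]]; exists g, b; split; [exact: gE | exact: mulZ E].
- exact: unital.
exists Phi; split.
- by exists (unrealize char0 hw).
- by split; [exact: Phi1 | move=> x y; apply: PsiK].
- split=> a; apply: etrans (PhiU _) _; rewrite ?ws ?we /wval big_seq1.
    exact: (sperm_adj (@periplectic_relation _ _)).
  exact: (ecupE (@periplectic_relation _ _)).
- exact: (@realize_line R[i] d w hw).
exact: PhiB.
Qed.
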